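(* Let $k$ be a field of characteristic zero, $X$ a geometrically connected variety over $k$, $\overline U<\pi_1(\overline X)$ a closed subgroup normal in $\pi_1(X)$, $\overline A=\pi_1(\overline X)/\overline U$, $(k_i)_{i\in I}$ a family of field extensions of $k$ with restriction maps $\theta_i:\Gamma_i\to\Gamma_k$, and $(s_i:\Gamma_i\to\pi_1^U(X))_{i\in I}$ a tuple of section maps (all as described in the context). Consider the assertions: (a) For every finite $k$-group scheme $G$ and every $\alpha\in H^1(X,G)$ such that the corresponding element $\bar\alpha\in H^1(\overline X,\overline G)$ has trivial restriction to $\overline U$, the family $(\alpha(s_i))\in\prod_{i\in I}H^1(k_i,G)$ belongs to the diagonal image of $H^1(k,G)$. (a'') For every finite $k$-group scheme $G$ and every $\alpha\in H^1(X,G)$ such that the corresponding element $\bar\alpha\in H^1(\overline X,\overline G)$ has trivial restriction to $\overline U$ and is surjective (equivalently, the $G$-torsor $Y\to X$ corresponding to $\alpha$ is geometrically connected), the family $(\alpha(s_i))\in\prod_{i\in I}H^1(k_i,G)$ belongs to the diagonal image of $H^1(k,G)$. (c) There exists a section $s:\Gamma_k\to\pi_1^U(X)$ of the exact sequence $(E_U)$: $1\to\overline A\to\pi_1^U(X)\to\Gamma_k\to1$ such that for each $i\in I$ we have $s_i=s\circ\theta_i$ up to conjugation by an element of $\overline A$. Then (c) implies (a), and (a) implies (a''). If moreover $(E_U)$ admits a section $s_0$ and ($\ast$) for every finite constant $k$-group scheme $G$ the fibres of the diagonal map $H^1(k,G)\to\prod_{i\in I}H^1(k_i,G)$ are finite,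 then (a), (a'') and (c) are all equivalent.
   Context: Let $k$ be a field of characteristic zero with algebraic closure $\bar k$, $\Gamma_k=\mathrm{Gal}(\bar k/k)$, and $X$ a geometrically connected variety over $k$ with a fixed geometric point $\bar x\in X(\bar k)$; $\overline X=X\times_k\bar k$. Étale fundamental groups $\pi_1(X)=\pi_1(X,\bar x)$, $\pi_1(\overline X)=\pi_1(\overline X,\bar x)$ sit in the fundamental exact sequence $1\to\pi_1(\overline X)\to\pi_1(X)\to\Gamma_k\to1$. Let $\overline U<\pi_1(\overline X)$ be a closed subgroup normal in $\pi_1(X)$, $\overline A=\pi_1(\overline X)/\overline U$, $\pi_1^U(X)=\pi_1(X)/\overline U$; there is an exact sequence $1\to\overline A\to\pi_1^U(X)\to\Gamma_k\to1$. All homomorphisms and sections are continuous. Let $(k_i)_{i\in I}$ be a family of field extensions of $k$; fix algebraic closures $\bar k_i$ and embeddings $\bar k\to\bar k_i$ over $k\subset k_i$, and let $\Gamma_i=\mathrm{Gal}(\bar k_i/k_i)$ with restriction maps $\theta_i:\Gamma_i\to\Gamma_k$. Put $X_i=X\times_kk_i$ with the induced geometric point $\bar x_i$ above $\bar x$. For each $i$ let $\sigma_i:\Gamma_i\to\pi_1(X_i,\bar x_i)$ be a section of the fundamental exact sequence of $X_i$; the associated section map is the composite $s_i:\Gamma_i\xrightarrow{\sigma_i}\pi_1(X_i)\to\pi_1(X)\to\pi_1^U(X)$. For a finite $k$-group scheme $G$, $H^1(X,G)=H^1(\pi_1(X),G(\bar k))$ with $\pi_1(X)$ acting through $\Gamma_k$,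 and $H^1(\overline X,\overline G)$ ($\overline G=G\times_k\bar k$) is the set of continuous homomorphisms $\pi_1(\overline X)\to G(\bar k)$ up to conjugation in $G(\bar k)$; $\bar\alpha$ is called surjective if such a homomorphism representing it is surjective. If $\alpha\in H^1(X,G)$ has image $\bar\alpha\in H^1(\overline X,\overline G)$ with trivial restriction to $\overline U$, then $\alpha$ comes from a unique class in $H^1(\pi_1^U(X),G(\bar k))$, and $\alpha(s_i):=s_i^*(\alpha)\in H^1(\Gamma_i,G(\bar k))=H^1(k_i,G)$, where $\Gamma_i$ acts on $G(\bar k)$ via $\theta_i$. *)

(* Defs.v *)
(* Schemes over a field, their finite etale covers and finite group schemes are
   encoded by their functors of points; the etale fundamental group is the
   automorphism group of the fibre functor, as in SGA 1.  Library: MathComp and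
   MathComp-Analysis. *)
From HB Require Import structures.
From mathcomp Require Import all_boot all_order all_fingroup all_algebra.
From mathcomp Require Import all_classical.

Set Implicit Arguments.
Unset Strict Implicit.
Unset Printing Implicit Defensive.

Import GRing.Theory.
Local Open Scope classical_set_scope.
Local Open Scope ring_scope.

(** * Commutative rings and algebras *)

(* Algebras are based on [comPzRingType] because the zero ring is needed: it is
   a localization, and the empty cover is the spectrum of the zero ring. *)
Record alg (k : comPzRingType) := Alg {
  alg_ring :> comPzRingType;
  alg_map : {rmorphism k -> alg_ring} }.
Arguments Alg {k} alg_ring alg_map.
Arguments alg_map {k} a.

Record ahom (k : comPzRingType) (A B : alg k) := AHom {
  ahom_fun :> {rmorphism A -> B};
  ahomE : forall c : k, ahom_fun (alg_map A c) = alg_map B c }.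

Definition res (k K : comPzRingType) (kK : {rmorphism k -> K}) (A : alg K)
  : alg k := Alg A (alg_map A \o kK).

Definition res_hom (k K : comPzRingType) (kK : {rmorphism k -> K})
  (A B : alg K) (f : ahom A B) : ahom (res kK A) (res kK B) :=
  @AHom k (res kK A) (res kK B) f (fun c => ahomE f (kK c)).

Definition unit_ideal (R : comPzRingType) (J : set R) : Prop :=
  exists (n : nat) (c a : 'I_n -> R),
    (forall i, J (a i)) /\ \sum_(i < n) c i * a i = 1.

Definition is_localization (k : comPzRingType) (R S : alg k) (l : ahom R S)
  (f : R) : Prop :=
  (exists u, l f * u = 1) /\
  forall (T : alg k) (t : ahom R T), (exists u, t f * u = 1) ->
    exists h : ahom S T, h \o l =1 t /\
      forall h' : ahom S T, h' \o l =1 t -> h' =1 h.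

Definition finitely_generated_algebra (k : comPzRingType) (A : alg k) : Prop :=
  exists (n : nat) (a : 'I_n -> A), forall S : set A,
    (forall c, S (alg_map A c)) -> (forall i, S (a i)) ->
    (forall x y, S x -> S y -> S (x + y)) ->
    (forall x y, S x -> S y -> S (x * y)) -> S = setT.

Definition finite_morphism (R B : comPzRingType) (phi : {rmorphism R -> B})
  : Prop :=
  exists (n : nat) (e : 'I_n -> B), forall b, exists c : 'I_n -> R,
    b = \sum_(i < n) phi (c i) * e i.

(* For a finite R-algebra, being of finite presentation as an algebra amounts
   to being of finite presentation as a module (EGA IV 1.4.7): finitely many
   generators [e], with a finitely generated module of relations [r]. *)
Definition finitely_presented_module (R B : comPzRingType)
  (phi : {rmorphism R -> B}) : Prop :=
  exists (n m : nat) (e : 'I_n -> B) (r : 'I_m -> 'I_n -> R),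
    (forall b, exists c : 'I_n -> R, b = \sum_(i < n) phi (c i) * e i) /\
    (forall c : 'I_n -> R, \sum_(i < n) phi (c i) * e i = 0 <->
       exists d : 'I_m -> R, forall i, c i = \sum_(j < m) d j * r j i).

Definition formally_etale (R B : comPzRingType) (phi : {rmorphism R -> B})
  : Prop :=
  forall (S S' : comPzRingType) (q : {rmorphism S -> S'})
    (sigma : {rmorphism R -> S}) (g : {rmorphism B -> S'}),
    (forall s', exists s, q s = s') ->
    (forall s t, q s = 0 -> q t = 0 -> s * t = 0) ->
    g \o phi =1 q \o sigma ->
    exists f : {rmorphism B -> S}, (f \o phi =1 sigma /\ q \o f =1 g) /\
      forall f' : {rmorphism B -> S},
        f' \o phi =1 sigma -> q \o f' =1 g -> f' =1 f.

Definition finite_etale (R B : comPzRingType) (phi : {rmorphism R -> B})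
  : Prop := finitely_presented_module phi /\ formally_etale phi.

(** * Functors of points and varieties *)

(* The two laws are stated up to pointwise equality of morphisms. *)
Record kfun (k : comPzRingType) := KFun {
  pts :> alg k -> Type;
  kmap : forall A B : alg k, ahom A B -> pts A -> pts B;
  kmap_id : forall (A : alg k) (f : ahom A A) x, f =1 id -> kmap f x = x;
  kmap_comp : forall (A B C : alg k) (f : ahom A B) (g : ahom B C)
    (h : ahom A C) x, h =1 g \o f -> kmap h x = kmap g (kmap f x) }.
Arguments kmap {k} X {A B} f x : rename.

Definition base_change (k K : comPzRingType) (kK : {rmorphism k -> K})
  (X : kfun k) : kfun K :=
  @KFun K (fun A => X (res kK A)) (fun A B f => kmap X (res_hom kK f))
    (fun A f x fE => @kmap_id k X (res kK A) (res_hom kK f) x fE)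
    (fun A B C f g h x hE => @kmap_comp k X (res kK A) (res kK B) (res kK C)
      (res_hom kK f) (res_hom kK g) (res_hom kK h) x hE).

Definition point_scheme (k : comPzRingType) : kfun k :=
  @KFun k (fun=> unit) (fun _ _ _ x => x) (fun _ _ _ _ => erefl)
    (fun _ _ _ _ _ _ _ _ => erefl).

Definition zariski_sheaf (k : comPzRingType) (X : kfun k) : Prop :=
  forall (R : alg k) (n : nat) (f : 'I_n -> R) (L : 'I_n -> alg k)
    (l : forall i, ahom R (L i)),
    (exists c : 'I_n -> R, \sum_(i < n) c i * f i = 1) ->
    (forall i, is_localization (l i) (f i)) ->
    forall x : (forall i, X (L i)),
    (forall i j (T : alg k) (u : ahom (L i) T) (v : ahom (L j) T),
       u \o l i =1 v \o l j -> kmap X u (x i) = kmap X v (x j)) ->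
    exists! x0 : X R, forall i, kmap X (l i) x0 = x i.

(* The points of the underlying topological space are represented by the
   points with values in fields. *)
Definition field_alg (k : comPzRingType) (L : fieldType)
  (kL : {rmorphism k -> L}) : alg k := Alg L kL.

Definition subfunctor (k : comPzRingType) (X : kfun k) :=
  forall R : alg k, set (X R).

Definition open_subfunctor (k : comPzRingType) (X : kfun k)
  (U : subfunctor X) : Prop :=
  forall (R : alg k) (x : X R), exists I : set R,
    forall (S : alg k) (f : ahom R S), U S (kmap X f x) <-> unit_ideal (f @` I).

Definition affine_finite_type (k : comPzRingType) (X : kfun k)
  (U : subfunctor X) : Prop :=
  exists (A : alg k) (u : X A), [/\ finitely_generated_algebra A, U A u &
    forall (R : alg k) (x : X R), U R x ->
      exists f : ahom A R, kmap X f u = x /\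
        forall f' : ahom A R, kmap X f' u = x -> f' =1 f].

(* Diagonal immersion closed. *)
Definition separated (k : comPzRingType) (X : kfun k) : Prop :=
  forall (R : alg k) (x y : X R), exists I : set R,
    forall (S : alg k) (f : ahom R S),
      kmap X f x = kmap X f y <-> (forall a, I a -> f a = 0).

(* Separated schemes of finite type. *)
Definition variety (k : fieldType) (X : kfun k) : Prop :=
  [/\ zariski_sheaf X, separated X &
   exists (n : nat) (U : 'I_n -> subfunctor X),
     (forall i, open_subfunctor (U i) /\ affine_finite_type (U i)) /\
     (forall (L : fieldType) (kL : {rmorphism k -> L}) (x : X (field_alg kL)),
        exists i, U i _ x)].

Definition has_point (k : comPzRingType) (X : kfun k) (U : subfunctor X)
  : Prop :=
  exists (L : fieldType) (kL : {rmorphism k -> L}), exists x, U (field_alg kL) x.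

Definition connected_scheme (k : comPzRingType) (X : kfun k) : Prop :=
  has_point (fun R => [set: X R]) /\
  forall U V : subfunctor X, open_subfunctor U -> open_subfunctor V ->
    (forall (L : fieldType) (kL : {rmorphism k -> L}) (x : X (field_alg kL)),
       (U _ x \/ V _ x) /\ ~ (U _ x /\ V _ x)) ->
    ~ has_point U \/ ~ has_point V.

(** * Topological groups *)

(* The fundamental group defined below quantifies over all covers and lives in
   a universe above the carriers of the Hierarchy-Builder structures
   ([choiceType], hence [groupType] and [topologicalType]), so a separate record
   is needed. *)
Declare Scope tgroup_scope.
Delimit Scope tgroup_scope with tg.

Record top_group := TopGroup {
  tg_sort :> Type;
  tg_one : tg_sort;
  tg_inv : tg_sort -> tg_sort;
  tg_mul : tg_sort -> tg_sort -> tg_sort;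
  tg_mulA : associative tg_mul;
  tg_mul1 : left_id tg_one tg_mul;
  tg_mulV : left_inverse tg_one tg_inv tg_mul;
  tg_open : (tg_sort -> Prop) -> Prop;
  tg_openT : tg_open (fun=> True);
  tg_openI : forall U V, tg_open U -> tg_open V ->
    tg_open (fun x => U x /\ V x);
  tg_openU : forall F : (tg_sort -> Prop) -> Prop,
    (forall U, F U -> tg_open U) -> tg_open (fun x => exists2 U, F U & U x);
  tg_mul_continuous : forall U x y, tg_open U -> U (tg_mul x y) ->
    exists V W, [/\ tg_open V, tg_open W, V x, W y &
      forall x' y', V x' -> W y' -> U (tg_mul x' y')];
  tg_inv_continuous : forall U, tg_open U -> tg_open (fun x => U (tg_inv x)) }.
Arguments tg_one {_}.
Arguments tg_inv {_} x.
Arguments tg_mul {_} x y.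
Arguments tg_open {_} U.

Notation "1" := tg_one : tgroup_scope.
Notation "x * y" := (tg_mul x y) : tgroup_scope.
Notation "x ^-1" := (tg_inv x) : tgroup_scope.
Bind Scope tgroup_scope with tg_sort.

Definition tg_closed (P : top_group) (C : P -> Prop) : Prop :=
  tg_open (fun x => ~ C x).

Definition tg_continuous (P Q : top_group) (f : P -> Q) : Prop :=
  forall U : Q -> Prop, tg_open U -> tg_open (fun x => U (f x)).

Definition continuous_hom (P Q : top_group) (f : P -> Q) : Prop :=
  tg_continuous f /\ {morph f : x y / (x * y)%tg}.

Section TopGroupTheory.
Local Open Scope tgroup_scope.
Variable P : top_group.
Implicit Types x y : P.

Lemma tg_mulKV x y : x^-1 * (x * y) = y.
Proof. by rewrite tg_mulA tg_mulV tg_mul1. Qed.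

Lemma tg_mulI x y z : x * y = x * z -> y = z.
Proof. by move=> e; rewrite -(tg_mulKV x y) e tg_mulKV. Qed.

Lemma tg_mulr1 x : x * 1 = x.
Proof. by apply: (@tg_mulI x^-1); rewrite tg_mulA tg_mulV tg_mul1. Qed.

Lemma tg_mulrV x : x * x^-1 = 1.
Proof. by apply: (@tg_mulI x^-1); rewrite tg_mulKV tg_mulr1. Qed.

Lemma tg_invK x : x^-1^-1 = x.
Proof. by apply: (@tg_mulI x^-1); rewrite tg_mulV tg_mulrV. Qed.

Lemma tg_invM x y : (x * y)^-1 = y^-1 * x^-1.
Proof.
apply: (@tg_mulI (x * y)); rewrite tg_mulrV -tg_mulA (tg_mulA y).
by rewrite tg_mulrV tg_mul1 tg_mulrV.
Qed.

Lemma tg_open_mulr U y : tg_open U -> tg_open (fun x => U (x * y)).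
Proof.
move=> Uo.
have -> : (fun x => U (x * y)) = (fun x => exists2 V : P -> Prop,
    tg_open V /\ (forall x', V x' -> U (x' * y)) & V x).
  apply/funext => x; apply/propext; split=> [Ux|[V [_ VU] Vx]]; last exact: VU.
  have [V [W [Vo _ Vx Wy VW]]] := tg_mul_continuous Uo Ux.
  by exists V => //; split=> // x' Vx'; exact: VW.
by apply: tg_openU => V [].
Qed.
End TopGroupTheory.

(* The group T with the topology of pointwise convergence for its action [act]
   on the discrete set I. *)
Section ActionGroup.
Variables (T I : Type) (e : T) (v : T -> T) (m : T -> T -> T).
Hypotheses (mA : associative m) (m1 : left_id e m) (mV : left_inverse e v m).
Variable act : T -> I -> I.
Hypotheses (act1 : forall i, act e i = i)
  (actM : forall g h i, act (m g h) i = act g (act h i)).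

Definition pointwise_open (U : T -> Prop) : Prop :=
  forall g, U g -> exists (n : nat) (a : 'I_n -> I),
    forall h, (forall i, act h (a i) = act g (a i)) -> U h.

Lemma pointwise_openT : pointwise_open (fun=> True).
Proof.
by move=> g _; exists 0%N, (fun i : 'I_0 => False_rect I (notF (ltn_ord i))).
Qed.

Lemma pointwise_openI U V : pointwise_open U -> pointwise_open V ->
  pointwise_open (fun x => U x /\ V x).
Proof.
move=> Uo Vo g [/Uo [n [a aU]] /Vo [p [b bV]]].
exists (n + p)%N, (fun i : 'I_(n + p) =>
  match fintype.split i with inl j => a j | inr j => b j end).
move=> h hg; split; [apply: aU | apply: bV] => i.
- by have := hg (lshift p i); rewrite (unsplitK (inl i)).
- by have := hg (rshift n i); rewrite (unsplitK (inr i)).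
Qed.

Lemma pointwise_openU (F : (T -> Prop) -> Prop) :
  (forall U, F U -> pointwise_open U) ->
  pointwise_open (fun x => exists2 U, F U & U x).
Proof.
move=> Fo g [U FU /(Fo U FU) [n [a aU]]].
by exists n, a => h /aU Uh; exists U.
Qed.

Lemma pointwise_mul U x y : pointwise_open U -> U (m x y) ->
  exists V W, [/\ pointwise_open V, pointwise_open W, V x, W y &
    forall x' y', V x' -> W y' -> U (m x' y')].
Proof.
move=> Uo /Uo [n [a aU]].
exists (fun x' => forall i, act x' (act y (a i)) = act x (act y (a i))).
exists (fun y' => forall i, act y' (a i) = act y (a i)); split=> //.
- by move=> g gP; exists n, (fun i => act y (a i)) => h hg i; rewrite hg.
- by move=> g gP; exists n, a => h hg i; rewrite hg.
- by move=> x' y' x'P y'P; apply: aU => i; rewrite !actM y'P.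
Qed.

Lemma pointwise_inv U : pointwise_open U -> pointwise_open (fun x => U (v x)).
Proof.
move=> Uo g /Uo [n [a aU]]; exists n, (fun i => act (v g) (a i)) => h hg.
apply: aU => i.
have gvg : act g (act (v g) (a i)) = a i.
  have vvg : v (v g) = g.
    have m1r x : m x e = x.
      have xV : m x (v x) = e.
        by rewrite -[LHS]m1 -{1}(mV (v x)) -mA (mA (v x)) mV m1 mV.
      by rewrite -(mV x) mA xV m1.
    by rewrite -[LHS]m1r -(mV g) mA mV m1.
  by rewrite -actM -{1}vvg mV act1.
by rewrite -{1}gvg -hg -actM mV act1.
Qed.

Definition action_group : top_group :=
  TopGroup mA m1 mV pointwise_openT pointwise_openI pointwise_openU
    pointwise_mul pointwise_inv.
End ActionGroup.

(** * Algebraic closures and Galois groups *)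

Record alg_closure (k : fieldType) := AlgClosure {
  cl_field :> closedFieldType;
  cl_in : {rmorphism k -> cl_field};
  cl_algebraic : forall a, exists2 p : {poly k},
    p != 0 & root (map_poly cl_in p) a }.
Arguments cl_in {k} c : rename.

Definition cl_alg (k : fieldType) (kb : alg_closure k) : alg k :=
  field_alg (cl_in kb).

Lemma self_closure_subproof (F : closedFieldType) (a : F) :
  exists2 p : {poly F}, p != 0 & root (map_poly idfun p) a.
Proof.
exists ('X - a%:P); first by rewrite polyXsubC_eq0.
by rewrite map_poly_id // root_XsubC.
Qed.

Definition self_closure (F : closedFieldType) : alg_closure F :=
  @AlgClosure F F idfun (@self_closure_subproof F).

Record field_extension (k : fieldType) (kb : alg_closure k) := FieldExtension {
  ext_field :> fieldType;
  ext_in : {rmorphism k -> ext_field};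
  ext_cl : alg_closure ext_field;
  ext_emb : {rmorphism kb -> ext_cl};
  ext_comm : forall a : k, ext_emb (cl_in kb a) = cl_in ext_cl (ext_in a) }.
Arguments ext_in {k kb} e : rename.
Arguments ext_cl {k kb} e : rename.
Arguments ext_emb {k kb} e : rename.

Definition closure_extension (k : fieldType) (kb : alg_closure k)
  : field_extension kb :=
  @FieldExtension k kb kb (cl_in kb) (self_closure kb) idfun (fun=> erefl).

Record gal (k : fieldType) (kb : alg_closure k) := Gal {
  gal_fun :> kb -> kb;
  gal_zmod : zmod_morphism gal_fun;
  gal_monoid : monoid_morphism gal_fun;
  gal_bij : bijective gal_fun;
  gal_fix : forall a : k, gal_fun (cl_in kb a) = cl_in kb a }.

HB.instance Definition _ k kb (g : @gal k kb) :=
  GRing.isZmodMorphism.Build kb kb (gal_fun g) (gal_zmod g).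
HB.instance Definition _ k kb (g : @gal k kb) :=
  GRing.isMonoidMorphism.Build kb kb (gal_fun g) (gal_monoid g).

Definition gal_hom (k : fieldType) (kb : alg_closure k) (g : gal kb)
  : ahom (cl_alg kb) (cl_alg kb) :=
  @AHom k (cl_alg kb) (cl_alg kb) (gal_fun g) (gal_fix g).

Section GaloisGroup.
Variables (k : fieldType) (kb : alg_closure k).
Implicit Types g h : gal kb.

Lemma gal_eq g h : g =1 h -> g = h.
Proof.
case: g h => [g g1 g2 g3 g4] [h h1 h2 h3 h4] /= /funext gh.
by case: h / gh h1 h2 h3 h4 => *; congr Gal; exact: Prop_irrelevance.
Qed.

Definition gal_one : gal kb :=
  @Gal k kb id (fun x y => erefl) (erefl, fun x y => erefl)
    (Bijective (fun=> erefl) (fun=> erefl)) (fun=> erefl).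

Lemma gal_mul_zmod g h : zmod_morphism (g \o h).
Proof. by move=> x y /=; rewrite !gal_zmod. Qed.

Lemma gal_mul_monoid g h : monoid_morphism (g \o h).
Proof. by split=> [|x y] /=; rewrite !gal_monoid. Qed.

Lemma gal_mul_fix g h a : (g \o h) (cl_in kb a) = cl_in kb a.
Proof. by rewrite /= !gal_fix. Qed.

Definition gal_mul g h : gal kb :=
  Gal (gal_mul_zmod g h) (gal_mul_monoid g h)
    (bij_comp (gal_bij g) (gal_bij h)) (gal_mul_fix g h).

Lemma gal_inv_subproof g : exists h, gal_mul h g = gal_one.
Proof.
have [f fK Kf] := gal_bij g.
have fz : zmod_morphism f.
  by move=> x y; apply: (can_inj fK); rewrite Kf gal_zmod !Kf.
have fm : monoid_morphism f.
  split=> [|x y]; apply: (can_inj fK); rewrite Kf ?(gal_monoid g).1 //.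
  by rewrite (gal_monoid g).2 !Kf.
have ff a : f (cl_in kb a) = cl_in kb a.
  by rewrite -{1}(gal_fix g a) fK.
by exists (Gal fz fm (Bijective Kf fK) ff); apply: gal_eq => x /=; rewrite fK.
Qed.

Definition gal_inv g : gal kb := projT1 (cid (gal_inv_subproof g)).

Lemma gal_mulA : associative gal_mul.
Proof. by move=> f g h; exact: gal_eq. Qed.
Lemma gal_mul1g : left_id gal_one gal_mul.
Proof. by move=> g; exact: gal_eq. Qed.
Lemma gal_mulVg : left_inverse gal_one gal_inv gal_mul.
Proof. by move=> g; exact: projT2 (cid (gal_inv_subproof g)). Qed.

(* Krull topology. *)
Definition gal_group : top_group :=
  action_group gal_mulA gal_mul1g gal_mulVg
    (act := @gal_fun k kb) (fun=> erefl) (fun _ _ _ => erefl).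
End GaloisGroup.

Definition choose_or (T : Type) (x0 : T) (P : T -> Prop) : T :=
  match pselect (exists x, P x) with
  | left ex => projT1 (cid ex)
  | right _ => x0
  end.

(* Existence and uniqueness of the value come from the normality of [kb] over
   [k]; the default value is never used.  The maps [pi1_map] and [pi1_proj]
   below are likewise selected by their characteristic property, which always
   has exactly one solution. *)
Definition gal_res (k : fieldType) (kb : alg_closure k) (e : field_extension kb)
  (g : gal (ext_cl e)) : gal kb :=
  choose_or (gal_one kb)
    (fun h => forall a, ext_emb e (h a) = g (ext_emb e a)).

(** * Finite etale covers and the fundamental group *)

(* Y -> X is finite etale: its pullback along any x : Spec R -> X is the
   spectrum of a finite etale R-algebra B, with universal point [y]. *)
Record etale_cover (k : comPzRingType) (X : kfun k) := EtaleCover {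
  cov :> kfun k;
  cov_proj : forall A : alg k, cov A -> X A;
  cov_proj_nat : forall (A B : alg k) (f : ahom A B) y,
    cov_proj (kmap cov f y) = kmap X f (cov_proj y);
  cov_finite_etale : forall (R : alg k) (x : X R),
    exists (B : alg k) (beta : ahom R B) (y : cov B),
    [/\ finite_etale beta, cov_proj y = kmap X beta x &
      forall (S : alg k) (sigma : ahom R S) (y' : cov S),
        cov_proj y' = kmap X sigma x ->
        exists f : ahom B S, (f \o beta =1 sigma /\ kmap cov f y = y') /\
          forall f' : ahom B S,
            f' \o beta =1 sigma -> kmap cov f' y = y' -> f' =1 f] }.
Arguments cov_proj {k X} Y {A} y : rename.

Definition natural (k : comPzRingType) (Y Z : kfun k)
  (f : forall A, Y A -> Z A) : Prop :=
  forall (A B : alg k) (h : ahom A B) y, f B (kmap Y h y) = kmap Z h (f A y).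

Definition fibre (k : comPzRingType) (X : kfun k) (Y : etale_cover X) (A : alg k)
  (x : X A) := {y : Y A | cov_proj Y y = x}.

Record pi1 (k : fieldType) (kb : alg_closure k) (X : kfun k) (x : X (cl_alg kb)) :=
  Pi1 {
  pi1_act : forall Y : etale_cover X, fibre Y x -> fibre Y x;
  pi1_bij : forall Y, bijective (@pi1_act Y);
  pi1_nat : forall (Y Y' : etale_cover X) (f : forall A, Y A -> Y' A),
    natural f -> (forall A y, cov_proj Y' (f A y) = cov_proj Y y) ->
    forall (y : fibre Y x) (y' : fibre Y' x), sval y' = f _ (sval y) ->
      sval (pi1_act y') = f _ (sval (pi1_act y)) }.
Arguments pi1_act {k kb X x} p Y y : rename.

Section FundamentalGroup.
Variables (k : fieldType) (kb : alg_closure k) (X : kfun k) (x : X (cl_alg kb)).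
Implicit Types g h : pi1 x.

Lemma pi1_eq g h : (forall Y, pi1_act g Y =1 pi1_act h Y) -> g = h.
Proof.
case: g h => [g g1 g2] [h h1 h2] /= gh.
have {}gh : g = h by apply: functional_extensionality_dep => Y; apply/funext.
by case: h / gh h1 h2 => *; congr Pi1; exact: Prop_irrelevance.
Qed.

Definition pi1_one : pi1 x :=
  @Pi1 k kb X x (fun _ y => y) (fun=> Bijective (fun=> erefl) (fun=> erefl))
    (fun _ _ _ _ _ _ _ e => e).

Definition pi1_mul g h : pi1 x :=
  @Pi1 k kb X x (fun Y => pi1_act g Y \o pi1_act h Y)
    (fun Y => bij_comp (pi1_bij g Y) (pi1_bij h Y))
    (fun Y Y' f fn fp y y' e => pi1_nat g fn fp (pi1_nat h fn fp e)).

Lemma pi1_inv_subproof g : exists h, pi1_mul h g = pi1_one.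
Proof.
have ex Y : exists f, cancel (pi1_act g Y) f /\ cancel f (pi1_act g Y).
  by have [f] := pi1_bij g Y; exists f.
pose f Y := projT1 (cid (ex Y)).
have fP Y : cancel (pi1_act g Y) (f Y) /\ cancel (f Y) (pi1_act g Y).
  exact: projT2 (cid (ex Y)).
have fb Y : bijective (f Y) by have [fK Kf] := fP Y; exact: Bijective Kf fK.
have fnat (Y Y' : etale_cover X) (m : forall A, Y A -> Y' A) :
    natural m -> (forall A y, cov_proj Y' (m A y) = cov_proj Y y) ->
    forall (y : fibre Y x) (y' : fibre Y' x), sval y' = m _ (sval y) ->
      sval (f Y' y') = m _ (sval (f Y y)).
  move=> mn mp y y' yy'.
  have mfx : cov_proj Y' (m _ (sval (f Y y))) = x.
    by rewrite mp; exact: svalP (f Y y).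
  pose z : fibre Y' x := exist _ _ mfx.
  have := @pi1_nat _ _ _ _ g Y Y' m mn mp (f Y y) z erefl.
  rewrite (fP Y).2 -yy' => e.
  have -> : y' = pi1_act g Y' z.
    apply: eq_sig_hprop; [by move=> ? *; exact: Prop_irrelevance | exact: esym e].
  by rewrite (fP Y').1.
by exists (Pi1 fb fnat); apply: pi1_eq => Y y /=; rewrite (fP Y).1.
Qed.

Definition pi1_inv g : pi1 x := projT1 (cid (pi1_inv_subproof g)).

Lemma pi1_mulA : associative pi1_mul.
Proof. by move=> f g h; exact: pi1_eq. Qed.
Lemma pi1_mul1g : left_id pi1_one pi1_mul.
Proof. by move=> g; exact: pi1_eq. Qed.
Lemma pi1_mulVg : left_inverse pi1_one pi1_inv pi1_mul.
Proof. by move=> g; exact: projT2 (cid (pi1_inv_subproof g)). Qed.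

Definition pi1_group : top_group :=
  action_group pi1_mulA pi1_mul1g pi1_mulVg
    (act := fun g (z : {Y : etale_cover X & fibre Y x}) =>
       existT _ (projT1 z) (pi1_act g _ (projT2 z)))
    (fun z => let: existT Y y := z in erefl) (fun _ _ _ => erefl).
End FundamentalGroup.

Section BaseChange.
Variables (k : fieldType) (kb : alg_closure k) (e : field_extension kb).

Definition ext_scheme (X : kfun k) : kfun e := base_change (ext_in e) X.

Definition emb_hom :
    ahom (cl_alg kb) (res (ext_in e) (cl_alg (ext_cl e))) :=
  @AHom k (cl_alg kb) (res (ext_in e) (cl_alg (ext_cl e))) (ext_emb e)
    (@ext_comm k kb e).

Definition ext_point (X : kfun k) (x : X (cl_alg kb))
  : ext_scheme X (cl_alg (ext_cl e)) := kmap X emb_hom x.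

Lemma ext_cover_subproof (X : kfun k) (Y : etale_cover X) (R : alg e)
    (x : ext_scheme X R) :
  exists (B : alg e) (beta : ahom R B) (y : ext_scheme Y B),
    [/\ finite_etale beta,
      cov_proj Y (y : Y (res (ext_in e) B)) =
        kmap (ext_scheme X) beta x &
      forall (S : alg e) (sigma : ahom R S) (y' : ext_scheme Y S),
        cov_proj Y (y' : Y (res (ext_in e) S)) =
          kmap (ext_scheme X) sigma x ->
        exists f : ahom B S,
          (f \o beta =1 sigma /\ kmap (ext_scheme Y) f y = y') /\
          forall f' : ahom B S, f' \o beta =1 sigma ->
            kmap (ext_scheme Y) f' y = y' -> f' =1 f].
Proof.
have [B [beta [y [Bet yx yU]]]] := @cov_finite_etale k X Y (res (ext_in e) R) x.
pose B' : alg e := Alg B (beta \o alg_map R).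
pose beta' : ahom R B' := @AHom e R B' beta (fun=> erefl).
have iE c : alg_map B c = alg_map (res (ext_in e) B') c by rewrite -(ahomE beta).
pose i : ahom B (res (ext_in e) B') :=
  @AHom k B (res (ext_in e) B') idfun iE.
exists B', beta', (kmap Y i y); split=> //.
  by rewrite cov_proj_nat yx; apply/esym/kmap_comp.
move=> S sigma y' y'x.
have [f [[fb fy] fU]] := yU (res (ext_in e) S) (res_hom (ext_in e) sigma) y' y'x.
have fE c : f (alg_map B' c) = alg_map S c by rewrite -(ahomE sigma) -fb.
pose f0 : ahom B' S := @AHom e B' S f fE.
exists f0; split; first split=> //.
  rewrite -fy; apply/esym.
  exact: (@kmap_comp k Y B (res (ext_in e) B') (res (ext_in e) S) i
            (res_hom (ext_in e) f0) f y (fun=> erefl)).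
move=> f' f'b f'y.
have f'E c : f' (alg_map B c) = alg_map (res (ext_in e) S) c.
  by rewrite iE; exact: (ahomE (res_hom (ext_in e) f')).
apply: (fU (@AHom k B (res (ext_in e) S) f' f'E)) => //.
rewrite -f'y.
exact: (@kmap_comp k Y B (res (ext_in e) B') (res (ext_in e) S) i
          (res_hom (ext_in e) f')).
Qed.

Definition ext_cover (X : kfun k) (Y : etale_cover X)
  : etale_cover (ext_scheme X) :=
  @EtaleCover e (ext_scheme X) (ext_scheme Y)
    (fun A y => cov_proj Y (y : Y (res (ext_in e) A)))
    (fun A B f y => cov_proj_nat (res_hom (ext_in e) f) y)
    (@ext_cover_subproof X Y).

(* Induced by Y |-> Y_e on covers, through the bijections from the fibre of Y
   at x to the fibre of Y_e at x_e. *)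
Definition pi1_map (X : kfun k) (x : X (cl_alg kb)) (g' : pi1 (ext_point x))
  : pi1 x :=
  choose_or (pi1_one x) (fun g => forall (Y : etale_cover X) (y : fibre Y x)
    (y' : fibre (ext_cover Y) (ext_point x)),
    sval y' = kmap Y emb_hom (sval y) ->
    sval (pi1_act g' (ext_cover Y) y') =
      kmap Y emb_hom (sval (pi1_act g Y y))).
End BaseChange.

(* The map to the Galois group is the functoriality of pi_1 along X -> Spec k:
   an element acts through its image on every finite etale cover E of Spec k
   receiving a morphism from a finite etale cover Y of X. *)
Definition pi1_proj (k : fieldType) (kb : alg_closure k) (X : kfun k)
  (x : X (cl_alg kb)) (g : pi1 x) : gal kb :=
  choose_or (gal_one kb) (fun h =>
    forall (E : etale_cover (point_scheme k)) (Y : etale_cover X)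
      (f : forall A, Y A -> E A), natural f ->
    forall y : fibre Y x,
      f _ (sval (pi1_act g Y y)) = kmap E (gal_hom h) (f _ (sval y))).

Definition geom_pi1_map (k : fieldType) (kb : alg_closure k) (X : kfun k)
  (x : X (cl_alg kb)) :
  pi1 (ext_point (closure_extension kb) x) -> pi1 x :=
  @pi1_map k kb (closure_extension kb) X x.

Definition geometrically_connected (k : fieldType) (kb : alg_closure k)
  (X : kfun k) : Prop :=
  connected_scheme (ext_scheme (closure_extension kb) X).

(* 1 -> pi_1(Xbar) -> pi_1(X) -> Gal(kb/k) -> 1 is exact. *)
Definition fundamental_sequence_exact (k : fieldType) (kb : alg_closure k)
  (X : kfun k) (x : X (cl_alg kb)) : Prop :=
  [/\ injective (@geom_pi1_map k kb X x),
      forall g : pi1 x,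
        pi1_proj g = gal_one kb <-> exists h, geom_pi1_map h = g &
      forall h : gal kb, exists g : pi1 x, pi1_proj g = h].

(** * Quotient by a normal subgroup *)

Record normal_subgroup (P : top_group) := NormalSubgroup {
  ns_set :> P -> Prop;
  ns1 : ns_set 1%tg;
  nsM : forall x y, ns_set x -> ns_set y -> ns_set (x * y)%tg;
  nsV : forall x, ns_set x -> ns_set (x^-1)%tg;
  nsJ : forall x y, ns_set x -> ns_set (y * x * y^-1)%tg }.

Section Quotient.
Local Open Scope tgroup_scope.
Variables (P : top_group) (N : normal_subgroup P).

Definition coset_set (x : P) : P -> Prop := fun y => N (x^-1 * y).

Definition coset_space := {C : P -> Prop | exists x, C = coset_set x}.

Definition left_coset (x : P) : coset_space :=
  exist _ (coset_set x) (ex_intro _ x erefl).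

Definition coset_repr (u : coset_space) : P := projT1 (cid (svalP u)).

Lemma coset_eq x y : left_coset x = left_coset y <-> N (x^-1 * y).
Proof.
split=> [/(f_equal sval) /= xy|xy].
  have : coset_set y y by rewrite /coset_set tg_mulV; exact: ns1.
  by rewrite -xy.
apply: eq_sig_hprop => [? ? ?|]; first exact: Prop_irrelevance.
apply/funext => z; apply/propext; split=> Nz.
  have := nsM (nsV xy) Nz.
  by rewrite tg_invM tg_invK -tg_mulA (tg_mulA x) tg_mulrV tg_mul1.
have := nsM xy Nz.
by rewrite -tg_mulA (tg_mulA y) tg_mulrV tg_mul1.
Qed.

Lemma coset_reprK u : left_coset (coset_repr u) = u.
Proof.
apply: eq_sig_hprop => [? ? ?|]; first exact: Prop_irrelevance.
by rewrite /= /coset_repr; case: cid.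
Qed.

Definition quotient_mul (u v : coset_space) : coset_space :=
  left_coset (coset_repr u * coset_repr v).
Definition quotient_inv (u : coset_space) : coset_space := left_coset (coset_repr u)^-1.

Lemma quotient_mulE x y : quotient_mul (left_coset x) (left_coset y) = left_coset (x * y).
Proof.
apply/coset_eq.
have /coset_eq Nx := coset_reprK (left_coset x).
have /coset_eq Ny := coset_reprK (left_coset y).
have := nsM (nsJ (coset_repr (left_coset y))^-1 Nx) Ny.
rewrite tg_invK tg_invM -!tg_mulA.
by rewrite (tg_mulA (coset_repr (left_coset y)) _ y) tg_mulrV tg_mul1.
Qed.

Lemma quotient_invE x : quotient_inv (left_coset x) = left_coset x^-1.
Proof.
apply/coset_eq; rewrite tg_invK.
have /coset_eq /nsV /(@nsJ _ N _ x) := coset_reprK (left_coset x).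
by rewrite tg_invM tg_invK tg_mulA tg_mulrV tg_mul1.
Qed.

Lemma quotient_mulA : associative quotient_mul.
Proof.
move=> u v w; rewrite -(coset_reprK u) -(coset_reprK v) -(coset_reprK w).
by rewrite !quotient_mulE tg_mulA.
Qed.
Lemma quotient_mul1 : left_id (left_coset 1) quotient_mul.
Proof. by move=> u; rewrite -(coset_reprK u) quotient_mulE tg_mul1. Qed.
Lemma quotient_mulV : left_inverse (left_coset 1) quotient_inv quotient_mul.
Proof.
by move=> u; rewrite -(coset_reprK u) quotient_invE quotient_mulE tg_mulV.
Qed.

Definition quotient_open (U : coset_space -> Prop) : Prop :=
  tg_open (fun x => U (left_coset x)).

Lemma quotient_openT : quotient_open (fun=> True).
Proof. exact: tg_openT. Qed.

Lemma quotient_openI U V : quotient_open U -> quotient_open V ->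
  quotient_open (fun x => U x /\ V x).
Proof. exact: tg_openI. Qed.

Lemma quotient_openU (F : (coset_space -> Prop) -> Prop) :
  (forall U, F U -> quotient_open U) ->
  quotient_open (fun x => exists2 U, F U & U x).
Proof.
move=> Fo; rewrite /quotient_open.
have -> : (fun x => exists2 U, F U & U (left_coset x)) = (fun x =>
    exists2 V, (exists2 U, F U & V = (fun y => U (left_coset y))) & V x).
  apply/funext => x; apply/propext; split=> [[U FU Ux]|[V [U FU ->]]].
    by exists (fun y => U (left_coset y)) => //; exists U.
  by exists U.
by apply: tg_openU => V [U /Fo ? ->].
Qed.

Lemma quotient_open_image V : tg_open V ->
  quotient_open (fun u => exists2 x, V x & left_coset x = u).
Proof.
move=> Vo; rewrite /quotient_open.
have -> : (fun x => exists2 y, V y & left_coset y = left_coset x) = (fun x =>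
    exists2 W, (exists2 n, N n & W = (fun y => V (y * n))) & W x).
  apply/funext => x; apply/propext; split=> [[y Vy /esym/coset_eq Nyx]|].
    exists (fun z => V (z * (x^-1 * y))); last first.
      by rewrite tg_mulA tg_mulrV tg_mul1.
    by exists (x^-1 * y).
  move=> [W [n Nn ->] Vxn]; exists (x * n) => //.
  by apply/esym/coset_eq; rewrite tg_mulKV.
by apply: tg_openU => W [n _ ->]; exact: tg_open_mulr.
Qed.

Lemma quotient_mul_continuous U u v : quotient_open U ->
  U (quotient_mul u v) ->
  exists V W, [/\ quotient_open V, quotient_open W, V u, W v &
    forall u' v', V u' -> W v' -> U (quotient_mul u' v')].
Proof.
move=> Uo; rewrite -(coset_reprK u) -(coset_reprK v) quotient_mulE => Uuv.
have [V [W [Vo Wo Vu Wv VW]]] := tg_mul_continuous Uo Uuv.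
exists (fun u => exists2 x, V x & left_coset x = u).
exists (fun u => exists2 x, W x & left_coset x = u); split.
- exact: quotient_open_image.
- exact: quotient_open_image.
- by exists (coset_repr u).
- by exists (coset_repr v).
by move=> _ _ [x Vx <-] [y Wy <-]; rewrite quotient_mulE; exact: VW.
Qed.

Lemma quotient_inv_continuous U : quotient_open U ->
  quotient_open (fun x => U (quotient_inv x)).
Proof.
move=> /tg_inv_continuous Uo; rewrite /quotient_open.
have -> : (fun x => U (quotient_inv (left_coset x))) = (fun x => U (left_coset x^-1)).
  by apply/funext => x; rewrite quotient_invE.
exact: Uo.
Qed.

Definition quotient_group : top_group :=
  TopGroup quotient_mulA quotient_mul1 quotient_mulV quotient_openT
    quotient_openI quotient_openU quotient_mul_continuous
    quotient_inv_continuous.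
End Quotient.

(** * Finite group schemes and nonabelian cohomology *)

Record finite_group_scheme (k : comPzRingType) := FiniteGroupScheme {
  gs_pts :> alg k -> groupType;
  gs_map : forall A B : alg k, ahom A B -> gs_pts A -> gs_pts B;
  gs_mapM : forall (A B : alg k) (f : ahom A B) x y,
    gs_map f (x * y)%g = (gs_map f x * gs_map f y)%g;
  gs_map_id : forall (A : alg k) (f : ahom A A) x,
    f =1 id -> gs_map f x = x;
  gs_map_comp : forall (A B C : alg k) (f : ahom A B) (g : ahom B C)
    (h : ahom A C) x, h =1 g \o f -> gs_map h x = gs_map g (gs_map f x);
  gs_finite : exists (A : alg k) (u : gs_pts A),
    finite_morphism (alg_map A) /\
    forall (R : alg k) (x : gs_pts R),
      exists f : ahom A R, gs_map f u = x /\
        forall f' : ahom A R, gs_map f' u = x -> f' =1 f }.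
Arguments gs_map {k} G {A B} f x : rename.

(* G is the constant group scheme attached to a finite group M: the R-points of
   the disjoint union of copies of Spec k indexed by M are the families of
   orthogonal idempotents of sum 1. *)
Definition constant_group_scheme (k : comPzRingType)
  (G : finite_group_scheme k) : Prop :=
  exists (M : finGroupType) (phi : forall R : alg k, G R -> M -> R),
  [/\ forall (A B : alg k) (f : ahom A B) x m,
        phi B (gs_map G f x) m = f (phi A x m),
      forall R, injective (phi R),
      forall (R : alg k) (i : M -> R), (exists x, phi R x = i) <->
        (forall m n, i m * i n = if m == n then i m else 0) /\
        \sum_m i m = 1 &
      forall (R : alg k) x y m,
        phi R (x * y)%g m =
          \sum_(p : M * M | (p.1 * p.2)%g == m) phi R x p.1 * phi R y p.2].

Section Cohomology.
Local Open Scope group_scope.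
Variables (k : fieldType) (kb : alg_closure k) (G : finite_group_scheme k).

Definition geom_points : groupType := G (cl_alg kb).

Definition gal_act (g : gal kb) (m : geom_points) : geom_points :=
  gs_map G (gal_hom g) m.

(* Cohomology of P with coefficients in G(kb), on which P acts through
   [rho : P -> Gal(kb/k)]; a class is a set of cocycles. *)
Section Pointed.
Variables (P : top_group) (rho : P -> gal kb).

Definition cocycle (a : P -> geom_points) : Prop :=
  (forall m, tg_open (fun x => a x = m)) /\
  forall x y, a (x * y)%tg = a x * gal_act (rho x) (a y).

Definition cohomologous (a b : P -> geom_points) : Prop :=
  exists m : geom_points, forall x, b x = m^-1 * a x * gal_act (rho x) m.

Definition H1 (c : (P -> geom_points) -> Prop) : Prop :=
  exists a, cocycle a /\ c = cohomologous a.
End Pointed.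

(* Pullback of a class along f : P' -> P, with [rho'] the action of P'. *)
Definition pullback (P P' : top_group) (rho' : P' -> gal kb)
  (f : P' -> P) (c : (P -> geom_points) -> Prop)
  : (P' -> geom_points) -> Prop :=
  fun b => exists2 a, c a & cohomologous rho' (a \o f) b.
End Cohomology.

(** * Sections and evaluation of torsors *)

Section Sections.
Variables (k : fieldType) (kb : alg_closure k) (X : kfun k) (x : X (cl_alg kb)).

Definition Xbar_point := ext_point (closure_extension kb) x.

Definition pi1_section (s : gal_group kb -> pi1_group x) : Prop :=
  continuous_hom s /\ forall g, pi1_proj (s g) = g.

(* [U] is normal in pi_1(X), and is a closed subgroup of pi_1(Xbar) seen inside
   pi_1(X). *)
Definition closed_geometric (U : normal_subgroup (pi1_group x)) : Prop :=
  (forall g, U g -> exists h, geom_pi1_map h = g) /\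
  @tg_closed (pi1_group Xbar_point) (fun h => U (geom_pi1_map h)).

Variable U : normal_subgroup (pi1_group x).

Definition pi1U : top_group := quotient_group U.

Definition pi1U_proj (u : pi1U) : gal kb := pi1_proj (coset_repr u).

(* The image of pi_1(Xbar)/U in [pi1U]. *)
Definition Abar (u : pi1U) : Prop :=
  exists h : pi1 Xbar_point, u = left_coset U (geom_pi1_map h).

Definition pi1U_section (s : gal_group kb -> pi1U) : Prop :=
  continuous_hom s /\ forall g, pi1U_proj (s g) = g.

Definition section_map (e : field_extension kb)
  (sigma : gal_group (ext_cl e) -> pi1_group (ext_point e x))
  (g : gal_group (ext_cl e)) : pi1U :=
  left_coset U (pi1_map (sigma g)).

Variable G : finite_group_scheme k.

Definition H1_scheme : ((pi1_group x -> geom_points kb G) -> Prop) -> Prop :=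
  @H1 k kb G (pi1_group x) (@pi1_proj k kb X x).

Definition H1_pi1U : ((pi1U -> geom_points kb G) -> Prop) -> Prop :=
  @H1 k kb G pi1U pi1U_proj.

Definition H1_field : ((gal_group kb -> geom_points kb G) -> Prop) -> Prop :=
  @H1 k kb G (gal_group kb) id.

(* By exactness the composite of [geom_pi1_map] and [pi1_proj] is trivial, so
   that a class on Xbar is a conjugacy class of continuous homomorphisms. *)
Definition geom_restriction (alpha : (pi1_group x -> geom_points kb G) -> Prop)
  : (pi1_group Xbar_point -> geom_points kb G) -> Prop :=
  @pullback k kb G (pi1_group x) (pi1_group Xbar_point)
    (fun h => pi1_proj (geom_pi1_map h)) (@geom_pi1_map k kb X x) alpha.

Definition trivial_on_U
  (abar : (pi1_group Xbar_point -> geom_points kb G) -> Prop) : Prop :=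
  exists2 a, abar a & forall h, U (geom_pi1_map h) -> a h = 1%g.

Definition surjective_class
  (abar : (pi1_group Xbar_point -> geom_points kb G) -> Prop) : Prop :=
  exists2 a, abar a & forall m, exists h, a h = m.

(* The unique class of H^1(pi1U, G) inducing [alpha]; it exists as soon as
   [geom_restriction alpha] is trivial on U. *)
Definition deflation (alpha : (pi1_group x -> geom_points kb G) -> Prop)
  : (pi1U -> geom_points kb G) -> Prop :=
  choose_or (fun=> False) (fun beta => H1_pi1U beta /\
    @pullback k kb G pi1U (pi1_group x) (@pi1_proj k kb X x) (left_coset U) beta
      = alpha).

Definition evaluation (e : field_extension kb) (s : gal_group (ext_cl e) -> pi1U)
  (alpha : (pi1_group x -> geom_points kb G) -> Prop)
  : (gal_group (ext_cl e) -> geom_points kb G) -> Prop :=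
  @pullback k kb G pi1U (gal_group (ext_cl e)) (@gal_res k kb e) s
    (deflation alpha).
End Sections.

Definition field_restriction (k : fieldType) (kb : alg_closure k)
  (G : finite_group_scheme k) (e : field_extension kb)
  (c : (gal_group kb -> geom_points kb G) -> Prop)
  : (gal_group (ext_cl e) -> geom_points kb G) -> Prop :=
  @pullback k kb G (gal_group kb) (gal_group (ext_cl e)) (@gal_res k kb e)
    (@gal_res k kb e) c.
Arguments field_restriction {k kb G} e c _.

Section Assertions.
Variables (k : fieldType) (kb : alg_closure k) (X : kfun k) (x : X (cl_alg kb)).
Variables (U : normal_subgroup (pi1_group x)) (I : Type).
Variables (e : I -> field_extension kb)
  (s : forall i, gal_group (ext_cl (e i)) -> pi1U U).

Definition evaluation_is_diagonal (G : finite_group_scheme k)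
  (alpha : (pi1_group x -> geom_points kb G) -> Prop) : Prop :=
  exists2 c, @H1_field k kb G c &
    forall i, evaluation (@s i) alpha = field_restriction (e i) c.

Definition assertion_a : Prop :=
  forall (G : finite_group_scheme k) alpha, @H1_scheme k kb X x G alpha ->
    trivial_on_U U (geom_restriction alpha) -> evaluation_is_diagonal alpha.

Definition assertion_a'' : Prop :=
  forall (G : finite_group_scheme k) alpha, @H1_scheme k kb X x G alpha ->
    trivial_on_U U (geom_restriction alpha) ->
    surjective_class (geom_restriction alpha) -> evaluation_is_diagonal alpha.

Definition assertion_c : Prop :=
  exists2 s0 : gal_group kb -> pi1U U, pi1U_section s0 &
    forall i, exists2 a, Abar a &
      forall g, @s i g = (a * s0 (gal_res g) * a^-1)%tg.

Definition finite_diagonal_fibres : Prop :=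
  forall G : finite_group_scheme k, constant_group_scheme G ->
    forall b : (forall i, (gal (ext_cl (e i)) -> geom_points kb G) -> Prop),
      finite_set [set c : (gal kb -> geom_points kb G) -> Prop |
        @H1_field k kb G c /\ forall i, field_restriction (e i) c = b i].
End Assertions.

(* Main.v *)
(* The implication from (a'') to (c) is a compactness argument.  Let [P] be the
   fundamental group of [X].  For each finite list [l] of covers of [X], the
   group [P] modulo [U] and modulo the elements acting trivially on the fibres
   of [l] is a finite group [M]; let [H] be the image in [M] of the geometric
   fundamental group.  The given section makes the Galois group act on [H], and
   [H] becomes a finite group scheme [G] over [k]: its algebra consists of the
   equivariant functions from [H] to [kb], and it has the right geometric points
   because an injective equivariant function [phi] from [H] to [kb] provides
   equivariant functions, the powers of [phi], spanning all functions.
   Comparing the projection [P -> M] with the section gives a surjective class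
   in H^1(X, G), and (a'') yields a homomorphism from the Galois group to [M]
   inducing all [s i] up to conjugation.  The limit of these homomorphisms along
   an ultrafilter on the lists [l] is a section, and it is continuous because,
   by finiteness of the diagonal fibres for the constant group [M], only finitely
   many homomorphisms to [M] occur.  Compactness comes from the finiteness of the
   fibres of covers and of the Galois orbits in [kb]. *)

(* Assertion (a'') concerns surjective classes only, so it has to be applied to [H] and not to [M];
   the given section supplies the homomorphism to [M] against which the projection is compared, and
   conjugation by it is the twist. The homomorphisms found for different lists need not be
   compatible. Each is therefore represented by a map from the Galois group to [P] itself, lifting
   the identity and multiplicative only modulo its own level, so that all limits are taken in the
   one compact group [P]; the conjugating elements attached to each [i] pass to the limit in the
   same way. Closedness of [U] makes the levels intersect in [U]. The maps [pi1_proj], [pi1_map] and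
   [gal_res] are selected by choice and first have to be shown to satisfy their defining properties;
   for [pi1_proj] this rests on exactness. Characteristic zero enters twice: the Galois invariants
   of [kb] are [k], and the integers are infinitely many distinct scalars of [kb]. *)
From HB Require Import structures.
Require Import Defs.
From mathcomp Require Import all_boot all_order all_fingroup all_algebra.
From mathcomp Require Import all_classical ring.

Set Implicit Arguments.
Unset Strict Implicit.
Unset Printing Implicit Defensive.

Import GRing.Theory.
Local Open Scope ring_scope.

(** * Zorn's lemma and ultrafilters on large types *)

(* The library versions are stated for types below the universe of
   [choiceType], which excludes types of covers. *)
Section Zorn.
Variables (T : Type) (good : (T -> Prop) -> Prop) (A0 : T -> Prop).

Definition subP (A B : T -> Prop) := forall x, A x -> B x.
Definition unionP (F : (T -> Prop) -> Prop) : T -> Prop :=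
  fun x => exists2 A, F A & A x.
Definition chainP (F : (T -> Prop) -> Prop) :=
  forall A B, F A -> F B -> subP A B \/ subP B A.

Hypothesis good0 : good A0.
Hypothesis good_union : forall F : (T -> Prop) -> Prop,
  (exists A, F A) -> (forall A, F A -> good A) -> chainP F -> good (unionP F).

Lemma subP_eq A B : subP A B -> subP B A -> A = B.
Proof. by move=> AB BA; apply/funext => x; apply/propext; split; auto. Qed.

(** A successor that fails to enlarge a good set certifies that this set is maximal. *)
Let next (A B : T -> Prop) :=
  subP A B /\ (good A -> good B) /\
  (good A -> subP B A -> forall C, good C -> subP A C -> subP C A).

Let nextE A : exists B, next A B.
Proof.
have [[C [gC [sAC nCA]]]|nC] :=
  pselect (exists C, good C /\ (subP A C /\ ~ subP C A)).
  by exists C; split=> //; split=> // _ /nCA.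
exists A; split; first by move=> x.
split=> // gA _ C gC sAC; apply: contrapT => nCA; apply: nC; by exists C.
Qed.

Let f A := projT1 (cid (nextE A)).
Let fP A : next A (f A). Proof. by rewrite /f; case: cid. Qed.

(** The tower of the Bourbaki-Witt argument, which avoids ordinals. Adjoining [A0] to each union
    lets the empty family start the tower. *)
Inductive tower : (T -> Prop) -> Prop :=
| tower_next A : tower A -> tower (f A)
| tower_union F : (forall A, F A -> tower A) ->
    tower (fun x => A0 x \/ unionP F x).

(** For an extreme member [C] of the tower, no member lies strictly between [C] and [f C]. Once all
    members are extreme, the tower is a chain. *)
Let extreme C := forall A, tower A -> subP A C -> ~ subP C A -> subP (f A) C.

Let extreme_comp C : extreme C -> subP A0 C ->
  forall A, tower A -> subP A C \/ subP (f C) A.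
Proof.
move=> eC A0C A; elim=> {A} [A tA [sAC|gCA]|F tF IH].
- have [CA|nCA] := pselect (subP C A); last by left; apply: eC.
  by right; rewrite (subP_eq sAC CA).
- by right => x /gCA; apply: (fP A).1.
have [[A [FA gCA]]|nF] := pselect (exists A, F A /\ subP (f C) A).
  by right => x /gCA Ax; right; exists A.
left => x [/A0C //|[A FA]]; have [sAC|gCA] := IH A FA; first exact: sAC.
by case: nF; exists A.
Qed.

Let tower0 A : tower A -> subP A0 A.
Proof.
elim=> {A} [A _ A0A x /A0A|F _ _ x]; first exact: (fP A).1.
by left.
Qed.

Let tower_extreme C : tower C -> extreme C.
Proof.
elim=> {C} [C tC IH A tA sAC nCA|F tF IH A tA AF nFA].
  have [sAC'|//] := extreme_comp IH (tower0 tC) tA.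
  have [CA|nCA'] := pselect (subP C A).
    by rewrite (subP_eq sAC' CA).
  by move=> x /(IH A tA sAC' nCA'); apply: (fP C).1.
have [[C [FCC sAC]]|nC] := pselect (exists C, F C /\ subP A C); last first.
  exfalso; apply: nFA => x [/(tower0 tA) //|[C FCC Cx]].
  have [sAC|gCA] := extreme_comp (IH C FCC) (tower0 (tF C FCC)) tA.
    by case: nC; exists C.
  by apply: gCA; exact: (fP C).1.
have [CA|nCA] := pselect (subP C A); last first.
  by move=> x /(IH C FCC A tA sAC nCA) Cx; right; exists C.
rewrite (subP_eq sAC CA).
have [FCC'|//] :=
  extreme_comp (IH C FCC) (tower0 (tF C FCC)) (tower_union tF).
by case: nFA => x /FCC' /CA.
Qed.

Let tower_chain : chainP tower.
Proof.
move=> A B tA tB.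
have [AB|fBA] := extreme_comp (tower_extreme tB) (tower0 tB) tA; first by left.
by right => x Bx; apply: fBA; exact: (fP B).1.
Qed.

Let tower_good A : tower A -> good A.
Proof.
elim=> {A} [A _ gA|F tF gF]; first exact: (fP A).2.1.
pose F' B := B = A0 \/ F B.
have -> : (fun x => A0 x \/ unionP F x) = unionP F'.
  apply: subP_eq => x.
    by case=> [A0x|[B FB Bx]]; [exists A0; [left|]|exists B; [right|]].
  by case=> B [->|FB] Bx; [left|right; exists B].
apply: good_union; first by exists A0; left.
  by move=> B [->|/gF].
move=> B C [->|FB] [->|FCC]; first by left.
- by left; apply: tower0; apply: tF.
- by right; apply: tower0; apply: tF.
by apply: tower_chain; apply: tF.
Qed.

(** The union of the tower belongs to the tower, hence contains its own successor; the last clause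
    of [next] then gives maximality. *)
Lemma zorn_sets : exists A, [/\ good A, subP A0 A &
  forall B, good B -> subP A B -> subP B A].
Proof.
pose V x := A0 x \/ unionP tower x.
have tV : tower V by exact: tower_union.
exists V; split; [exact: tower_good|exact: tower0|].
apply: (fP V).2.2; first exact: tower_good.
by move=> x fVx; right; exists (f V) => //; exact: tower_next.
Qed.
End Zorn.

Record ultrafilter (J : Type) (D : (J -> Prop) -> Prop) : Prop := Ultrafilter {
  ufT : D (fun=> True);
  ufS : forall P Q : J -> Prop, (forall j, P j -> Q j) -> D P -> D Q;
  ufI : forall P Q, D P -> D Q -> D (fun j => P j /\ Q j);
  uf_ex : forall P, D P -> exists j, P j;
  ufC : forall P, D P \/ D (fun j => ~ P j) }.

Lemma directed_ultrafilter (J : Type) (le : J -> J -> Prop) (j0 : J) :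
  (forall a b c, le a b -> le b c -> le a c) ->
  (forall a b, exists2 c, le a c & le b c) ->
  exists2 D, ultrafilter D & forall j, D (le j).
Proof.
move=> le_trans le_dir.
pose base (P : J -> Prop) := exists j, subP (le j) P.
pose good (D : (J -> Prop) -> Prop) := [/\ subP base D,
  (forall P Q : J -> Prop, subP P Q -> D P -> D Q),
  (forall P Q, D P -> D Q -> D (fun j => P j /\ Q j)) &
  forall P, D P -> exists j, P j].
have gB : good base.
  split=> [//|P Q PQ [j jP]|P Q [i iP] [j jQ]|P [j jP]].
  - by exists j => x /jP /PQ.
  - have [l il jl] := le_dir i j.
    by exists l => x lx; split; [apply: iP|apply: jQ]; apply: le_trans lx.
  - by have [l jl _] := le_dir j j; exists l; apply: jP.
have gU (F : ((J -> Prop) -> Prop) -> Prop) : (exists A, F A) ->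
    (forall A, F A -> good A) -> chainP F -> good (unionP F).
  move=> [A FA] Fg Fc; split.
  - by move=> P bP; exists A => //; have [+ _ _ _] := Fg A FA; apply.
  - move=> P Q PQ [B FB BP]; exists B => //; have [_ + _ _] := Fg B FB.
    by apply; first exact: PQ.
  - move=> P Q [B FB BP] [C FCC CQ]; have [BC|CB] := Fc B C FB FCC.
      by exists C => //; have [_ _ + _] := Fg C FCC; apply=> //; apply: BC.
    by exists B => //; have [_ _ + _] := Fg B FB; apply=> //; apply: CB.
  - by move=> P [B FB BP]; have [_ _ _ +] := Fg B FB; apply.
have [D [[bD DS DI Dex] _ Dmax]] := zorn_sets gB gU.
exists D; last by move=> j; apply: bD; exists j.
split=> // [|P]; first by apply: bD; exists j0.
have [DP|nDP] := pselect (D P); first by left.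
(* [D'] is the filter generated by [D] and the complement of [P]. It is proper because [P] is not in
   [D], so maximality gives [D' = D]. *)
right; pose D' Q := exists2 S, D S & forall j, S j -> ~ P j -> Q j.
have DD' : subP D D' by move=> Q DQ; exists Q.
apply: (Dmax D') => //; last by exists (fun=> True) => //; apply: bD; exists j0.
split=> [Q /bD /DD' //|Q R QR [S DS' SQ]|Q R [S DS' SQ] [S' DS'' SR]|Q [S DS' SQ]].
- by exists S => // j Sj /(SQ j Sj) /QR.
- exists (fun j => S j /\ S' j); first exact: DI.
  by move=> j [Sj S'j] nPj; split; [apply: SQ|apply: SR].
apply: contrapT => nQ; apply: nDP; apply: DS DS' => j Sj.
by apply: contrapT => nPj; apply: nQ; exists j; apply: SQ.
Qed.

(** Finiteness for bare types, such as fibres of covers, that carry no [choiceType] structure. *)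
Definition finitary (T : Type) :=
  exists (F : finType) (f : T -> F), injective f.

Section UltraLimits.
Variables (J : Type) (D : (J -> Prop) -> Prop) (uD : ultrafilter D).

Lemma uf_all (n : nat) (P : 'I_n -> J -> Prop) :
  (forall i, D (P i)) -> D (fun j => forall i, P i j).
Proof.
move=> DP.
suff H (s : seq 'I_n) : D (fun j => forall i, i \in s -> P i j).
  by apply: (ufS uD _ (H (enum 'I_n))) => j Pj i; apply: Pj; rewrite mem_enum.
elim: s => [|i s IH]; first by apply: (ufS uD _ (ufT uD)).
apply: (ufS uD _ (ufI uD (DP i) IH)) => j [Pi Ps] i'.
by rewrite inE => /orP[/eqP->|/Ps].
Qed.

(** Compactness of a finite discrete space: an ultrafilter contains one of finitely many pieces
    covering the index set. *)
Lemma uf_seq (T : eqType) (s : seq T) (f : J -> T) :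
  D (fun j => f j \in s) -> exists t, D (fun j => f j = t).
Proof.
elim: s => [|t s IH] Ds; first by have [j] := uf_ex uD Ds.
have [Dt|Dt] := ufC uD (fun j => f j = t); first by exists t.
apply: IH; apply: (ufS uD _ (ufI uD Ds Dt)) => j [].
by rewrite inE => /orP[/eqP ->|].
Qed.

Lemma uf_finitary (T : Type) (f : J -> T) :
  finitary T -> exists t, D (fun j => f j = t).
Proof.
move=> [F [g gI]].
have [|t Dt] := @uf_seq F (enum F) (g \o f).
  by apply: (ufS uD _ (ufT uD)) => j _; rewrite mem_enum.
have [j0 j0t] := uf_ex uD Dt; exists (f j0).
by apply: (ufS uD _ Dt) => j /=; rewrite -j0t => /gI.
Qed.

Lemma uf_eq (T : Type) (f : J -> T) t t' :
  D (fun j => f j = t) -> D (fun j => f j = t') -> t = t'.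
Proof.
move=> Dt Dt'; have [j [<- <-]] := uf_ex uD (ufI uD Dt Dt'); by [].
Qed.
End UltraLimits.

(** * Automorphisms of an algebraic closure *)

Lemma roots_seq (K : closedFieldType) (p : {poly K}) : p != 0 ->
  exists2 s : seq K, uniq s & forall x, (x \in s) = root p x.
Proof.
move=> p0; have [r pE] := closed_field_poly_normal p.
exists (undup r); first exact: undup_uniq.
move=> x; rewrite mem_undup {1}pE rootZ ?lead_coef_eq0 //.
by rewrite root_prod_XsubC.
Qed.

Lemma gal_orbit (k : fieldType) (kb : alg_closure k) (a : kb) :
  exists s : seq kb, forall g : gal kb, g a \in s.
Proof.
have [p p0 pa] := cl_algebraic a.
have [|s _ sP] := @roots_seq kb (map_poly (cl_in kb) p).
  by rewrite map_poly_eq0.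
exists s => g; rewrite sP.
have -> : map_poly (cl_in kb) p = map_poly g (map_poly (cl_in kb) p).
  by rewrite -map_poly_comp; apply: eq_map_poly => c /=; rewrite gal_fix.
by apply: rmorph_root.
Qed.

Section ExtendIso.
Variables (k : fieldType) (kb : alg_closure k).
Implicit Types (G : kb * kb -> Prop) (r : {poly kb}).

(* Partial automorphisms are handled through their graphs. *)
Record iso_graph G : Prop := IsoGraph {
  ig_k : forall c : k, G (cl_in kb c, cl_in kb c);
  ig_sub : forall x y, G x -> G y -> G (x.1 - y.1, x.2 - y.2);
  ig_mul : forall x y, G x -> G y -> G (x.1 * y.1, x.2 * y.2);
  ig_fun : forall y, G (0, y) -> y = 0 }.

Definition poly_graph G r1 r2 := forall i, G (r1`_i, r2`_i).

Definition adjoin G (b c : kb) (z : kb * kb) :=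
  exists r1 r2, poly_graph G r1 r2 /\ z = (r1.[b], r2.[c]).

Lemma nonzero_algebraic (u : kb) : u != 0 ->
  exists2 p : {poly k}, p`_0 != 0 & root (map_poly (cl_in kb) p) u.
Proof.
move=> u0; have [p] := cl_algebraic u.
have [n] := ubnP (size p); elim: n p => // n IH p /ltnSE sp p0 pu.
have [p00|] := eqVneq p`_0 0; last by exists p.
have /factor_theorem [q pE] : root p 0 by rewrite /root horner_coef0 p00.
rewrite subr0 in pE.
have q0 : q != 0 by apply: contraNneq p0 => q0; rewrite pE q0 mul0r.
apply: (IH q) => //; first by move: sp; rewrite pE size_mulX.
move: pu; rewrite pE rmorphM /= map_polyX rootM rootX (negPf u0) orbF //.
Qed.

Section Graph.
Variables (G : kb * kb -> Prop) (igG : iso_graph G).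

Lemma ig0 : G (0, 0).
Proof. by have := ig_k igG 0; rewrite !rmorph0. Qed.
Lemma ig1 : G (1, 1).
Proof. by have := ig_k igG 1; rewrite !rmorph1. Qed.
Lemma ig_opp x : G x -> G (- x.1, - x.2).
Proof. by move=> Gx; have := ig_sub igG ig0 Gx; rewrite !sub0r. Qed.
Lemma ig_add x y : G x -> G y -> G (x.1 + y.1, x.2 + y.2).
Proof. by move=> Gx /ig_opp Gy; have := ig_sub igG Gx Gy; rewrite !opprK. Qed.

(** A nonzero [u] is a root of a polynomial over [k] with nonzero constant term. Carried along the
    graph from [u] to [0], this relation would kill the constant term. *)
Lemma ig_inj u : G (u, 0) -> u = 0.
Proof.
move=> Gu; apply: contrapT => /eqP /nonzero_algebraic [p p0 pu].
have Gp (q : {poly k}) : G ((map_poly (cl_in kb) q).[u],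
    (map_poly (cl_in kb) q).[0]).
  elim/poly_ind: q => [|q c IH]; first by rewrite map_poly0 !horner0; exact: ig0.
  rewrite rmorphD rmorphM /= map_polyX map_polyC !hornerE.
  have := ig_add (ig_mul igG IH Gu) (ig_k igG c).
  by rewrite /= mulr0 add0r.
have := Gp p; rewrite (eqP pu) => /(ig_fun igG).
by rewrite horner_coef0 coef_map => /eqP; rewrite fmorph_eq0 (negPf p0).
Qed.

Lemma poly_graph_sub r1 r2 t1 t2 : poly_graph G r1 r2 -> poly_graph G t1 t2 ->
  poly_graph G (r1 - t1) (r2 - t2).
Proof. by move=> Gr Gt i; rewrite !coefB; exact: (ig_sub igG (Gr i) (Gt i)). Qed.

Lemma poly_graph_mul r1 r2 t1 t2 : poly_graph G r1 r2 -> poly_graph G t1 t2 ->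
  poly_graph G (r1 * t1) (r2 * t2).
Proof.
move=> Gr Gt i; rewrite !coefM.
pose S (x y : kb) := G (x, y).
apply: (big_ind2 S) => [|x1 x2 y1 y2 Gx Gy|j _]; first exact: ig0.
  exact: (ig_add Gx Gy).
exact: (ig_mul igG (Gr j) (Gt (i - j)%N)).
Qed.

Lemma poly_graphC c1 c2 : G (c1, c2) -> poly_graph G c1%:P c2%:P.
Proof. by move=> Gc i; rewrite !coefC; case: eqP => // _; exact: ig0. Qed.

Lemma poly_graphXn n : poly_graph G 'X^n 'X^n.
Proof. by move=> i; rewrite !coefXn; case: eqP => _; [exact: ig1|exact: ig0]. Qed.

Lemma poly_graph_k (p : {poly k}) :
  poly_graph G (map_poly (cl_in kb) p) (map_poly (cl_in kb) p).
Proof. by move=> i; rewrite !coef_map; exact: ig_k. Qed.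

(** [q1] plays the minimal polynomial of [b] over the domain of [G], up to a scalar, and [q2] is its
    conjugate under the partial automorphism. *)
Lemma min_poly_graph b : exists q1 q2, [/\ poly_graph G q1 q2, q1 != 0,
  root q1 b & forall r1 r2, poly_graph G r1 r2 -> r1 != 0 -> root r1 b ->
    (size q1 <= size r1)%N].
Proof.
pose P n := `[< exists r1 r2, [/\ poly_graph G r1 r2, r1 != 0, root r1 b &
  size r1 = n] >].
have exP : exists n, P n.
  have [p p0 pb] := cl_algebraic b.
  exists (size (map_poly (cl_in kb) p)); apply/asboolP.
  exists (map_poly (cl_in kb) p), (map_poly (cl_in kb) p); split=> //.
    exact: poly_graph_k.
  by rewrite map_poly_eq0.
case: (ex_minnP exP) => n /asboolP [q1 [q2 [Gq q0 qb <-]]] nmin.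
exists q1, q2; split=> // r1 r2 Gr r0 rb; apply: nmin; apply/asboolP.
by exists r1, r2.
Qed.

Lemma adjoinS b c : subP G (adjoin G b c).
Proof.
move=> [u v] Guv; exists u%:P, v%:P; split; first exact: poly_graphC.
by rewrite !hornerC.
Qed.

Lemma adjoin_gen b c : adjoin G b c (b, c).
Proof.
by exists 'X, 'X; split; [exact: (@poly_graphXn 1)|rewrite !hornerX].
Qed.

(** The point is that the image of [r1.[b]] is well defined: if [r1] vanishes at [b], then [r2]
    vanishes at [c]. This goes by division by the minimal polynomial, as a descent on the size of
    [r1]. *)
Lemma adjoin_iso_graph b c q1 q2 : poly_graph G q1 q2 -> q1 != 0 ->
  (forall r1 r2, poly_graph G r1 r2 -> r1 != 0 -> root r1 b ->
    (size q1 <= size r1)%N) ->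
  root q1 b -> root q2 c -> iso_graph (adjoin G b c).
Proof.
move=> Gq q0 qmin qb qc; split.
- by move=> a; apply: adjoinS; exact: ig_k.
- move=> x y [r1 [r2 [Gr ->]]] [t1 [t2 [Gt ->]]] /=.
  exists (r1 - t1), (r2 - t2); split; first exact: poly_graph_sub.
  by rewrite !hornerD !hornerN.
- move=> x y [r1 [r2 [Gr ->]]] [t1 [t2 [Gt ->]]] /=.
  exists (r1 * t1), (r2 * t2); split; first exact: poly_graph_mul.
  by rewrite !hornerM.
suff H n r1 r2 : (size r1 <= n)%N -> poly_graph G r1 r2 -> r1.[b] = 0 ->
    r2.[c] = 0.
  by move=> y [r1 [r2 [Gr [/esym r1b ->]]]]; exact: (H _ _ _ (leqnn _) Gr).
have r0P t1 t2 : poly_graph G t1 t2 -> t1 = 0 -> t2.[c] = 0.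
  move=> Gt t10; have -> : t2 = 0; last by rewrite horner0.
  apply/polyP => i; rewrite coef0; apply: (ig_fun igG).
  by have := Gt i; rewrite t10 coef0.
elim: n r1 r2 => [|n IH] r1 r2 sr Gr rb.
  by apply: (r0P r1) => //; apply/eqP; rewrite -size_poly_leq0.
have [r10|r10] := eqVneq r1 0; first exact: (r0P r1).
have sq : (size q1 <= size r1)%N by apply: (qmin _ _ Gr) => //; apply/eqP.
set m := (size r1).-1; set l := (size q1).-1.
have v0 : q2`_l != 0.
  apply: contraNneq q0 => q2l; rewrite -lead_coef_eq0; apply/eqP/ig_inj.
  by have := Gq l; rewrite q2l.
have sr1 : size r1 = m.+1 by rewrite prednK // size_poly_gt0.
have sq1 : size q1 = l.+1 by rewrite prednK // size_poly_gt0.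
(* A pseudo-division step: [G] is only known to be a ring, so leading coefficients are multiplied
   crosswise instead of inverted, and [v0] cancels the extra factor at the end. *)
pose t1 := (q1`_l)%:P * r1 - (r1`_m)%:P * 'X^(m - l) * q1.
pose t2 := (q2`_l)%:P * r2 - (r2`_m)%:P * 'X^(m - l) * q2.
have Gt : poly_graph G t1 t2.
  apply: poly_graph_sub; first by apply: poly_graph_mul => //; exact: poly_graphC.
  apply: poly_graph_mul => //; apply: poly_graph_mul; first exact: poly_graphC.
  exact: poly_graphXn.
have lm : (l <= m)%N by move: sq; rewrite sr1 sq1.
have st : (size t1 <= n)%N.
  apply: (@leq_trans m); last by move: sr; rewrite sr1.
  apply/leq_sizeP => i; rewrite leq_eqVlt => /orP[/eqP <-|mi].
    rewrite /t1 coefB -mulrA !coefCM coefXnM ltnNge leq_subr /= subKn //.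
    by rewrite mulrC subrr.
  rewrite /t1 coefB -mulrA !coefCM coefXnM.
  rewrite [r1`_i]nth_default ?sr1 // mulr0 ltnNge.
  rewrite (leq_trans (leq_subr _ _) (ltnW mi)) /= [q1`_ _]nth_default ?mulr0 ?subrr //.
  by rewrite sq1 ltn_subRL subnK // .
have := IH t1 t2 st Gt.
rewrite /t1 /t2 !(hornerE, hornerM) rb (eqP qb) (eqP qc) !mulr0 !subrr !subr0.
by move=> /(_ erefl)/eqP; rewrite mulf_eq0 (negPf v0) => /eqP.
Qed.

End Graph.

Lemma diag_iso_graph : iso_graph (fun z => exists c, z = (cl_in kb c, cl_in kb c)).
Proof.
split.
- by move=> c; exists c.
- by move=> _ _ [c ->] [d ->]; exists (c - d); rewrite /= rmorphB.
- by move=> _ _ [c ->] [d ->]; exists (c * d); rewrite /= rmorphM.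
- by move=> y [c [/esym /eqP]]; rewrite fmorph_eq0 => /eqP -> ->; rewrite rmorph0.
Qed.

Lemma iso_graph_extend (G : kb * kb -> Prop) : iso_graph G ->
  exists g : gal kb, forall z, G z -> g z.1 = z.2.
Proof.
move=> igG; have [|H [igH GH Hmax]] := @zorn_sets _ iso_graph G igG.
  move=> F [A FA] Fg Fc.
  have pick x y : unionP F x -> unionP F y -> exists B, [/\ F B, B x & B y].
    move=> [B FB Bx] [C FC' Cy]; have [BC|CB] := Fc B C FB FC'.
      by exists C; split=> //; apply: BC.
    by exists B; split=> //; apply: CB.
  split.
  - by move=> c; exists A => //; exact: (ig_k (Fg A FA)).
  - move=> x y Fx Fy; have [B [FB Bx By]] := pick x y Fx Fy.
    by exists B => //; exact: (ig_sub (Fg B FB)).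
  - move=> x y Fx Fy; have [B [FB Bx By]] := pick x y Fx Fy.
    by exists B => //; exact: (ig_mul (Fg B FB)).
  - by move=> y [B FB By]; exact: (ig_fun (Fg B FB)).
have tot b : exists c, H (b, c).
  have [q1 [q2 [Gq q0 qb qmin]]] := min_poly_graph igH b.
  (* If [q2] were constant, injectivity of the graph would make [q1] constant too, although [q1] is
     nonzero and has the root [b]. *)
  have : size q2 != 1%N.
    have s1 : (1 < size q1)%N by exact: root_size_gt1 qb.
    apply: contraTneq s1 => s2; rewrite -leqNgt.
    apply/leq_sizeP => i i1; apply: (ig_inj igH).
    by have := Gq i; rewrite [q2`_i]nth_default // s2.
  move=> /closed_rootP [c qc]; exists c.
  apply: (Hmax (adjoin H b c)); last exact: adjoin_gen.
    exact: adjoin_iso_graph qc.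
  exact: adjoinS.
pose f b := projT1 (cid (tot b)).
have fP b : H (b, f b) by exact: projT2 (cid (tot b)).
have fE b c : H (b, c) -> f b = c.
  move=> Hbc; apply/eqP; rewrite -subr_eq0; apply/eqP/(ig_fun igH).
  by have := ig_sub igH (fP b) Hbc; rewrite /= subrr.
have fz : zmod_morphism f by move=> x y; apply: fE; exact: (ig_sub igH (fP x) (fP y)).
have fm : monoid_morphism f.
  split; first by apply: fE; exact: ig1.
  by move=> x y; apply: fE; exact: (ig_mul igH (fP x) (fP y)).
have fk a : f (cl_in kb a) = cl_in kb a by apply: fE; exact: ig_k.
have fI : injective f.
  move=> x y fxy; apply/eqP; rewrite -subr_eq0; apply/eqP/(ig_inj igH).
  by have := ig_sub igH (fP x) (fP y); rewrite /= fxy subrr.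
pose zM := GRing.isZmodMorphism.Build kb kb f fz.
pose mM := GRing.isMonoidMorphism.Build kb kb f fm.
pose fR : {rmorphism kb -> kb} := HB.pack f zM mM.
have fS y : exists x, f x = y.
  have [p p0 py] := cl_algebraic y.
  have [|s us sP] := @roots_seq kb (map_poly (cl_in kb) p).
    by rewrite map_poly_eq0.
  (* Surjectivity: [f] is injective and preserves the finite set of roots of [p], hence permutes
     it. *)
  have sub : {subset [seq f x | x <- s] <= s}.
    move=> _ /mapP [x + ->]; rewrite !sP => px.
    have -> : map_poly (cl_in kb) p = map_poly fR (map_poly (cl_in kb) p).
      by rewrite -map_poly_comp; apply: eq_map_poly => c /=; rewrite fk.
    exact: (rmorph_root fR).
  have [||_ E] := uniq_min_size _ sub; rewrite ?map_inj_uniq ?size_map //.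
  have : y \in s by rewrite sP.
  by rewrite -E => /mapP [x _ ->]; exists x.
have fb : bijective f.
  exists (fun y => projT1 (cid (fS y))) => x; last by case: cid.
  by apply: fI; case: cid.
exists (Gal fz fm fb fk) => -[x y] /GH Hxy /=; exact: fE.
Qed.

Hypothesis k_char0 : [pchar k] =i pred0.

Lemma pchar0_natf n : (n.+1%:R : kb) != 0.
Proof.
rewrite -(rmorph_nat (cl_in kb)) fmorph_eq0.
by have /pcharf0P -> := k_char0.
Qed.

(** Any other root of the minimal polynomial [q] of [a] would be the image of [a] under an
    automorphism, so [q] is a scalar times a power of ['X - a%:P]. An exponent above 1 is excluded
    because the derivative would be a smaller nonzero polynomial vanishing at [a]. *)
Lemma gal_fixed (a : kb) : (forall g : gal kb, g a = a) ->
  exists c, cl_in kb c = a.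
Proof.
move=> ga; have igD := diag_iso_graph.
set G := fun z : kb * kb => _ in igD.
have [q [q2 [Gq q0 qa qmin]]] := min_poly_graph igD a.
have q2E : q2 = q.
  by apply/polyP => i; have [c [-> ->]] := Gq i.
rewrite {}q2E in Gq.
have only b : root q b -> b = a.
  move=> qb; have igA := adjoin_iso_graph igD Gq q0 qmin qa qb.
  have [g gE] := iso_graph_extend igA.
  by have /= := gE _ (adjoin_gen igD a b); rewrite ga.
have [r qE] := closed_field_poly_normal q.
have l0 : lead_coef q != 0 by rewrite lead_coef_eq0.
have ra z : z \in r -> z = a.
  move=> zr; apply: only; rewrite qE rootZ // root_prod_XsubC //.
have {}qE : q = lead_coef q *: ('X - a%:P) ^+ size r.
  rewrite {1}qE; congr (_ *: _); elim: r ra {qE} => [|z r IH] ra.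
    by rewrite big_nil expr0.
  rewrite big_cons exprS IH => [|y yr]; last by apply: ra; rewrite inE yr orbT.
  by rewrite (ra z) // mem_head.
case: (size r) qE => [|[|n]] qE.
- by move: qa; rewrite qE expr0 rootZ // /root hornerC oner_eq0.
- have [c0 [e0 _]] := Gq 0%N; have [c1 [e1 _]] := Gq 1%N.
  move: e0 e1; rewrite qE expr1 !coefZ !coefB !coefX !coefC /= sub0r subr0 mulr1.
  move=> e0 e1; exists (- (c0 / c1)); rewrite rmorphN fmorph_div -e0 -e1.
  by rewrite mulrN mulNr opprK mulrC mulKf.
- have sq : size q = n.+3 by rewrite qE size_scale // size_exp_XsubC.
  have qd0 : q^`() != 0.
    apply/eqP => /polyP /(_ n.+1); rewrite coef_deriv coef0 -mulr_natr => /eqP.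
    rewrite mulf_eq0 (negPf (pchar0_natf _)) orbF.
    by move: l0; rewrite lead_coefE sq /= => /negPf ->.
  have qda : root q^`() a.
    rewrite qE derivZ /root hornerZ exprS derivM derivXsubC mul1r hornerD.
    by rewrite exprS !hornerM hornerXsubC subrr !mul0r addr0 mulr0.
  have Gqd : poly_graph G q^`() q^`().
    move=> i; rewrite !coef_deriv; have [c [-> _]] := Gq i.+1.
    by exists (c *+ i.+1); rewrite rmorphMn.
  have := qmin _ _ Gqd qd0 qda; rewrite leqNgt lt_size_deriv //.
Qed.

End ExtendIso.

(** * Equivariant functions on a finite Galois set *)

Section Separation.
Variables (k : fieldType) (kb : alg_closure k).
Hypothesis k_char0 : [pchar k] =i pred0.

Lemma natr_inj : injective (fun n : nat => n%:R : kb).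
Proof.
have H m n : (m <= n)%N -> m%:R = n%:R :> kb -> m = n.
  move=> mn /esym/eqP; rewrite -subr_eq0 -natrB //.
  case E: (n - m)%N => [|l]; last by rewrite (negPf (pchar0_natf kb k_char0 l)).
  by move=> _; apply/eqP; rewrite eqn_leq mn -subn_eq0 E.
move=> m n /= e; have [/H|/ltnW/H] := leqP m n; first exact.
by move=> /(_ (esym e)) ->.
Qed.

Lemma natr_avoid (s : seq kb) : exists n : nat, n%:R \notin s.
Proof.
apply: contrapT => nex.
have sub : {subset [seq n%:R | n <- iota 0 (size s).+1] <= s}.
  move=> _ /mapP [n _ ->]; apply: contrapT => /negP ns; by apply: nex; exists n.
have := uniq_leq_size _ sub; rewrite (map_inj_uniq natr_inj) iota_uniq => /(_ isT).
by rewrite size_map size_iota ltnn.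
Qed.

(** Two distinct pairs collide for at most one scalar, so any integer outside the finite list [bad]
    will do. *)
Lemma separating_combination (s : seq (kb * kb)) : exists n : nat,
  {in s &, forall x y, x.1 + n%:R * x.2 = y.1 + n%:R * y.2 -> x = y}.
Proof.
pose bad := [seq (x.1 - y.1) / (y.2 - x.2) | x <- s, y <- s].
have [n nbad] := natr_avoid bad; exists n => -[x1 x2] [y1 y2] xs ys /= e.
have [e2|ne2] := eqVneq x2 y2; first by move: e; rewrite e2 => /addIr ->.
case/negP: nbad; apply/allpairsP; exists ((x1, x2), (y1, y2)); split=> //=.
apply: (canRL (mulfK _)); first by rewrite subr_eq0 eq_sym.
apply/eqP; rewrite -subr_eq0.
have -> : n%:R * (y2 - x2) - (x1 - y1) = y1 + n%:R * y2 - (x1 + n%:R * x2).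
  by ring.
by rewrite e subrr.
Qed.

(** Separating all pairs of conjugates of [a] and [b] forces an automorphism fixing [a + n%:R * b]
    to fix both terms. *)
Lemma primitive_element (s : seq kb) :
  exists c : kb, forall g : gal kb, g c = c -> {in s, forall x, g x = x}.
Proof.
elim: s => [|a s [b bP]]; first by exists 0.
have [sa saP] := gal_orbit a; have [sb sbP] := gal_orbit b.
have [n nP] := separating_combination [seq (x, y) | x <- sa, y <- sb].
exists (a + n%:R * b : cl_field kb) => g; rewrite rmorphD rmorphM /= rmorph_nat => e.
have mg (h : gal kb) : (h a, h b) \in [seq (x, y) | x <- sa, y <- sb].
  exact: allpairs_f.
have [ga gb] := nP _ _ (mg g) (mg (gal_one kb)) e.
by move=> x; rewrite inE => /orP[/eqP->|] //; exact: bP.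
Qed.

Variables (T : finType) (act : gal kb -> T -> T).
Hypothesis act_mul : forall g h t, act (gal_mul g h) t = act g (act h t).
Hypothesis act_one : forall t, act (gal_one kb) t = t.
Hypothesis act_open : exists s : seq kb, forall g : gal kb,
  {in s, forall x, g x = x} -> forall t, act g t = t.

Definition equivariant (f : T -> kb) := forall g t, f (act g t) = g (f t).

Lemma gal_actK g t : act (gal_inv g) (act g t) = t.
Proof. by rewrite -act_mul gal_mulVg act_one. Qed.

Lemma equivariant_comb (f h : T -> kb) n : equivariant f -> equivariant h ->
  equivariant (fun t => f t + n%:R * h t).
Proof.
by move=> fe he g t; rewrite fe he rmorphD rmorphM /= rmorph_nat.
Qed.

Lemma gal_mulgV (g : gal kb) : gal_mul g (gal_inv g) = gal_one kb.
Proof. exact: (@tg_mulrV (gal_group kb) g). Qed.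

Lemma gal_actKV g t : act g (act (gal_inv g) t) = t.
Proof. by rewrite -act_mul gal_mulgV act_one. Qed.

(* With [c] a primitive element of an extension trivializing the action, [T]
   is separated by the sums, over the conjugates [b] of [c], of [b ^+ j]
   weighted by the number of the point transported from [c] to [b]. *)
Lemma equivariant_injection : exists2 f : T -> kb, equivariant f & injective f.
Proof.
have [s0 s0P] := act_open; have [c cP] := primitive_element s0.
have {s0 s0P cP} cP (g : gal kb) : g c = c -> forall t, act g t = t.
  by move=> gc; apply: s0P; exact: cP.
have [s sP] := gal_orbit c.
pose O := undup [seq b <- s | `[< exists g : gal kb, b = g c >]].
have OP b : (b \in O) = `[< exists g : gal kb, b = g c >].
  rewrite mem_undup mem_filter andb_idr // => /asboolP [g ->]; exact: sP.
have gO (g : gal kb) : perm_eq O [seq g b | b <- O].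
  have gI : injective g by exact: (bij_inj (gal_bij g)).
  apply: uniq_perm; [exact: undup_uniq|by rewrite map_inj_uniq // undup_uniq|].
  move=> b; apply/idP/mapP => [|[d + ->]]; rewrite ?OP; last first.
    by move=> /asboolP [h ->]; apply/asboolP; exists (gal_mul g h).
  move=> /asboolP [h ->]; exists (gal_mul (gal_inv g) h c).
    by rewrite OP; apply/asboolP; exists (gal_mul (gal_inv g) h).
  by rewrite -[RHS]/(gal_mul (gal_mul g (gal_inv g)) h c) gal_mulgV.
(* The value does not depend on which automorphism carries [c] to [b], since the stabilizer of [c]
   acts trivially on [T]. The default occurs only when [b] is not a conjugate of [c]. *)
pose w t b := act (gal_inv (choose_or (gal_one kb) (fun g : gal kb => g c = b))) t.
have wE (g : gal kb) t : w t (g c) = act (gal_inv g) t.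
  rewrite /w /choose_or; case: pselect => [ex|[]]; last by exists g.
  case: cid => h /= hc.
  have gh : gal_mul (gal_inv g) h c = c.
    by rewrite /= hc -[LHS]/(gal_mul (gal_inv g) g c) gal_mulVg.
  by rewrite -[LHS](cP _ gh) act_mul gal_actKV.
pose psi j t := \sum_(b <- O) (enum_rank (w t b))%:R * b ^+ j.
have psi_eqv j : equivariant (psi j).
  move=> g t; rewrite /psi (perm_big _ (gO g)) big_map raddf_sum /=.
  rewrite big_seq [RHS]big_seq; apply: eq_bigr => b.
  rewrite OP => /asboolP [h ->]; rewrite rmorphM rmorph_nat rmorphXn /=.
  rewrite -[g (h c)]/(gal_mul g h c) !wE; congr ((enum_rank _)%:R * _).
  by rewrite -{1}(gal_actKV h t) -(act_mul g h) gal_actK.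
(* Integral combinations merge the finitely many [psi j] into a single equivariant function whose
   values determine theirs. *)
have [f fe fP] : exists2 f : T -> kb, equivariant f & forall t u, f t = f u ->
    forall j, (j < (size O).+1)%N -> psi j t = psi j u.
  elim: (size O).+1 => [|n [f fe fP]].
    by exists (fun=> 0) => // g t; rewrite rmorph0.
  have [m mP] := separating_combination [seq (f t, psi n t) | t <- enum T].
  exists (fun t => f t + m%:R * psi n t); first exact: equivariant_comb.
  move=> t u e j; rewrite ltnS leq_eqVlt.
  have := mP (f t, psi n t) (f u, psi n u).
  rewrite !map_f ?mem_enum // => /(_ isT isT e) [ftu ptu].
  by case/orP => [/eqP -> //|]; exact: fP.
exists f => // t u /fP tu.
(* Equality of all [psi j] at [t] and [u] says that the weights [d] annihilate every polynomial of
   small degree on the orbit [O]. *)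
pose d b : kb := (enum_rank (w t b))%:R - (enum_rank (w u b))%:R.
have dq (q : {poly kb}) : (size q <= (size O).+1)%N ->
    \sum_(b <- O) d b * q.[b] = 0.
  move=> sq; under eq_bigr => b _ do rewrite (horner_coef_wide _ sq) mulr_sumr.
  rewrite exchange_big big1 //= => j _.
  under eq_bigr => b _ do rewrite mulrCA mulrBl.
  by rewrite -mulr_sumr sumrB [X in X - _](tu j) // subrr mulr0.
have cO : c \in O by rewrite OP; apply/asboolP; exists (gal_one kb).
have uO : uniq O by exact: undup_uniq.
(* Vanishing at every conjugate except [c], this polynomial isolates [d c], which compares the
   numbers of [t] and [u] themselves. *)
pose q : {poly kb} := \prod_(b <- rem c O) ('X - b%:P).
have sq : (size q <= (size O).+1)%N.
  by rewrite size_prod_XsubC size_rem // prednK; last by case: (O) cO.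
have qE b : (q.[b] == 0) = (b \in rem c O) by rewrite -root_prod_XsubC.
have := dq q sq; rewrite (big_rem _ cO) /= [X in _ + X](_ : _ = 0); last first.
  rewrite big_seq big1 // => b; rewrite -qE => /eqP ->; exact: mulr0.
rewrite addr0 => /eqP; rewrite mulf_eq0 qE.
rewrite mem_rem_uniq // inE eqxx /= orbF subr_eq0 => /eqP e.
have wc v : w v c = v by rewrite -[c]/(gal_one kb c) wE -{1}(act_one v) gal_actK.
apply: enum_rank_inj; apply: val_inj.
by move: e; rewrite !wc => /natr_inj.
Qed.
End Separation.

(** * Finite group schemes from finite Galois groups *)

Lemma ahom_eq (k : comPzRingType) (A B : alg k) (f g : ahom A B) :
  f =1 g -> f = g.
Proof.
case: f g => [[f [[f1] [f2]]] fE] [[g [[g1] [g2]]] gE] /= /funext fg.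
case: g / fg g1 g2 gE => g1 g2.
rewrite (Prop_irrelevance g1 f1) (Prop_irrelevance g2 f2) => gE.
by rewrite (Prop_irrelevance gE fE).
Qed.

HB.instance Definition _ (k : comPzRingType) (A B : alg k) :=
  gen_eqMixin (ahom A B).
HB.instance Definition _ (k : comPzRingType) (A B : alg k) :=
  gen_choiceMixin (ahom A B).

Section MakeHom.
Variables (k : comPzRingType) (A B : alg k) (f : A -> B).
Hypotheses (fz : zmod_morphism f) (fm : monoid_morphism f)
  (fk : forall c, f (alg_map A c) = alg_map B c).

Definition make_rmorphism : {rmorphism A -> B} :=
  HB.pack f (GRing.isZmodMorphism.Build A B f fz)
    (GRing.isMonoidMorphism.Build A B f fm).

Definition make_ahom : ahom A B := @AHom k A B make_rmorphism fk.
End MakeHom.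

Definition ahom_comp (k : comPzRingType) (A B C : alg k) (g : ahom B C)
  (f : ahom A B) : ahom A C.
Proof.
by refine (@AHom k A C (g \o f) _) => c /=; rewrite !ahomE.
Defined.

Definition ahom_id (k : comPzRingType) (A : alg k) : ahom A A :=
  @AHom k A A idfun (fun=> erefl).

(** * The algebra of equivariant functions *)

Section EquivariantFunctions.
Variables (k : fieldType) (kb : alg_closure k).
Variables (T : finType) (act : gal kb -> T -> T).

Record efun := EFun { ef :> T -> kb; efP : equivariant act ef }.

HB.instance Definition _ := gen_eqMixin efun.
HB.instance Definition _ := gen_choiceMixin efun.

Lemma efun_eq (f g : efun) : f =1 g -> f = g.
Proof.
case: f g => [f fe] [g ge] /= /funext fg; case: g / fg ge => ge.
by congr EFun; exact: Prop_irrelevance.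
Qed.

Lemma efun_const_subproof (c : k) : equivariant act (fun=> cl_in kb c).
Proof. by move=> g t; rewrite gal_fix. Qed.
Definition efun_const c := EFun (efun_const_subproof c).

Lemma efun_opp_subproof (f : efun) : equivariant act (fun t => - f t).
Proof. by move=> g t; rewrite efP rmorphN. Qed.
Definition efun_opp f := EFun (efun_opp_subproof f).

Lemma efun_add_subproof (f h : efun) : equivariant act (fun t => f t + h t).
Proof. by move=> g t; rewrite !efP rmorphD. Qed.
Definition efun_add f h := EFun (efun_add_subproof f h).

Lemma efun_mul_subproof (f h : efun) : equivariant act (fun t => f t * h t).
Proof. by move=> g t; rewrite !efP rmorphM. Qed.
Definition efun_mul f h := EFun (efun_mul_subproof f h).

Lemma efun_addA : associative efun_add.
Proof. by move=> f g h; apply: efun_eq => t; exact: addrA. Qed.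
Lemma efun_addC : commutative efun_add.
Proof. by move=> f g; apply: efun_eq => t; exact: addrC. Qed.
Lemma efun_add0 : left_id (efun_const 0) efun_add.
Proof. by move=> f; apply: efun_eq => t /=; rewrite rmorph0 add0r. Qed.
Lemma efun_addN : left_inverse (efun_const 0) efun_opp efun_add.
Proof. by move=> f; apply: efun_eq => t /=; rewrite rmorph0 addNr. Qed.
HB.instance Definition _ :=
  GRing.isZmodule.Build efun efun_addA efun_addC efun_add0 efun_addN.

Lemma efun_mulA : associative efun_mul.
Proof. by move=> f g h; apply: efun_eq => t; exact: mulrA. Qed.
Lemma efun_mulC : commutative efun_mul.
Proof. by move=> f g; apply: efun_eq => t; exact: mulrC. Qed.
Lemma efun_mul1 : left_id (efun_const 1) efun_mul.
Proof. by move=> f; apply: efun_eq => t /=; rewrite rmorph1 mul1r. Qed.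
Lemma efun_mulD : left_distributive efun_mul efun_add.
Proof. by move=> f g h; apply: efun_eq => t; exact: mulrDl. Qed.
HB.instance Definition _ :=
  GRing.Zmodule_isComPzRing.Build efun efun_mulA efun_mulC efun_mul1 efun_mulD.

Lemma efun_const_zmod : zmod_morphism efun_const.
Proof. by move=> c d; apply: efun_eq => t /=; rewrite rmorphB. Qed.
Lemma efun_const_monoid : monoid_morphism efun_const.
Proof.
split; first by apply: efun_eq => t /=.
by move=> c d; apply: efun_eq => t /=; rewrite rmorphM.
Qed.
HB.instance Definition _ :=
  GRing.isZmodMorphism.Build k efun efun_const efun_const_zmod.
HB.instance Definition _ :=
  GRing.isMonoidMorphism.Build k efun efun_const efun_const_monoid.

Definition efun_alg : alg k := Alg efun efun_const.

Lemma efunB (f h : efun_alg) t : (f - h) t = f t - h t. Proof. by []. Qed.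
Lemma efunM (f h : efun_alg) t : (f * h) t = f t * h t. Proof. by []. Qed.
Lemma efun1 t : (1 : efun_alg) t = 1. Proof. exact: rmorph1. Qed.
Lemma efun_sum (J : Type) (r : seq J) P (F : J -> efun_alg) t :
  (\sum_(j <- r | P j) F j) t = \sum_(j <- r | P j) F j t.
Proof.
apply: (big_morph (fun f : efun_alg => f t)) => //; exact: rmorph0.
Qed.
End EquivariantFunctions.

(** * Galois-equivariant Lagrange interpolation *)

Section Lagrange.
Variables (k : fieldType) (kb : alg_closure k).
Variables (T : finType) (act : gal kb -> T -> T) (phi : T -> kb).
Hypotheses (phi_eqv : equivariant act phi) (phi_inj : injective phi).
Hypothesis act_bij : forall g, bijective (act g).

Definition lagrange_basis t : {poly kb} :=
  \prod_(u | u != t) ((phi t - phi u)^-1 *: ('X - (phi u)%:P)).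

Lemma horner_lagrange t u : (lagrange_basis t).[phi u] = (t == u)%:R.
Proof.
rewrite horner_prod; have [<-|tu] := eqVneq.
  rewrite big1 // => v vt; rewrite hornerZ hornerXsubC mulVf // subr_eq0.
  by rewrite (inj_eq phi_inj) eq_sym.
apply/eqP; rewrite prodf_seq_eq0; apply/hasP; exists u; first exact: mem_index_enum.
by rewrite eq_sym tu hornerZ hornerXsubC subrr mulr0 eqxx.
Qed.

(** Galois permutes the basis as it permutes the nodes; hence the interpolation coefficients of an
    equivariant function are Galois invariant and come from [k]. *)
Lemma map_lagrange g t :
  map_poly (gal_fun g) (lagrange_basis t) = lagrange_basis (act g t).
Proof.
rewrite rmorph_prod /lagrange_basis [RHS](reindex (act g)) /=; last first.
  exact: onW_bij.
apply: eq_big => [u|u _]; first by rewrite (bij_eq (act_bij g)).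
by rewrite map_polyZ fmorphV rmorphB map_polyXsubC !phi_eqv.
Qed.

Definition lagrange_deg := \max_t size (lagrange_basis t).

Lemma lagrange_interpolation (h : T -> kb) t :
  \sum_(j < lagrange_deg) (\sum_u h u * (lagrange_basis u)`_j) * phi t ^+ j = h t.
Proof.
under eq_bigr => j _ do rewrite mulr_suml.
rewrite exchange_big /= (bigD1 t) //= [X in _ + X]big1 ?addr0 => [|u ut].
  under eq_bigr => j _ do rewrite -mulrA.
  rewrite -mulr_sumr -horner_coef_wide ?horner_lagrange ?eqxx ?mulr1 //.
  exact: (leq_bigmax t).
under eq_bigr => j _ do rewrite -mulrA.
rewrite -mulr_sumr -horner_coef_wide ?horner_lagrange ?(negPf ut) ?mulr0 //.
exact: (leq_bigmax u).
Qed.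

Lemma lagrange_coef_eqv g t j : (lagrange_basis (act g t))`_j = g (lagrange_basis t)`_j.
Proof. by rewrite -map_lagrange coef_map. Qed.
End Lagrange.

(** * The group scheme attached to a finite group with Galois action *)

Section GroupScheme.
Variables (k : fieldType) (kb : alg_closure k).
Hypothesis k_char0 : [pchar k] =i pred0.
Variables (H : finGroupType) (act : gal kb -> H -> H).
Hypothesis act_mul : forall g h t, act (gal_mul g h) t = act g (act h t).
Hypothesis act_one : forall t, act (gal_one kb) t = t.
Hypothesis act_morph : forall g, {morph act g : x y / (x * y)%g}.
Variable phi : H -> kb.
Hypotheses (phi_eqv : equivariant act phi) (phi_inj : injective phi).

Notation A0 := (efun_alg act).
Notation n := (lagrange_deg phi).
Notation L := (lagrange_basis phi).

Lemma act_bij g : bijective (act g).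
Proof.
exists (act (gal_inv g)) => t; first exact: (gal_actK act_mul act_one).
exact: (gal_actKV act_mul act_one).
Qed.

Lemma act_unit g : act g 1%g = 1%g.
Proof.
by apply: (@mulgI _ (act g 1%g)); rewrite -act_morph !mulg1.
Qed.

Lemma act_inverse g h : act g (h^-1)%g = ((act g h)^-1)%g.
Proof.
by apply: (@mulgI _ (act g h)); rewrite -act_morph !mulgV act_unit.
Qed.

(** Descent of Galois invariant elements to [k]; on other elements the value is arbitrary. *)
Definition fixed_val (a : kb) : k := choose_or 0 (fun c => cl_in kb c = a).

Lemma fixed_valE a : (forall g : gal kb, g a = a) -> cl_in kb (fixed_val a) = a.
Proof.
move=> /(gal_fixed k_char0) ex; rewrite /fixed_val /choose_or.
by case: pselect => // ex'; case: cid.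
Qed.

Lemma lagrange_sum_fixed (F : A0) j (g : gal kb) :
  g (\sum_u F u * (L u)`_j) = \sum_u F u * (L u)`_j.
Proof.
rewrite rmorph_sum [RHS](reindex (act g)) /=; last exact/onW_bij/act_bij.
apply: eq_bigr => u _; rewrite rmorphM /= efP.
by rewrite (lagrange_coef_eqv phi_eqv act_bij).
Qed.

Lemma coefL_subproof (F : A0) j :
  equivariant act (fun h => \sum_u F (h * u)%g * (L u)`_j).
Proof.
move=> g h; rewrite rmorph_sum (reindex (act g)) /=; last exact/onW_bij/act_bij.
apply: eq_bigr => u _; rewrite -act_morph efP rmorphM /=.
by rewrite (lagrange_coef_eqv phi_eqv act_bij).
Qed.
(** The coefficients, as functions of [h], of the interpolation of [u |-> F (h * u)] in powers of
    [phi u]. *)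
Definition coefL (F : A0) j : A0 := EFun (coefL_subproof F j).

Lemma powL_subproof j : equivariant act (fun h => phi h ^+ j).
Proof. by move=> g h; rewrite phi_eqv rmorphXn. Qed.
Definition powL j : A0 := EFun (powL_subproof j).

Lemma powLE j : powL j = powL 1 ^+ j.
Proof.
apply: efun_eq => h; elim: j => [|j IH]; first by rewrite [RHS]efun1.
by rewrite exprS efunM -IH /= expr1 exprS.
Qed.

Lemma coefLE (F : A0) h u :
  \sum_(j < n) coefL F j h * powL j u = F (h * u)%g.
Proof. exact: (lagrange_interpolation phi_inj (fun u => F (h * u)%g)). Qed.

Definition interp (F : A0) j : k := fixed_val (\sum_u F u * (L u)`_j).

Lemma interpE (F : A0) : F = \sum_(j < n) alg_map A0 (interp F j) * powL j.
Proof.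
apply: efun_eq => h; rewrite efun_sum.
under eq_bigr => j _.
  rewrite efunM /= fixed_valE; last exact: lagrange_sum_fixed.
  over.
by rewrite (lagrange_interpolation phi_inj F).
Qed.

Section Points.
Variable R : alg k.
Implicit Types x y z : ahom A0 R.

(* Convolution for the coproduct [F (h * u) = \sum_j coefL F j h * powL j u]. *)
Definition gmul_fun x y (F : A0) : R :=
  \sum_(j < n) x (coefL F j) * y (powL j).

(** This stands in for the tensor square of [A0]: each [B s] expands over [k] in powers of [phi],
    and [x], [y] are [k]-linear, so every splitting of [F (h * u)] gives the same sum. The algebra
    laws then follow from convenient splittings. *)
Lemma gmul_funE (S : finType) x y (F : A0) (A B : S -> A0) :
  (forall h u, F (h * u)%g = \sum_s A s h * B s u) ->
  gmul_fun x y F = \sum_s x (A s) * y (B s).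
Proof.
move=> FE; have cE j : coefL F j = \sum_s A s * alg_map A0 (interp (B s) j).
  apply: efun_eq => h; rewrite efun_sum /=.
  under eq_bigr => u _ do rewrite FE mulr_suml.
  rewrite exchange_big /=; apply: eq_bigr => s _.
  rewrite fixed_valE; last exact: lagrange_sum_fixed.
  by rewrite mulr_sumr; apply: eq_bigr => u _; rewrite mulrA.
rewrite /gmul_fun; under eq_bigr => j _.
  rewrite cE rmorph_sum mulr_suml.
  under eq_bigr => s _ do rewrite rmorphM ahomE -mulrA -(ahomE y) -rmorphM.
  over.
rewrite exchange_big /=; apply: eq_bigr => s _.
by rewrite -mulr_sumr -rmorph_sum -interpE.
Qed.

Lemma gmul_zmod x y : zmod_morphism (gmul_fun x y).
Proof.
move=> F F'; rewrite /gmul_fun -sumrB; apply: eq_bigr => j _.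
rewrite -mulrBl -rmorphB; congr (x _ * _); apply: efun_eq => h.
by rewrite efunB -sumrB; apply: eq_bigr => u _; rewrite efunB mulrBl.
Qed.

Lemma gmul_monoid x y : monoid_morphism (gmul_fun x y).
Proof.
split=> [|F F'].
  rewrite (@gmul_funE unit x y 1 (fun=> 1) (fun=> 1)) => [|h u].
    by rewrite big_const card_unit /= !rmorph1 mulr1 addr0.
  by rewrite big_const card_unit /= !rmorph1 mulr1 addr0.
rewrite (@gmul_funE _ x y _ (fun p : 'I_n * 'I_n => coefL F p.1 * coefL F' p.2)
  (fun p => powL p.1 * powL p.2)) => [|h u]; last first.
  rewrite efunM -!coefLE mulr_suml -(pair_bigA _ (fun i j : 'I_n =>
    (coefL F i * coefL F' j) h * (powL i * powL j) u)) /=.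
  apply: eq_bigr => i _; rewrite mulr_sumr; apply: eq_bigr => j _.
  by rewrite mulrACA.
rewrite /gmul_fun mulr_suml -(pair_bigA _ (fun i j : 'I_n =>
    x (coefL F i * coefL F' j) * y (powL i * powL j))) /=.
apply: eq_bigr => i _; rewrite mulr_sumr; apply: eq_bigr => j _.
by rewrite !rmorphM mulrACA.
Qed.

Lemma gmul_k x y c : gmul_fun x y (alg_map A0 c) = alg_map R c.
Proof.
rewrite (@gmul_funE unit x y _ (fun=> alg_map A0 c) (fun=> 1)) => [|h u].
  by rewrite big_const card_unit /= rmorph1 ahomE mulr1 addr0.
by rewrite big_const card_unit /= rmorph1 mulr1 addr0.
Qed.

Definition gmul x y : ahom A0 R :=
  make_ahom (gmul_zmod x y) (gmul_monoid x y) (gmul_k x y).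

Lemma gmulE x y F : gmul x y F = gmul_fun x y F. Proof. by []. Qed.

Lemma gmulA : associative gmul.
Proof.
move=> x y z; apply: ahom_eq => F; rewrite !gmulE [LHS]/gmul_fun.
under eq_bigr => j _ do rewrite gmulE /gmul_fun mulr_sumr.
rewrite exchange_big /=; apply: eq_bigr => i _; rewrite -/(gmul x y) gmulE.
(* Coassociativity: [F (h * u * v)] is expanded in powers at [u * v], and these in powers at [v]. *)
rewrite (@gmul_funE 'I_n x y _ (fun j => coefL F j)
    (fun j => coefL (powL j) i)) ?mulr_suml => [|h u].
  by apply: eq_bigr => j _; rewrite mulrA.
rewrite /=; under eq_bigr => v _.
  rewrite -mulgA -coefLE mulr_suml.
  over.
rewrite exchange_big /=; apply: eq_bigr => j _.
by rewrite mulr_sumr; apply: eq_bigr => v _; rewrite mulrA.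
Qed.

Lemma fixed_at1 (F : A0) : cl_in kb (fixed_val (F 1%g)) = F 1%g.
Proof. by apply: fixed_valE => g; rewrite -efP act_unit. Qed.

Lemma efun_constE c h : (alg_map A0 c) h = cl_in kb c. Proof. by []. Qed.

Definition gone_fun (F : A0) : R := alg_map R (fixed_val (F 1%g)).

Lemma gone_zmod : zmod_morphism gone_fun.
Proof.
move=> F F'; rewrite /gone_fun -rmorphB; congr (alg_map R _).
by apply: (fmorph_inj (cl_in kb)); rewrite rmorphB !fixed_at1.
Qed.

Lemma gone_monoid : monoid_morphism gone_fun.
Proof.
rewrite /gone_fun; split=> [|F F']; rewrite -?rmorphM -1?(rmorph1 (alg_map R)).
  by congr (alg_map R _); apply: (fmorph_inj (cl_in kb)); rewrite fixed_at1.
congr (alg_map R _).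
by apply: (fmorph_inj (cl_in kb)); rewrite rmorphM !fixed_at1.
Qed.

Lemma gone_k c : gone_fun (alg_map A0 c) = alg_map R c.
Proof.
by congr (alg_map R _); apply: (fmorph_inj (cl_in kb)); rewrite fixed_at1.
Qed.

Definition gone : ahom A0 R := make_ahom gone_zmod gone_monoid gone_k.

Lemma goneE F : gone F = alg_map R (fixed_val (F 1%g)). Proof. by []. Qed.

Lemma gmul1 : left_id gone gmul.
Proof.
move=> x; apply: ahom_eq => F; rewrite /= /gmul_fun.
under eq_bigr => j _ do rewrite goneE -(ahomE x) -rmorphM.
rewrite -rmorph_sum; congr (x _); apply: efun_eq => h; rewrite efun_sum.
under eq_bigr => j _ do rewrite efunM efun_constE fixed_at1.
by rewrite coefLE mul1g.
Qed.

Lemma gmulr1 : right_id gone gmul.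
Proof.
move=> x; apply: ahom_eq => F; rewrite /= /gmul_fun.
under eq_bigr => j _ do rewrite goneE -(ahomE x) -rmorphM.
rewrite -rmorph_sum; congr (x _); apply: efun_eq => h; rewrite efun_sum.
under eq_bigr => j _ do rewrite efunM efun_constE fixed_at1.
by rewrite coefLE mulg1.
Qed.

Lemma antipode_subproof (F : A0) : equivariant act (fun h => F (h^-1)%g).
Proof. by move=> g h; rewrite -act_inverse efP. Qed.
Definition antipode F : A0 := EFun (antipode_subproof F).

Lemma antipode_zmod : zmod_morphism antipode.
Proof. by move=> F F'; apply: efun_eq. Qed.
Lemma antipode_monoid : monoid_morphism antipode.
Proof. by split=> [|F F']; apply: efun_eq. Qed.
Lemma antipode_k c : antipode (alg_map A0 c) = alg_map A0 c.
Proof. exact: efun_eq. Qed.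

Definition ginv x : ahom A0 R :=
  ahom_comp x (make_ahom antipode_zmod antipode_monoid antipode_k).

Lemma gmulV : left_inverse gone ginv gmul.
Proof.
move=> x; apply: ahom_eq => F; rewrite gmulE goneE /gmul_fun -(ahomE x).
under eq_bigr => j _ do rewrite /= -rmorphM.
rewrite -rmorph_sum; congr (x _); apply: efun_eq => h; rewrite efun_sum.
under eq_bigr => j _ do rewrite efunM /=.
by rewrite [RHS]fixed_at1 -(mulVg h) -coefLE.
Qed.

Lemma gmulrV : right_inverse gone ginv gmul.
Proof.
move=> x; apply: ahom_eq => F; rewrite gmulE goneE /gmul_fun -(ahomE x).
under eq_bigr => j _ do rewrite /= -rmorphM.
rewrite -rmorph_sum; congr (x _); apply: efun_eq => h; rewrite efun_sum.
under eq_bigr => j _ do rewrite efunM /=.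
by rewrite [RHS]fixed_at1 -(mulgV h) -coefLE.
Qed.

Definition point_group : groupType :=
  HB.pack (ahom A0 R)
    (isGroup.Build (ahom A0 R) gmulA gmul1 gmulr1 gmulV gmulrV).
End Points.

Lemma twisted_mapM (R S : alg k) (f : ahom R S) (x y : point_group R) :
  ahom_comp f (x * y)%g =
  ((ahom_comp f x : point_group S) * (ahom_comp f y : point_group S))%g.
Proof.
apply: ahom_eq => F /=; rewrite /gmul_fun rmorph_sum.
by apply: eq_bigr => j _; rewrite rmorphM.
Qed.

Lemma twisted_finite : exists (A : alg k) (u : point_group A),
    finite_morphism (alg_map A) /\
    forall (R : alg k) (x : point_group R),
      exists f : ahom A R, ahom_comp f u = x /\
        forall f' : ahom A R, ahom_comp f' u = x -> f' =1 f.
Proof.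
exists A0, (ahom_id A0); split.
  exists n, (fun j : 'I_n => powL j) => F.
  by exists (fun j => interp F j); exact: interpE.
move=> R x; exists x; split; first exact: ahom_eq.
by move=> f' <- F.
Qed.

Definition twisted_scheme : finite_group_scheme k.
Proof.
refine (@FiniteGroupScheme k point_group (fun A B f x => ahom_comp f x)
  twisted_mapM _ _ twisted_finite).
- by move=> A f x fE; apply: ahom_eq => F; exact: fE.
- by move=> A B C f g h x hE; apply: ahom_eq => F; exact: hE.
Defined.

Section GeometricPoints.
Notation GP := (geom_points kb twisted_scheme).

Lemma eval_zmod h : zmod_morphism (fun F : A0 => F h : cl_alg kb).
Proof. by []. Qed.
Lemma eval_monoid h : monoid_morphism (fun F : A0 => F h : cl_alg kb).
Proof. by split=> //; exact: rmorph1. Qed.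
Lemma eval_k h c : (alg_map A0 c) h = alg_map (cl_alg kb) c.
Proof. by []. Qed.
Definition eval_pt h : GP := make_ahom (eval_zmod h) (eval_monoid h) (eval_k h).

Lemma eval_ptM : {morph eval_pt : h u / (h * u)%g}.
Proof. by move=> h u; apply: ahom_eq => F; exact: (esym (coefLE F h u)). Qed.

Lemma eval_pt_act g h : gal_act g (eval_pt h) = eval_pt (act g h).
Proof. by apply: ahom_eq => F /=; rewrite efP. Qed.

Lemma eval_pt_inj : injective eval_pt.
Proof.
move=> h u /(congr1 (fun x : ahom A0 (cl_alg kb) => x (powL 1))) /=.
exact: phi_inj.
Qed.

(** The polynomial [P] has coefficients in [k] and kills [phi] in [A0], so a point sends [phi] to
    some [phi h]. As the powers of [phi] span [A0], the point is evaluation at [h]. *)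
Lemma eval_pt_surj (x : GP) : exists h, eval_pt h = x.
Proof.
pose x' : ahom A0 (cl_alg kb) := x.
pose P : {poly kb} := \prod_u ('X - (phi u)%:P).
have Pfix (g : gal kb) j : g P`_j = P`_j.
  have gP : map_poly (gal_fun g) P = P.
    rewrite /P rmorph_prod [RHS](reindex (act g)) /=; last exact/onW_bij/act_bij.
    by apply: eq_bigr => u _; rewrite rmorphB /= map_polyX map_polyC phi_eqv.
  by rewrite -[in RHS]gP coef_map.
pose d := size P.
have PE (y : ahom A0 (cl_alg kb)) :
    y (\sum_(j < d) alg_map A0 (fixed_val P`_j) * powL j) = P.[y (powL 1)].
  rewrite rmorph_sum horner_coef; apply: eq_bigr => j _.
  rewrite rmorphM ahomE /= fixed_valE //; congr (_ * _).
  by rewrite powLE rmorphXn.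
have root0 h : P.[phi h] = 0.
  by apply/eqP; rewrite horner_prod (bigD1 h) //= hornerXsubC subrr mul0r.
have : P.[x' (powL 1)] = 0.
  rewrite -PE (_ : \sum_(j < d) _ = 0) ?rmorph0 //; apply: efun_eq => h.
  have := PE (eval_pt h); rewrite [X in P.[X]]/= expr1 root0 => e.
  exact: (etrans e (esym (rmorph0 (cl_in kb)))).
move=> /eqP; rewrite horner_prod prodf_seq_eq0 => /hasP [h _ /=].
rewrite hornerXsubC subr_eq0 => /eqP xh; exists h; apply: ahom_eq => F.
rewrite (interpE F) !rmorph_sum; apply: eq_bigr => j _.
rewrite !rmorphM !ahomE; congr (_ * _).
by rewrite powLE !rmorphXn /= expr1 -/x' xh.
Qed.
End GeometricPoints.

Section Constant.
Hypothesis act_triv : forall g h, act g h = h.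

Lemma indicator_subproof m : equivariant act (fun h => (h == m)%:R).
Proof. by move=> g h; rewrite act_triv rmorph_nat. Qed.
Definition indicator m : A0 := EFun (indicator_subproof m).

Lemma efun_val (F : A0) m : cl_in kb (fixed_val (F m)) = F m.
Proof. by apply: fixed_valE => g; rewrite -efP act_triv. Qed.

Lemma indicator_sum (F : A0) :
  F = \sum_m alg_map A0 (fixed_val (F m)) * indicator m.
Proof.
apply: efun_eq => h; rewrite efun_sum (bigD1 h) //= big1 => [|m mh].
  by rewrite efun_val eqxx mulr1 addr0.
by rewrite eq_sym (negPf mh) mulr0.
Qed.

(** For a trivial action all values descend to [k], and the indicators are equivariant orthogonal
    idempotents forming a basis of [A0]. *)
Lemma twisted_constant : constant_group_scheme twisted_scheme.
Proof.
exists H, (fun R (x : ahom A0 R) m => x (indicator m)); split.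
- by [].
- move=> R x y xy; apply: ahom_eq => F; rewrite (indicator_sum F) !rmorph_sum.
  apply: eq_bigr => m _; rewrite !rmorphM !ahomE; congr (_ * _).
  by have := congr1 (fun f => f m) xy.
- move=> R i; split=> [[x <-]|[iM i1]].
    split=> [m m'|].
      rewrite -rmorphM (_ : _ * _ = if m == m' then indicator m else 0).
        by case: eqP; rewrite ?rmorph0.
      apply: efun_eq => h; rewrite efunM /=; case: (eqVneq m m') => [<-|ne] /=.
        by rewrite -natrM mulnb andbb.
      rewrite [RHS](rmorph0 (cl_in kb)).
      by case: (eqVneq h m) => [->|_]; rewrite ?mul0r // (negPf ne) mulr0.
    rewrite -rmorph_sum -(rmorph1 x); congr (x _); rewrite [RHS]indicator_sum.
    apply: eq_bigr => m _; rewrite -[LHS]mul1r; congr (_ * _).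
    by apply: efun_eq => h; rewrite [RHS]efun_val.
  pose f (F : A0) : R := \sum_m alg_map R (fixed_val (F m)) * i m.
  have valB (F F' : A0) m :
      fixed_val ((F - F') m) = fixed_val (F m) - fixed_val (F' m).
    by apply: (fmorph_inj (cl_in kb)); rewrite rmorphB !efun_val.
  have valM (F F' : A0) m :
      fixed_val ((F * F') m) = fixed_val (F m) * fixed_val (F' m).
    by apply: (fmorph_inj (cl_in kb)); rewrite rmorphM !efun_val.
  have valC c m : fixed_val (alg_map A0 c m) = c.
    by apply: (fmorph_inj (cl_in kb)); rewrite efun_val.
  have fz : zmod_morphism f.
    move=> F F'; rewrite -sumrB; apply: eq_bigr => m _.
    by rewrite valB rmorphB mulrBl.
  have fk c : f (alg_map A0 c) = alg_map R c.
    by rewrite /f; under eq_bigr => m _ do rewrite valC;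
      rewrite -mulr_sumr i1 mulr1.
  have fm : monoid_morphism f.
    split=> [|F F']; first by rewrite -(rmorph1 (alg_map A0)) fk rmorph1.
    rewrite mulr_suml; apply: eq_bigr => m _.
    rewrite mulr_sumr (bigD1 m) //= big1 ?addr0 => [|m' m'm].
      by rewrite mulrACA iM eqxx valM rmorphM.
    by rewrite mulrACA iM eq_sym (negPf m'm) mulr0.
  exists (make_ahom fz fm fk); apply/funext => m /=.
  rewrite /f (bigD1 m) //= big1 => [|m' m'm].
    have -> : fixed_val (indicator m m) = 1.
      by apply: (fmorph_inj (cl_in kb)); rewrite efun_val /= eqxx rmorph1.
    by rewrite rmorph1 mul1r addr0.
  have -> : fixed_val (indicator m m') = 0.
    apply: (fmorph_inj (cl_in kb)).
    by rewrite efun_val rmorph0 /= (negPf m'm); exact: mulr0n.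
  by rewrite rmorph0 mul0r.
move=> R x y m.
rewrite [LHS](@gmul_funE _ (H * H)%type x y _
  (fun p => if (p.1 * p.2)%g == m then indicator p.1 else 0)
  (fun p => indicator p.2)) => [|h u].
  rewrite [RHS]big_mkcond /=; apply: eq_bigr => p _.
  by case: ifP; rewrite ?rmorph0 ?mul0r.
rewrite (bigD1 (h, u)) //= big1 => [|[h' u'] ne].
  rewrite eqxx mulr1 addr0; case: eqP => _ /=; first by rewrite eqxx.
  by rewrite [RHS]rmorph0.
rewrite /=; case: (eqVneq u u') ne => [<- ne|uu _]; last by rewrite mulr0.
have hh : h != h' by move: ne; rewrite xpair_eqE eqxx andbT eq_sym.
case: ifP => _ /=; rewrite ?(negPf hh) ?mul0r //.
by rewrite [X in X * _]rmorph0 mul0r.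
Qed.
End Constant.
End GroupScheme.

(** The interface to these group schemes: through [ev], cocycles with values in [G] are cocycles
    with values in [H]. *)
Lemma twisted_form (k : fieldType) (kb : alg_closure k)
    (k_char0 : [pchar k] =i pred0) (H : finGroupType) (act : gal kb -> H -> H) :
  (forall g h t, act (gal_mul g h) t = act g (act h t)) ->
  (forall t, act (gal_one kb) t = t) ->
  (forall g, {morph act g : x y / (x * y)%g}) ->
  (exists s : seq kb, forall g : gal kb,
    {in s, forall x, g x = x} -> forall t, act g t = t) ->
  exists (G : finite_group_scheme k) (ev : H -> geom_points kb G),
    [/\ injective ev, forall m, exists h, ev h = m,
        {morph ev : x y / (x * y)%g},
        forall g h, gal_act g (ev h) = ev (act g h) &
        (forall g h, act g h = h) -> constant_group_scheme G].
Proof.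
move=> aM a1 amorph aopen.
have [phi pe pi] := equivariant_injection k_char0 aM a1 aopen.
exists (twisted_scheme k_char0 aM a1 amorph pe pi).
exists (eval_pt k_char0 aM a1 amorph pe pi).
split; [exact: eval_pt_inj|exact: eval_pt_surj|exact: eval_ptM|exact: eval_pt_act|].
exact: twisted_constant.
Qed.

(** * Fibres of etale covers *)

Lemma root_in_image (K : closedFieldType) (L : fieldType)
    (f : {rmorphism K -> L}) (p : {poly K}) (z : L) :
  p != 0 -> root (map_poly f p) z -> exists w, f w = z.
Proof.
move=> p0; have [r pE] := closed_field_poly_normal p.
rewrite pE map_polyZ rootZ ?fmorph_eq0 ?lead_coef_eq0 //.
have -> : map_poly f (\prod_(w <- r) ('X - w%:P)) =
    \prod_(w <- [seq f w | w <- r]) ('X - w%:P).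
  by rewrite rmorph_prod big_map; apply: eq_bigr => w _; exact: map_polyXsubC.
by rewrite root_prod_XsubC => /mapP [w _ ->]; exists w.
Qed.

(** The powers of [b] up to the [n]-th are [n.+1] elements with coordinate vectors of length [n]; a
    nonzero row of the kernel of their matrix is an annihilating polynomial. *)
Lemma finite_algebra_root (K : fieldType) (B : comPzRingType)
    (beta : {rmorphism K -> B}) (n : nat) (e : 'I_n -> B) :
  (forall b, exists c : 'I_n -> K, b = \sum_(i < n) beta (c i) * e i) ->
  forall b, exists2 p : {poly K}, p != 0 &
    forall (L : fieldType) (f : {rmorphism B -> L}) (h : {rmorphism K -> L}),
      f \o beta =1 h -> root (map_poly h p) (f b).
Proof.
move=> gen b; have /choice [c cE] := fun j : nat => gen (b ^+ j).
pose M : 'M[K]_(n.+1, n) := \matrix_(j, i) c j i.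
have : kermx M != 0.
  rewrite kermx_eq0 /row_free; apply/eqP => r.
  by have := rank_leq_col M; rewrite r ltnn.
move=> /matrix0Pn [i [j uij]]; pose u := row i (kermx M).
have uM : u *m M = 0 by rewrite -row_mul mulmx_ker row0.
exists (\poly_(l < n.+1) u 0 (inord l)).
  apply: contraNneq uij => /polyP /(_ j); rewrite coef_poly ltn_ord coef0.
  by rewrite inord_val mxE => ->.
move=> L f h fh; rewrite /root (@horner_coef_wide _ n.+1); last first.
  by apply: leq_trans (size_poly _ _) _; exact: size_poly.
apply/eqP.
under eq_bigr => l _.
  rewrite coef_map coef_poly ltn_ord inord_val -rmorphXn [in f _]cE rmorph_sum.
  rewrite mulr_sumr.
  under eq_bigr => m _ do rewrite rmorphM [f (beta _)]fh mulrA -rmorphM.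
  over.
rewrite exchange_big /=; apply: big1 => m _; rewrite -mulr_suml -rmorph_sum.
have := congr1 (fun v : 'rV_n => v 0 m) uM; rewrite !mxE.
under eq_bigr => l _ do rewrite !mxE.
move=> u0; rewrite (_ : \sum_(_ < _) _ = 0) ?rmorph0 ?mul0r // -[RHS]u0.
by apply: eq_bigr => l _; rewrite !mxE.
Qed.

Section Fibres.
Variables (k : fieldType) (kb : alg_closure k).

Lemma fibre_eq (X : kfun k) (Y : etale_cover X) (A : alg k) (x : X A)
  (y y' : fibre Y x) : sval y = sval y' -> y = y'.
Proof. by apply: eq_sig_hprop => ? ? ?; exact: Prop_irrelevance. Qed.

Section Universal.
Variables (X : kfun k) (Y : etale_cover X) (x : X (cl_alg kb)).

Lemma fibre_algebra : exists (B : alg k) (beta : ahom (cl_alg kb) B) (y : Y B)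
    (n : nat) (e : 'I_n -> B),
  [/\ cov_proj Y y = kmap X beta x,
     forall b, exists c : 'I_n -> kb, b = \sum_(i < n) beta (c i) * e i &
     forall (S : alg k) (s : ahom (cl_alg kb) S) (y' : Y S),
       cov_proj Y y' = kmap X s x ->
       exists f : ahom B S, (f \o beta =1 s /\ kmap Y f y = y') /\
         forall f' : ahom B S, f' \o beta =1 s -> kmap Y f' y = y' -> f' =1 f].
Proof.
have [B [beta [y [[[n [m [e [r [gen _]]]]] _] yx yU]]]] := cov_finite_etale Y x.
by exists B, beta, y, n, e.
Qed.

(** Fibre points are homomorphisms from a finite algebra [B] to [kb], determined by the images of
    its generators, each of which is a root of a fixed polynomial. *)
Lemma fibre_finitary : finitary (fibre Y x).
Proof.
have [B [beta [yB [n [e [yx gen yU]]]]]] := fibre_algebra.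
have ex (y : fibre Y x) : exists f : ahom B (cl_alg kb),
    f \o beta =1 id /\ kmap Y f yB = sval y.
  have [|f [fP _]] := yU _ (ahom_id (cl_alg kb)) (sval y); last by exists f.
  by rewrite kmap_id //; exact: svalP y.
pose f y := projT1 (cid (ex y)).
have fP y : f y \o beta =1 id /\ kmap Y (f y) yB = sval y.
  exact: projT2 (cid (ex y)).
have rts i : exists s : seq kb, forall y, f y (e i) \in s.
  have [p p0 pP] := finite_algebra_root gen (e i).
  have [s _ sP] := roots_seq p0; exists s => y; rewrite sP.
  have := pP _ (f y) idfun (fP y).1.
  by rewrite map_poly_id.
have /choice [s sP] := rts.
pose t := flatten [seq s i | i <- enum 'I_n].
have tP y i : f y (e i) \in t.
  by apply/flattenP; exists (s i); rewrite ?map_f ?mem_enum.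
exists {ffun 'I_n -> seq_sub t}, (fun y => [ffun i => SeqSub (tP y i)]).
move=> y y' /ffunP yy'; apply: fibre_eq; rewrite -(fP y).2 -(fP y').2.
suff -> : f y = f y' by [].
apply: ahom_eq => b; have [c ->] := gen b; rewrite !rmorph_sum.
apply: eq_bigr => i _; rewrite !rmorphM; congr (_ * _).
  by rewrite [LHS](fP y).1 [RHS](fP y').1.
by have := yy' i; rewrite !ffunE => /(congr1 val).
Qed.

Variable e : field_extension kb.
Notation emb := (emb_hom e).

Lemma emb_fibre_inj (y y' : fibre Y x) :
  kmap Y emb (sval y) = kmap Y emb (sval y') -> y = y'.
Proof.
move=> yy'; apply: fibre_eq.
have [B [beta [yB [n [_ [yx _ yU]]]]]] := fibre_algebra.
have [|f [[fb fy] _]] := yU _ (ahom_id (cl_alg kb)) (sval y).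
  by rewrite kmap_id //; exact: svalP y.
have [|f' [[fb' fy'] _]] := yU _ (ahom_id (cl_alg kb)) (sval y').
  by rewrite kmap_id //; exact: svalP y'.
have [|h [_ hU]] := yU _ emb (kmap Y emb (sval y)).
  by rewrite cov_proj_nat (svalP y).
have comp (g : ahom B (cl_alg kb)) z : kmap Y g yB = z -> g \o beta =1 id ->
    kmap Y emb z = kmap Y emb (sval y) -> ahom_comp emb g =1 h.
  move=> <- gb zy; apply: hU; first by move=> a /=; rewrite [g _]gb.
  by rewrite -zy; apply: kmap_comp.
rewrite -fy -fy'; congr (kmap Y _ yB); apply: ahom_eq => b.
apply: (fmorph_inj (ext_emb e)).
have /= := comp f _ fy fb erefl b => ->.
by have /= := comp f' _ fy' fb' (esym yy') b => ->.
Qed.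

Definition emb_fibre (y : fibre Y x) : fibre (ext_cover e Y) (ext_point e x).
Proof.
exists (kmap Y emb (sval y)).
by rewrite /= cov_proj_nat (svalP y).
Defined.

(** Passing to a larger closure creates no new fibre points: the values of such a point are roots of
    polynomials over the algebraically closed [kb]. *)
Lemma emb_fibre_surj (y' : fibre (ext_cover e Y) (ext_point e x)) :
  exists y, emb_fibre y = y'.
Proof.
have [B [beta [yB [n [e' [yx gen yU]]]]]] := fibre_algebra.
have [|f [[fb fy] _]] := yU _ emb (sval y'); first exact: svalP y'.
have ex b : exists a : kb, ext_emb e a = f b.
  have [p p0 pP] := finite_algebra_root gen b.
  apply: (root_in_image p0); exact: (pP (ext_cl e) f (ext_emb e) fb).
pose f0 b := projT1 (cid (ex b)).
have f0P b : ext_emb e (f0 b) = f b by exact: projT2 (cid (ex b)).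
have eI := fmorph_inj (ext_emb e).
have fz : zmod_morphism (f0 : B -> cl_alg kb).
  by move=> a b; apply: eI; rewrite rmorphB !f0P rmorphB.
have fm : monoid_morphism (f0 : B -> cl_alg kb).
  split; first by apply: eI; rewrite f0P !rmorph1.
  by move=> a b; apply: eI; rewrite rmorphM !f0P rmorphM.
have fbeta a : f0 (beta a) = a by apply: eI; rewrite f0P; exact: fb.
have fk c : f0 (alg_map B c) = alg_map (cl_alg kb) c.
  by rewrite -(ahomE beta) fbeta.
pose g := make_ahom fz fm fk.
have gx : cov_proj Y (kmap Y g yB) = x.
  rewrite cov_proj_nat yx -(@kmap_comp _ _ _ _ _ beta g (ahom_id _)) ?kmap_id //.
  by move=> a /=; rewrite fbeta.
exists (exist (fun z => cov_proj Y z = x) _ gx); apply: fibre_eq.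
rewrite /= -fy; apply/esym/kmap_comp.
by move=> b /=; rewrite f0P.
Qed.
End Universal.
End Fibres.

(** * Functoriality of the fundamental group *)

Lemma choose_orP (T : Type) (x0 : T) (P : T -> Prop) :
  (exists x, P x) -> P (choose_or x0 P).
Proof. by rewrite /choose_or; case: pselect => // ex _; case: cid. Qed.

Section Pi1Map.
Variables (k : fieldType) (kb : alg_closure k) (e : field_extension kb).
Variables (X : kfun k) (x : X (cl_alg kb)).

(** Transport along the bijections [emb_fibre] yields an automorphism of the fibre functor, so the
    choice defining [pi1_map] succeeds. *)
Lemma pi1_mapP (g' : pi1 (ext_point e x)) (Y : etale_cover X) (y : fibre Y x) :
  pi1_act g' (ext_cover e Y) (emb_fibre e y) =
  emb_fibre e (pi1_act (pi1_map g') Y y).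
Proof.
have sur (Z : etale_cover X) z' : exists z : fibre Z x, emb_fibre e z = z'.
  exact: emb_fibre_surj.
pose inv Z z' := projT1 (cid (sur Z z')).
have invK Z z' : emb_fibre e (inv Z z') = z' by exact: projT2 (cid (sur Z z')).
have embI (Z : etale_cover X) : injective (@emb_fibre k kb X Z x e).
  by move=> z z' /(congr1 sval); exact: emb_fibre_inj.
pose g Z z := inv Z (pi1_act g' (ext_cover e Z) (emb_fibre e z)).
have gb Z : bijective (g Z).
  have [h hK Kh] := pi1_bij g' (ext_cover e Z).
  exists (fun z => inv Z (h (emb_fibre e z))) => z; apply: embI.
    by rewrite invK /g invK hK.
  by rewrite /g invK invK Kh.
have gn (Z Z' : etale_cover X) (f : forall A, Z A -> Z' A) : natural f ->
    (forall A z, cov_proj Z' (f A z) = cov_proj Z z) ->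
    forall (z : fibre Z x) (z' : fibre Z' x), sval z' = f _ (sval z) ->
      sval (g Z' z') = f _ (sval (g Z z)).
  move=> fn fp z z' zz'.
  have fg : cov_proj Z' (f _ (sval (g Z z))) = x by rewrite fp; exact: (svalP (g Z z)).
  suff -> : g Z' z' = exist (fun u => cov_proj Z' u = x) _ fg by [].
  apply: embI; rewrite /g invK; apply: fibre_eq.
  rewrite /= -fn -[kmap Z _ _]/(sval (emb_fibre e (g Z z))) /g invK.
  pose f' (A : alg e) : ext_cover e Z A -> ext_cover e Z' A := f (res (ext_in e) A).
  apply: (@pi1_nat _ _ _ _ g' (ext_cover e Z) (ext_cover e Z') f').
  - by move=> A B h u; exact: (fn _ _ (res_hom (ext_in e) h)).
  - by move=> A u; exact: fp.
  - by rewrite /= zz' -fn.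
have ex : exists g : pi1 x, forall (Y : etale_cover X) (y : fibre Y x)
    (y' : fibre (ext_cover e Y) (ext_point e x)),
    sval y' = kmap Y (emb_hom e) (sval y) ->
    sval (pi1_act g' (ext_cover e Y) y') =
      kmap Y (emb_hom e) (sval (pi1_act g Y y)).
  exists (Pi1 gb gn) => Z z z' zz'.
  have -> : z' = emb_fibre e z by exact: fibre_eq.
  by rewrite -[RHS]/(sval (emb_fibre e (g Z z))) invK.
apply: fibre_eq; exact: (choose_orP (pi1_one x) ex Y y (emb_fibre e y) erefl).
Qed.
End Pi1Map.

(** Normality of [kb]: [g] keeps the image of [b] among the roots of a polynomial over [k], and
    these roots all come from [kb]. *)
Lemma gal_resP (k : fieldType) (kb : alg_closure k) (e : field_extension kb)
  (g : gal (ext_cl e)) a : ext_emb e (gal_res g a) = g (ext_emb e a).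
Proof.
have eI := fmorph_inj (ext_emb e).
have ex (h : gal (ext_cl e)) b : exists c, ext_emb e c = h (ext_emb e b).
  have [p p0 pb] := cl_algebraic b.
  have p0' : map_poly (cl_in kb) p != 0 by rewrite map_poly_eq0.
  apply: (root_in_image p0').
  have -> : map_poly (ext_emb e) (map_poly (cl_in kb) p) =
      map_poly h (map_poly (ext_emb e) (map_poly (cl_in kb) p)).
    rewrite -!map_poly_comp; apply: eq_map_poly => c /=.
    by rewrite ext_comm gal_fix.
  by apply: rmorph_root; apply: rmorph_root.
pose f h b := projT1 (cid (ex h b)).
have fP h b : ext_emb e (f h b) = h (ext_emb e b).
  exact: projT2 (cid (ex h b)).
have fz : zmod_morphism (f g).
  by move=> b c; apply: eI; rewrite rmorphB !fP -rmorphB -rmorphB.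
have fm : monoid_morphism (f g).
  split; first by apply: eI; rewrite fP !rmorph1.
  by move=> b c; apply: eI; rewrite rmorphM !fP -rmorphM -rmorphM.
have fb : bijective (f g).
  exists (f (gal_inv g)) => b; apply: eI; rewrite !fP.
    by rewrite -[LHS]/(gal_mul (gal_inv g) g _) gal_mulVg.
  by rewrite -[LHS]/(gal_mul g (gal_inv g) _) gal_mulgV.
have fk c : f g (cl_in kb c) = cl_in kb c.
  by apply: eI; rewrite fP ext_comm gal_fix.
have exh : exists h : gal kb, forall a, ext_emb e (h a) = g (ext_emb e a).
  by exists (Gal fz fm fb fk) => b; exact: fP.
exact: (choose_orP (gal_one kb) exh).
Qed.

Section PullbackCover.
Variables (k : fieldType) (X : kfun k) (E : etale_cover (point_scheme k)).

(** Pullback of [E] along the structure map of [X]; its fibre at [x] is a copy of the geometric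
    points of [E]. *)
Definition prod_kfun : kfun k.
Proof.
refine (@KFun k (fun A => (X A * E A)%type)
  (fun A B f u => (kmap X f u.1, kmap E f u.2)) _ _).
- by move=> A f [u v] fE /=; rewrite !kmap_id.
- by move=> A B C f g h [u v] hE /=; rewrite !(kmap_comp _ hE).
Defined.

Lemma pullback_cover_subproof (R : alg k) (x : X R) :
  exists (B : alg k) (beta : ahom R B) (y : prod_kfun B),
    [/\ finite_etale beta, y.1 = kmap X beta x &
      forall (S : alg k) (s : ahom R S) (y' : prod_kfun S),
        y'.1 = kmap X s x ->
        exists f : ahom B S, (f \o beta =1 s /\ kmap prod_kfun f y = y') /\
          forall f' : ahom B S,
            f' \o beta =1 s -> kmap prod_kfun f' y = y' -> f' =1 f].
Proof.
have [B [beta [y [fe _ yU]]]] := @cov_finite_etale k _ E R tt.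
exists B, beta, (kmap X beta x, y); split=> // S s [u v] /= us.
have [|f [[fb fy] fU]] := yU S s v; first by case: (cov_proj E v).
exists f; split; first split=> //.
  by rewrite /= fy us -(@kmap_comp _ X _ _ _ beta f s).
by move=> f' fb' [_ /= fy']; exact: fU.
Qed.

Definition pullback_cover : etale_cover X :=
  @EtaleCover k X prod_kfun (fun A u => u.1) (fun _ _ _ _ => erefl)
    pullback_cover_subproof.
End PullbackCover.

(** * Characterization of the projection to the Galois group *)

Section Pi1Proj.
Variables (k : fieldType) (kb : alg_closure k) (X : kfun k) (x : X (cl_alg kb)).

Definition proj_spec (g : pi1 x) (h : gal kb) : Prop :=
  forall (E : etale_cover (point_scheme k)) (Y : etale_cover X)
    (f : forall A, Y A -> E A), natural f ->
  forall y : fibre Y x,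
    f _ (sval (pi1_act g Y y)) = kmap E (gal_hom h) (f _ (sval y)).

Definition pullback_pt (E : etale_cover (point_scheme k)) (v : E (cl_alg kb)) :
  fibre (pullback_cover X E) x := exist (fun u => u.1 = x) (x, v) erefl.

Lemma proj_spec_pullback g h (E : etale_cover (point_scheme k))
    (v : E (cl_alg kb)) : proj_spec g h ->
  (sval (pi1_act g _ (pullback_pt v))).2 = kmap E (gal_hom h) v.
Proof.
move=> gh; exact: (gh E (pullback_cover X E) (fun A u => u.2) (fun _ _ _ _ => erefl)
  (pullback_pt v)).
Qed.

Lemma proj_spec1 : proj_spec (pi1_one x) (gal_one kb).
Proof. by move=> E Y f fn y /=; rewrite kmap_id. Qed.

Lemma proj_specM g h g' h' : proj_spec g h -> proj_spec g' h' ->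
  proj_spec (pi1_mul g g') (gal_mul h h').
Proof.
move=> gh gh' E Y f fn y; rewrite /= (gh E) // (gh' E) //.
by apply/esym/kmap_comp.
Qed.
End Pi1Proj.

(* [Ybar] maps to the pullback of [E] to [Xbar], each geometric point of which
   is fixed by an endomorphism factoring through a section over [Xbar]. *)
Lemma geom_pi1_map_spec (k : fieldType) (kb : alg_closure k) (X : kfun k)
    (x : X (cl_alg kb)) (h : pi1 (Xbar_point x)) :
  proj_spec (geom_pi1_map h) (gal_one kb).
Proof.
move=> E Y f fn y; rewrite kmap_id //.
pose e := closure_extension kb.
pose Eb : etale_cover (point_scheme kb) := ext_cover e E.
pose Yb := ext_cover e Y.
pose Z := pullback_cover (ext_scheme e X) Eb.
pose yb : fibre Yb (Xbar_point x) := emb_fibre e y.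
pose v : Eb (cl_alg (self_closure kb)) := f _ (sval yb).
pose s (A : alg kb) : ahom (cl_alg (self_closure kb)) A :=
  @AHom kb (cl_alg (self_closure kb)) A (alg_map A) (fun=> erefl).
pose c (A : alg kb) (z : Z A) : Z A := (z.1, kmap Eb (s A) v).
have vE : kmap Eb (s _) v = v by apply: kmap_id.
have cn : natural c.
  move=> A B u z; congr (_, _); rewrite -(@kmap_comp _ Eb _ _ _ (s A) u (s B)) //.
  by move=> a /=; rewrite -(ahomE u).
pose F (A : alg kb) (z : Yb A) : Z A := (cov_proj Yb z, f _ z).
have Fn : natural F.
  move=> A B u z; congr (_, _); first exact: cov_proj_nat.
  exact: (fn _ _ (res_hom (cl_in kb) u)).
pose z : fibre Z (Xbar_point x) := pullback_pt (Xbar_point x) v.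
have zF : sval z = F _ (sval yb) by congr (_, _); exact: (esym (svalP yb)).
have h1 := pi1_nat h Fn (fun A z => erefl) zF.
have zc : sval z = c _ (sval z) by congr (_, _); exact: (esym vE).
have h2 := pi1_nat h cn (fun A z => erefl) zc.
have E1 : f _ (sval (pi1_act h Yb yb)) = v.
  by have := congr1 snd h1; rewrite /= => <-; rewrite h2.
have := pi1_mapP h y => /(congr1 sval) hy.
have fin (u : E (cl_alg kb)) : cov_proj E u = tt by case: (cov_proj E u).
pose pt u : @fibre _ _ E (cl_alg kb) tt := exist (fun u => cov_proj E u = tt) u (fin u).
suff : pt (f _ (sval (pi1_act (geom_pi1_map h) Y y))) = pt (f _ (sval y)).
  by move=> /(congr1 sval).
apply: (@emb_fibre_inj _ _ _ E tt e); rewrite /= -!fn.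
by rewrite -[RHS]E1; congr (f _ _).
Qed.

Section Exact.
Variables (k : fieldType) (kb : alg_closure k) (X : kfun k) (x : X (cl_alg kb)).
Hypothesis X_exact : fundamental_sequence_exact x.

(* If no [h] were associated with [g], then [pi1_proj g] would take its default
   value, so that [g] would be geometric, hence associated with [gal_one]. *)
Lemma pi1_projP (g : pi1 x) : proj_spec g (pi1_proj g).
Proof.
apply: choose_orP; apply: contrapT => nex.
have [_ kerE _] := X_exact.
have /kerE [h hg] : pi1_proj g = gal_one kb.
  by rewrite /pi1_proj /choose_or; case: pselect.
by apply: nex; exists (gal_one kb); rewrite -hg; exact: geom_pi1_map_spec.
Qed.

(* If [g] maps to [n], then [g] and the identity are associated with the same
   elements; as [choose_or] depends only on this set, [n = pi1_proj 1]. *)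
Lemma gal_trivial_on_covers (n : gal kb) :
  (forall (E : etale_cover (point_scheme k)) (v : E (cl_alg kb)),
    kmap E (gal_hom n) v = v) -> n = gal_one kb.
Proof.
have key m : (forall (E : etale_cover (point_scheme k)) (v : E (cl_alg kb)),
    kmap E (gal_hom m) v = v) -> m = pi1_proj (pi1_one x).
  move=> mtriv; have [_ _ /(_ m) [g gm]] := X_exact.
  rewrite -gm; congr choose_or; apply/funext => h; apply/propext.
  have gP := pi1_projP g; rewrite gm in gP.
  by split=> H E Y f fn y; have := H E Y f fn y;
     have := gP E Y f fn y; rewrite mtriv => ->.
by move=> /key ->; apply/esym/key => E v; rewrite kmap_id.
Qed.

(** Every geometric point of [E] occurs in a fibre of its pullback to [X], so two candidates differ
    by an element trivial on all covers of the base field. *)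
Lemma pi1_proj_unique (g : pi1 x) h : proj_spec g h -> pi1_proj g = h.
Proof.
move=> gh; have gp := pi1_projP g.
have : gal_mul (gal_inv h) (pi1_proj g) = gal_one kb.
  apply: gal_trivial_on_covers => E v.
  rewrite (@kmap_comp _ E _ _ _ (gal_hom (pi1_proj g)) (gal_hom (gal_inv h))) //.
  rewrite -(proj_spec_pullback v gp) (proj_spec_pullback v gh).
  rewrite -(@kmap_comp _ E _ _ _ _ _ (gal_hom (gal_one kb))) ?kmap_id // => a.
  by rewrite -[RHS]/(gal_mul (gal_inv h) h a) gal_mulVg.
move=> e; apply: (@tg_mulI (gal_group kb) (gal_inv h)).
by rewrite [LHS]e; apply/esym; exact: gal_mulVg.
Qed.

Lemma pi1_projM : {morph @pi1_proj k kb X x : g h / pi1_mul g h >-> gal_mul g h}.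
Proof.
by move=> g h; apply: pi1_proj_unique; apply: proj_specM; exact: pi1_projP.
Qed.

Lemma pi1_proj1 : pi1_proj (pi1_one x) = gal_one kb.
Proof. exact/pi1_proj_unique/proj_spec1. Qed.

Lemma pi1_projV (g : pi1 x) : pi1_proj (pi1_inv g) = gal_inv (pi1_proj g).
Proof.
apply: (@tg_mulI (gal_group kb) (pi1_proj g)).
rewrite [RHS]gal_mulgV [LHS](esym (pi1_projM _ _)) -pi1_proj1.
by congr pi1_proj; exact: (@tg_mulrV (pi1_group x)).
Qed.

Lemma pi1_proj_section (e : field_extension kb)
    (sigma : gal_group (ext_cl e) -> pi1_group (ext_point e x)) :
  pi1_section sigma ->
  forall g, pi1_proj (pi1_map (sigma g)) = gal_res g :> gal kb.
Proof.
move=> [[_ sM] sP] g; apply: pi1_proj_unique.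
have s1 : sigma (gal_one _) = pi1_one _.
  have := sM 1%tg 1%tg; rewrite tg_mul1 => s11.
  apply: (@tg_mulI (pi1_group (ext_point e x)) (sigma 1%tg)).
  by rewrite -[LHS]s11; exact: (esym (tg_mulr1 _)).
(* Exactness is assumed over [k] only. Over [e], a failed choice would make [pi1_proj (sigma g)]
   trivial, against the section property when [g] is not the identity. *)
have spec : proj_spec (sigma g) g.
  have [->|g1] := pselect (g = gal_one _); first by rewrite s1; exact: proj_spec1.
  rewrite -{2}(sP g); apply: choose_orP; apply: contrapT => nex.
  apply: g1; rewrite -(sP g) /pi1_proj /choose_or.
  by case: pselect.
move=> E Y f fn y.
have fin (u : E (cl_alg kb)) : cov_proj E u = tt by case: (cov_proj E u).
pose pt u : @fibre _ _ E (cl_alg kb) tt := exist (fun u => cov_proj E u = tt) u (fin u).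
suff : pt (f _ (sval (pi1_act (pi1_map (sigma g)) Y y))) =
    pt (kmap E (gal_hom (gal_res g)) (f _ (sval y))) by move=> /(congr1 sval).
apply: (@emb_fibre_inj _ _ _ E tt e); rewrite /= -fn.
pose f' (A : alg e) : ext_cover e Y A -> ext_cover e E A := f (res (ext_in e) A).
have f'n : natural f' by move=> A B h u; exact: (fn _ _ (res_hom (ext_in e) h)).
have := spec (ext_cover e E) (ext_cover e Y) f' f'n (emb_fibre e y).
rewrite pi1_mapP /f' /= => ->; rewrite fn.
pose c : ahom (cl_alg kb) (res (ext_in e) (cl_alg (ext_cl e))) :=
  ahom_comp (emb_hom e) (gal_hom (gal_res g)).
rewrite -(@kmap_comp _ E _ _ _ (gal_hom (gal_res g)) (emb_hom e) c) //.
apply/esym; apply: (@kmap_comp _ E _ _ _ (emb_hom e)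
  (res_hom (ext_in e) (gal_hom g)) c) => a /=.
exact: gal_resP.
Qed.
End Exact.

(** * Compactness *)

(** Membership without decidable equality, as needed for lists of covers. *)
Fixpoint in_list (T : Type) (t : T) (s : seq T) : Prop :=
  if s is u :: s' then u = t \/ in_list t s' else False.

Definition sub_list (T : Type) (s s' : seq T) := forall t, in_list t s -> in_list t s'.

Lemma in_list_cat (T : Type) (t : T) s s' :
  in_list t (s ++ s') <-> in_list t s \/ in_list t s'.
Proof.
elim: s => [|u s IH] /=; first by tauto.
by rewrite IH; tauto.
Qed.

Lemma list_ultrafilter (T : Type) :
  exists2 D : (seq T -> Prop) -> Prop, ultrafilter D & forall s, D (sub_list s).
Proof.
apply: (directed_ultrafilter [::]) => [s1 s2 s3 s12 s23 t /s12 /s23 //|s s'].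
by exists (s ++ s') => t ts; apply/in_list_cat; [left|right].
Qed.

Lemma list_of_family (T : Type) n (a : 'I_n -> T) :
  exists s, forall i, in_list (a i) s.
Proof.
elim: n a => [|n IH] a; first by exists [::] => -[].
have [s sP] := IH (fun i => a (lift ord0 i)).
exists (a ord0 :: s) => i; case: (unliftP ord0 i) => [j ->|->]; last by left.
by right; exact: sP.
Qed.

Lemma finitary_enum (T : Type) : finitary T ->
  exists (n : nat) (a : 'I_n -> T), forall t, exists i, a i = t.
Proof.
move=> [F [f fI]]; have [[t0 _]|nT] := pselect (exists t : T, True); last first.
  exists 0%N, (fun i : 'I_0 => False_rect T (notF (ltn_ord i))) => t.
  by case: nT; exists t.
exists #|F|, (fun i => choose_or t0 (fun t => f t = enum_val i)) => t.
exists (enum_rank (f t)); apply: fI.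
have ex : exists u, f u = enum_val (enum_rank (f t)) by exists t; rewrite enum_rankK.
by rewrite (choose_orP t0 ex) enum_rankK.
Qed.

Lemma uf_pick (J : Type) (D : (J -> Prop) -> Prop) (T : Type) (P : J -> T -> Prop) :
  ultrafilter D -> finitary T -> D (fun j => exists t, P j t) ->
  exists t, D (fun j => P j t).
Proof.
move=> uD fT DP; have [j [t0 _]] := uf_ex uD DP.
have [t Dt] := uf_finitary uD (fun j => choose_or t0 (P j)) fT.
exists t; apply: (ufS uD _ (ufI uD DP Dt)) => i [ex <-]; exact: choose_orP.
Qed.

Lemma existT_inj (T : Type) (P : T -> Type) t (u v : P t) :
  existT P t u = existT P t v -> u = v.
Proof.
move=> e; have := projT2_eq e.
by rewrite (Prop_irrelevance (projT1_eq e) (erefl t)).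
Qed.

Lemma finitary_fin (F : finType) : finitary F.
Proof. by exists F, id. Qed.

Section GalLimit.
Variables (k : fieldType) (kb : alg_closure k).
Variables (J : Type) (D : (J -> Prop) -> Prop) (uD : ultrafilter D).

(** Compactness of the Galois group: values stay in finite orbits, and the limit of the inverses
    inverts the limit. *)
Lemma gal_ulim (eta : J -> gal kb) :
  exists g : gal kb, forall a, D (fun j => eta j a = g a).
Proof.
have lim (h : J -> gal kb) a : exists b, D (fun j => h j a = b).
  have [s sP] := @gal_orbit k kb a.
  apply: (uf_seq uD (s := s)); apply: (ufS uD _ (ufT uD)) => j _; exact: sP.
pose f h a := projT1 (cid (lim h a)).
have fP (h : J -> gal kb) a : D (fun j => h j a = f h a) by exact: projT2 (cid (lim h a)).
have fz : zmod_morphism (f eta).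
  move=> a b; apply: (uf_eq uD (fP eta (a - b))).
  apply: (ufS uD _ (ufI uD (fP eta a) (fP eta b))) => j [<- <-].
  exact: rmorphB.
have fm : monoid_morphism (f eta).
  split=> [|a b].
    by apply: (uf_eq uD (fP eta 1)); apply: (ufS uD _ (ufT uD)) => j _; exact: rmorph1.
  apply: (uf_eq uD (fP eta (a * b))).
  apply: (ufS uD _ (ufI uD (fP eta a) (fP eta b))) => j [<- <-].
  exact: rmorphM.
have fb : bijective (f eta).
  exists (f (fun j => gal_inv (eta j))) => a.
    have [j [e1 e2]] := uf_ex uD (ufI uD (fP eta a)
      (fP (fun j => gal_inv (eta j)) (f eta a))).
    by rewrite -e2 -e1 -[LHS]/(gal_mul (gal_inv (eta j)) (eta j) a) gal_mulVg.
  have [j [e1 e2]] := uf_ex uD (ufI uD (fP (fun j => gal_inv (eta j)) a)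
      (fP eta (f (fun j => gal_inv (eta j)) a))).
  by rewrite -e2 -e1 -[LHS]/(gal_mul (eta j) (gal_inv (eta j)) a) gal_mulgV.
have fk c : f eta (cl_in kb c) = cl_in kb c.
  apply/esym; apply: (uf_eq uD _ (fP eta (cl_in kb c))).
  by apply: (ufS uD _ (ufT uD)) => j _; exact: gal_fix.
by exists (Gal fz fm fb fk).
Qed.
End GalLimit.

Section Pi1Limit.
Variables (k : fieldType) (kb : alg_closure k) (X : kfun k) (x : X (cl_alg kb)).

Lemma pi1_actK (g : pi1 x) Y (y : fibre Y x) : pi1_act (pi1_inv g) Y (pi1_act g Y y) = y.
Proof. by rewrite -[LHS]/(pi1_act (pi1_mul (pi1_inv g) g) Y y) pi1_mulVg. Qed.

Lemma pi1_actKV (g : pi1 x) Y (y : fibre Y x) : pi1_act g Y (pi1_act (pi1_inv g) Y y) = y.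
Proof.
rewrite -[LHS]/(pi1_act (pi1_mul g (pi1_inv g)) Y y).
by rewrite [pi1_mul _ _](@tg_mulrV (pi1_group x)).
Qed.

Section Limit.
Variables (J : Type) (D : (J -> Prop) -> Prop) (uD : ultrafilter D).

(** Compactness of the fundamental group, from the finiteness of the fibres. *)
Lemma pi1_ulim (eta : J -> pi1 x) :
  exists g : pi1 x, forall Y (y : fibre Y x),
    D (fun j => pi1_act (eta j) Y y = pi1_act g Y y).
Proof.
have lim (h : J -> pi1 x) Y (y : fibre Y x) :
    exists z, D (fun j => pi1_act (h j) Y y = z).
  by apply: uf_finitary => //; exact: fibre_finitary.
pose f (h : J -> pi1 x) Y (y : fibre Y x) := projT1 (cid (lim h Y y)).
have fP (h : J -> pi1 x) Y (y : fibre Y x) : D (fun j => pi1_act (h j) Y y = f h Y y).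
  exact: projT2 (cid (lim h Y y)).
have fb Y : bijective (f eta Y).
  pose h j := pi1_inv (eta j); exists (f h Y) => y.
    have [j [e1 e2]] := uf_ex uD (ufI uD (fP eta Y y) (fP h Y (f eta Y y))).
    by rewrite -e2 -e1 pi1_actK.
  have [j [e1 e2]] := uf_ex uD (ufI uD (fP h Y y) (fP eta Y (f h Y y))).
  by rewrite -e2 -e1 pi1_actKV.
have fn (Y Y' : etale_cover X) (m : forall A, Y A -> Y' A) : natural m ->
    (forall A y, cov_proj Y' (m A y) = cov_proj Y y) ->
    forall (y : fibre Y x) (y' : fibre Y' x), sval y' = m _ (sval y) ->
      sval (f eta Y' y') = m _ (sval (f eta Y y)).
  move=> mn mp y y' yy'.
  have [j [<- <-]] := uf_ex uD (ufI uD (fP eta Y y) (fP eta Y' y')).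
  exact: (pi1_nat (eta j) mn mp).
by exists (Pi1 fb fn).
Qed.
End Limit.

Definition agree (l : seq (etale_cover X)) (g h : pi1 x) : Prop :=
  forall Y, in_list Y l -> forall y : fibre Y x, pi1_act g Y y = pi1_act h Y y.

Lemma agree_sub l l' g h : sub_list l l' -> agree l' g h -> agree l g h.
Proof. by move=> ll' gh Y /ll'; exact: gh. Qed.

Lemma agreeM l g h g' h' : agree l g h -> agree l g' h' ->
  agree l (pi1_mul g g') (pi1_mul h h').
Proof. by move=> gh gh' Y Yl y /=; rewrite gh' // gh. Qed.

Lemma agreeV l g h : agree l g h -> agree l (pi1_inv g) (pi1_inv h).
Proof.
by move=> gh Y Yl y; rewrite -[LHS](pi1_actK h) -gh // pi1_actKV.
Qed.

Lemma uf_agree (J : Type) (D : (J -> Prop) -> Prop) (uD : ultrafilter D)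
    (eta : J -> pi1 x) g l :
  (forall Y (y : fibre Y x), D (fun j => pi1_act (eta j) Y y = pi1_act g Y y)) ->
  D (fun j => agree l (eta j) g).
Proof.
move=> lim; elim: l => [|Y l IH]; first by apply: (ufS uD _ (ufT uD)) => j _ Y [].
have [n [a aP]] := finitary_enum (fibre_finitary Y x).
have := uf_all uD (fun i => lim Y (a i)) => DY.
apply: (ufS uD _ (ufI uD DY IH)) => j [Dj Dl] Z [<-|Zl] y; last exact: Dl.
by have [i <-] := aP y; exact: Dj.
Qed.

Lemma agree_open l g : @tg_open (pi1_group x) (fun h => agree l h g).
Proof.
elim: l => [|Y l IH].
  have -> : (fun h : pi1_group x => agree [::] h g) = (fun=> True).
    by apply/funext => h; apply/propext; split=> // _ Y [].
  exact: tg_openT.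
have -> : (fun h : pi1_group x => agree (Y :: l) h g) =
    (fun h => (forall y, pi1_act h Y y = pi1_act g Y y) /\ agree l h g).
  apply/funext => h; apply/propext; split=> [hg|[hY hl] Z [<-|/hl] //].
  by split=> [y|Z Zl]; apply: hg; [left|right].
apply: (@tg_openI (pi1_group x)) => // h hg.
have [n [a aP]] := finitary_enum (fibre_finitary Y x).
exists n, (fun i => existT (fun Y => fibre Y x) Y (a i)) => h' h'h y.
by have [i <-] := aP y; rewrite -hg; exact: (existT_inj (h'h i)).
Qed.

Lemma open_agree (O : pi1 x -> Prop) g : @tg_open (pi1_group x) O -> O g ->
  exists l, forall h, agree l h g -> O h.
Proof.
move=> Oo /Oo [n [a aP]].
have [l lP] := list_of_family (fun i => projT1 (a i)).
exists l => h hg; apply: aP => i; congr existT; exact: hg.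
Qed.

Lemma locally_constant_open (T : Type) (f : pi1 x -> T) l :
  (forall g h, agree l g h -> f g = f h) ->
  forall t, @tg_open (pi1_group x) (fun g => f g = t).
Proof.
move=> fl t; have -> : (fun g => f g = t) =
    (fun g => exists2 V, (exists h, f h = t /\ V = fun g => agree l g h) & V g).
  apply/funext => g; apply/propext; split=> [ft|[V [h [<- ->]] gh]].
    by exists (fun h => agree l h g) => //; exists g.
  exact: fl.
by apply: (@tg_openU (pi1_group x)) => V [h [_ ->]]; exact: agree_open.
Qed.

Hypothesis X_exact : fundamental_sequence_exact x.

(* Otherwise elements [w l] acting trivially on the fibres of [l] have images
   moving [a]; the limit of these images acts trivially on all covers of the base
   field, hence is the identity, a contradiction. *)
Lemma pi1_proj_continuous (s : seq kb) : exists l, forall g h : pi1 x,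
  agree l g h -> {in s, forall a, pi1_proj g a = pi1_proj h a}.
Proof.
suff one (a : kb) : exists l, forall w : pi1 x, agree l w (pi1_one x) ->
    pi1_proj w a = a.
  elim: s => [|a s [l lP]]; first by exists [::].
  have [l' l'P] := one a; exists (l' ++ l) => g h gh b.
  rewrite inE => /orP[/eqP ->|bs]; last first.
    by apply: lP => //; apply: agree_sub gh => Y Yl; apply/in_list_cat; right.
  have gh' : agree l' g h by apply: agree_sub gh => Y Yl; apply/in_list_cat; left.
  have := l'P (pi1_mul (pi1_inv g) h); rewrite (pi1_projM X_exact) (pi1_projV X_exact).
  have : agree l' (pi1_mul (pi1_inv g) h) (pi1_one x).
    by move=> Y Yl y /=; rewrite -gh' // pi1_actK.
  move=> ag /(_ ag) /(congr1 (pi1_proj g)) <-.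
  by rewrite -[LHS]/(gal_mul (pi1_proj g) (gal_inv (pi1_proj g)) _) gal_mulgV.
apply: contrapT => nl.
have ex l : exists w : pi1 x, agree l w (pi1_one x) /\ pi1_proj w a <> a.
  apply: contrapT => nw; apply: nl; exists l => w wl.
  by apply: contrapT => wa; apply: nw; exists w.
pose w l := projT1 (cid (ex l)).
have wP l : agree l (w l) (pi1_one x) /\ pi1_proj (w l) a <> a.
  exact: projT2 (cid (ex l)).
have [D uD Dl] := list_ultrafilter (etale_cover X).
have [eta etaP] := gal_ulim uD (fun l => pi1_proj (w l)).
have eta1 : eta = gal_one kb.
  apply: (gal_trivial_on_covers X_exact) => E v.
  have fin (u : E (cl_alg kb)) : cov_proj E u = tt by case: (cov_proj E u).
  pose K : alg k := Alg k idfun.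
  pose c : ahom K (cl_alg kb) := @AHom k K (cl_alg kb) (cl_in kb) (fun=> erefl).
  have [B [beta [yB [[[n [m [e [r [gen _]]]]] _] yx yU]]]] :=
    @cov_finite_etale k _ E K tt.
  have [|f [[fb fy] _]] := yU _ c v; first exact: fin.
  (* The point [v] factors through the finite algebra of [E], so the action on it is decided by the
     finitely many values [f (e i)]. *)
  have De := uf_all uD (fun i : 'I_n => etaP (f (e i))).
  have [l [De' Dl']] := uf_ex uD (ufI uD De (Dl [:: pullback_cover X E])).
  have [wl _] := wP l.
  have := proj_spec_pullback v (pi1_projP X_exact (w l)).
  rewrite wl /=; last by apply: Dl'; left.
  rewrite -fy => vE; rewrite [RHS]vE.
  rewrite -(@kmap_comp _ E _ _ _ f _ (ahom_comp (gal_hom eta) f)) //.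
  rewrite -(@kmap_comp _ E _ _ _ f _ (ahom_comp (gal_hom (pi1_proj (w l))) f)) //.
  congr (kmap E _ _); apply: ahom_eq => b; have [d ->] := gen b.
  rewrite !rmorph_sum; apply: eq_bigr => i _; rewrite !rmorphM /= De'.
  by congr (_ * _); rewrite -[beta _]/((beta \o idfun) _) [f _]fb /= !gal_fix.
have [l la] := uf_ex uD (etaP a).
by have [_] := wP l; rewrite la eta1.
Qed.
End Pi1Limit.

(** * Finite quotients of the fundamental group *)

(* The carrier of the quotient is transported to a subtype of [F], because
   [coset_space N] is too large to carry a [finGroupType] structure. *)
Lemma finite_quotient (P : top_group) (N : normal_subgroup P) (F : finType)
    (f : P -> F) :
  (forall g h, f g = f h -> N (tg_mul (tg_inv g) h)) ->
  exists (M : finGroupType) (pi : P -> M),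
    {morph pi : g h / tg_mul g h >-> (g * h)%g} /\
    forall g h, pi g = pi h <-> N (tg_mul (tg_inv g) h).
Proof.
move=> fN; pose r (u : coset_space N) := f (coset_repr u).
have rI : injective r.
  by move=> u v /fN /coset_eq; rewrite !Defs.coset_reprK.
pose T := {z : F | `[< exists u, r u = z >]}.
pose i u : T := exist _ (r u) (asboolT (ex_intro _ u erefl)).
pose j (z : T) : coset_space N := projT1 (cid (asboolP _ (valP z))).
have jK z : i (j z) = z by apply: val_inj; rewrite /= /j; case: cid.
have iK u : j (i u) = u by apply: rI; rewrite /j; case: cid.
pose m z w := i (quotient_mul (j z) (j w)).
pose o := i (left_coset N tg_one).
pose v z := i (quotient_inv (j z)).
have mA : associative m by move=> a b c; rewrite /m !iK quotient_mulA.
have m1 : left_id o m by move=> a; rewrite /m iK quotient_mul1 jK.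
have mV : left_inverse o v m by move=> a; rewrite /m iK quotient_mulV.
pose G := Defs.quotient_group N.
have mr1 : right_id o m.
  by move=> a; rewrite /m iK [quotient_mul _ _](@tg_mulr1 G) jK.
have mrV : right_inverse o v m.
  by move=> a; rewrite /m iK [quotient_mul _ _](@tg_mulrV G).
pose M : finGroupType := HB.pack T (isGroup.Build T mA m1 mr1 mV mrV).
exists M, (fun g => i (left_coset N g)); split=> [g h|g h].
  by rewrite -[RHS]/(m _ _) /m !iK quotient_mulE.
rewrite -coset_eq; split=> [|-> //].
by move=> /(congr1 j); rewrite !iK.
Qed.

Section Levels.
Variables (k : fieldType) (kb : alg_closure k) (X : kfun k) (x : X (cl_alg kb)).
Hypothesis X_exact : fundamental_sequence_exact x.
Variable U : normal_subgroup (pi1_group x).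
Hypothesis U_closed : closed_geometric U.

Lemma pi1_projU (u : pi1 x) : U u -> pi1_proj u = gal_one kb.
Proof.
move=> Uu; have [_ kerE _] := X_exact; apply/kerE.
exact: (U_closed.1 u Uu).
Qed.

(** Closedness of [U] is known only in the geometric fundamental group. The limit is therefore taken
    there, on preimages of the approximating elements, and its image is [z]. *)
Lemma U_agree_closed (z : pi1 x) :
  (forall l, exists2 u, U u & agree l u z) -> U z.
Proof.
move=> zU; have ex l : exists h : pi1 (Xbar_point x),
    U (geom_pi1_map h) /\ agree l (geom_pi1_map h) z.
  have [u Uu uz] := zU l; have [h hu] := U_closed.1 u Uu.
  by exists h; rewrite hu.
pose h l := projT1 (cid (ex l)).
have hP l : U (geom_pi1_map (h l)) /\ agree l (geom_pi1_map (h l)) z.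
  exact: projT2 (cid (ex l)).
have [D uD Dl] := list_ultrafilter (etale_cover X).
have [g gP] := pi1_ulim uD h.
have -> : z = geom_pi1_map g.
  apply: pi1_eq => Y y; pose e := closure_extension kb.
  suff E : emb_fibre e (pi1_act z Y y) =
      emb_fibre e (pi1_act (geom_pi1_map g) Y y).
    by apply: (@emb_fibre_inj _ _ _ Y x e); exact: (congr1 sval E).
  rewrite -(pi1_mapP g).
  have [l [hl Yl]] := uf_ex uD (ufI uD (gP (ext_cover e Y) (emb_fibre e y)) (Dl [:: Y])).
  rewrite -hl; rewrite [RHS](pi1_mapP (h l)); congr emb_fibre.
  by have [_ ->] := hP l; last by apply: Yl; left.
apply: contrapT => nU.
have [l lP] := open_agree U_closed.2 nU.
have [j jl] := uf_ex uD (uf_agree uD l gP).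
by have [Uj _] := hP j; exact: (lP _ jl).
Qed.

(** The product of [U] with the open subgroup of elements acting trivially on the fibres of [l]. *)
Definition level_set (l : seq (etale_cover X)) (g : pi1_group x) : Prop :=
  exists2 u, U u & agree l u g.

Lemma level_set1 l : level_set l tg_one.
Proof. by exists tg_one => //; exact: ns1. Qed.

Lemma level_setM l g h : level_set l g -> level_set l h -> level_set l (tg_mul g h).
Proof.
move=> [u Uu ug] [v Uv vh]; exists (tg_mul u v); [exact: nsM|exact: agreeM].
Qed.

Lemma level_setV l g : level_set l g -> level_set l (tg_inv g).
Proof. by move=> [u Uu ug]; exists (tg_inv u); [exact: nsV|exact: agreeV]. Qed.

Lemma level_setJ l g h : level_set l g ->
  level_set l (tg_mul (tg_mul h g) (tg_inv h)).
Proof.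
move=> [u Uu ug]; exists (tg_mul (tg_mul h u) (tg_inv h)); first exact: nsJ.
by apply: agreeM => //; exact: agreeM.
Qed.

Definition level_subgroup l : normal_subgroup (pi1_group x) :=
  NormalSubgroup (@level_set1 l) (@level_setM l) (@level_setV l) (@level_setJ l).

Lemma agree_finite l : exists (F : finType) (f : pi1 x -> F),
  forall g h, f g = f h -> agree l g h.
Proof.
elim: l => [|Y l [F [f fP]]].
  by exists unit, (fun=> tt) => g h _ Y [].
have [n [a aP]] := finitary_enum (fibre_finitary Y x).
have [F' [f' f'I]] := fibre_finitary Y x.
exists (F * {ffun 'I_n -> F'})%type.
exists (fun g => (f g, [ffun i => f' (pi1_act g Y (a i))])).
move=> g h [/fP gh /ffunP gh'] Z [<-|/gh //] y; have [i <-] := aP y.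
by have := gh' i; rewrite !ffunE => /f'I.
Qed.

Lemma level_exists l : exists (M : finGroupType) (pi : pi1_group x -> M),
  {morph pi : g h / tg_mul g h >-> (g * h)%g} /\
  forall g h, pi g = pi h <-> level_set l (tg_mul (tg_inv g) h).
Proof.
have [F [f fP]] := agree_finite l.
apply: (@finite_quotient _ (level_subgroup l) F f) => g h /fP gh.
exists tg_one; first exact: ns1.
by move=> Y Yl y /=; rewrite -gh // pi1_actK.
Qed.

Lemma level_set_sub l l' g : sub_list l l' -> level_set l' g -> level_set l g.
Proof. by move=> ll' [u Uu ug]; exists u => //; exact: agree_sub ug. Qed.

Lemma level_cap (g : pi1 x) : (forall l, level_set l g) -> U g.
Proof. by move=> lg; apply: U_agree_closed. Qed.

Lemma pi1U_proj_coset (g : pi1 x) : pi1U_proj (left_coset U g) = pi1_proj g.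
Proof.
rewrite /pi1U_proj; have /coset_eq := Defs.coset_reprK (left_coset U g).
move=> /pi1_projU; rewrite (pi1_projM X_exact) (pi1_projV X_exact) => e.
apply: (@tg_mulI (gal_group kb) (gal_inv (pi1_proj (coset_repr (left_coset U g))))).
by rewrite [RHS]e; exact: gal_mulVg.
Qed.

(** Dividing [h] by a suitable element of [U] preserves its coset and makes it agree with [g] on the
    fibres of [l]. *)
Lemma open_level (O : pi1U U -> Prop) (g : pi1_group x) :
  tg_open O -> O (left_coset U g) ->
  exists l, forall h : pi1_group x,
    level_set l (tg_mul (tg_inv g) h) -> O (left_coset U h).
Proof.
move=> Oo Og; have [l lP] := open_agree Oo Og; exists l => h [u Uu ug].
have -> : left_coset U h = left_coset U (tg_mul h (tg_inv u)).
  by apply/coset_eq; rewrite tg_mulKV; exact: nsV.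
apply: lP => Y Yl y /=.
rewrite -[RHS](congr1 (fun z => pi1_act g Y z) (pi1_actKV u y)).
by rewrite ug //= pi1_actKV.
Qed.
End Levels.

(** * Nonabelian cohomology *)

Section Cohomology.
Variables (k : fieldType) (kb : alg_closure k) (G : finite_group_scheme k).
Local Open Scope group_scope.
Implicit Types (g h : gal kb) (m n : geom_points kb G).

Lemma gal_actM g m n : gal_act g (m * n) = gal_act g m * gal_act g n.
Proof. exact: gs_mapM. Qed.

Lemma gal_act1 g : gal_act g (1 : geom_points kb G) = 1.
Proof. by apply: (@mulgI _ (gal_act g 1)); rewrite -gal_actM !mulg1. Qed.

Lemma gal_actV g m : gal_act g m^-1 = (gal_act g m)^-1.
Proof. by apply: (@mulgI _ (gal_act g m)); rewrite -gal_actM !mulgV gal_act1. Qed.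

Lemma gal_act_one m : gal_act (gal_one kb) m = m.
Proof. exact: gs_map_id. Qed.

Section Classes.
Variables (P : top_group) (rho : P -> gal kb).
Notation coh := (@cohomologous k kb G P rho).
Implicit Types a b c : P -> geom_points kb G.

Lemma cohomologous_refl a : coh a a.
Proof. by exists 1 => x; rewrite gal_act1 mulg1 invg1 mul1g. Qed.

Lemma cohomologous_sym a b : coh a b -> coh b a.
Proof.
move=> [m ab]; exists m^-1 => x; rewrite ab gal_actV invgK !mulgA mulgV mul1g.
by rewrite mulgK.
Qed.

Lemma cohomologous_trans a b c : coh a b -> coh b c -> coh a c.
Proof.
move=> [m ab] [n bc]; exists (m * n) => x.
by rewrite bc ab gal_actM invMg !mulgA.
Qed.

Lemma cohomologous_class a b : coh a b -> coh a = coh b.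
Proof.
move=> ab; apply/funext => c; apply/propext; split.
  exact/cohomologous_trans/cohomologous_sym.
exact: cohomologous_trans.
Qed.

Lemma cohomologous_classE a b : coh a = coh b -> coh a b.
Proof. by move=> ->; exact: cohomologous_refl. Qed.

Lemma cocycle1 (a : P -> geom_points kb G) :
  rho tg_one = gal_one kb -> cocycle rho a -> a tg_one = 1.
Proof.
move=> r1 [_ aM]; apply: (@mulgI _ (a tg_one)); rewrite mulg1.
by have := aM tg_one tg_one; rewrite r1 gal_act_one tg_mul1.
Qed.
End Classes.

Lemma pullback_class (P P' : top_group) (rho : P -> gal kb) (rho' : P' -> gal kb)
    (f : P' -> P) (a : P -> geom_points kb G) :
  (forall y, rho (f y) = rho' y) ->
  pullback rho' f (cohomologous rho a) = cohomologous rho' (a \o f).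
Proof.
move=> rf; apply/funext => b; apply/propext; split=> [[a' [m aa'] a'b]|ab].
  apply: cohomologous_trans a'b; by exists m => y /=; rewrite aa' rf.
by exists a => //; exact: cohomologous_refl.
Qed.
End Cohomology.

(** * Deflation of classes along the quotient by [U] *)

Section Evaluation.
Variables (k : fieldType) (kb : alg_closure k) (X : kfun k) (x : X (cl_alg kb)).
Hypothesis X_exact : fundamental_sequence_exact x.
Variable U : normal_subgroup (pi1_group x).
Hypothesis U_closed : closed_geometric U.
Variable G : finite_group_scheme k.
Local Open Scope group_scope.
Notation GP := (geom_points kb G).
Notation proj := (@pi1_proj k kb X x : pi1_group x -> gal kb).

Lemma pi1U_projM (u v : pi1U U) :
  pi1U_proj (tg_mul u v) = gal_mul (pi1U_proj u) (pi1U_proj v).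
Proof.
rewrite -(Defs.coset_reprK u) -(Defs.coset_reprK v) [tg_mul _ _]quotient_mulE.
by rewrite !(pi1U_proj_coset X_exact U_closed) -(pi1_projM X_exact).
Qed.

(** On [U] the Galois action is trivial, so cohomologous cocycles are conjugate there, and
    triviality of one representative passes to all. *)
Lemma geom_restriction_trivial (a : pi1_group x -> GP) :
  trivial_on_U U (geom_restriction (cohomologous proj a)) ->
  forall u, U u -> a u = 1.
Proof.
move=> [a' [a1 [m aa1] [n a1a']] a'1] u Uu.
have [h hu] := U_closed.1 u Uu; rewrite -hu in Uu *.
have := a'1 h Uu; rewrite a1a' /= aa1.
rewrite (pi1_projU X_exact U_closed Uu) !gal_act_one.
have conj1 (y z : GP) : z^-1 * y * z = 1 -> y = 1.
  by move=> e; apply: (@mulgI _ z^-1); apply: (@mulIg _ z); rewrite e mulg1 mulVg.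
by move=> /conj1 /conj1.
Qed.

(** A cocycle trivial on [U] is constant on its cosets, hence descends, and the choice in
    [deflation] succeeds. *)
Lemma deflationP alpha : @H1_scheme k kb X x G alpha ->
  trivial_on_U U (geom_restriction alpha) ->
  exists b : pi1U U -> GP, [/\ cocycle (@pi1U_proj k kb X x U) b,
    @deflation k kb X x U G alpha = cohomologous (@pi1U_proj k kb X x U) b &
    alpha (b \o left_coset U)].
Proof.
move=> [a [[ao aM] ->]] /geom_restriction_trivial aU.
pose b (u : pi1U U) := a (coset_repr u).
have bE g : b (left_coset U g) = a g.
  have /coset_eq Ug := Defs.coset_reprK (left_coset U g).
  rewrite -[g in RHS](tg_mulKV (tg_inv (coset_repr (left_coset U g)))) tg_invK.
  by rewrite aM (aU _ Ug) gal_act1 mulg1.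
have bc : cocycle (@pi1U_proj k kb X x U) b.
  split=> [m|u v].
    rewrite /= /quotient_open; have -> : (fun g => b (left_coset U g) = m) =
        (fun g => a g = m) by apply/funext => g; rewrite bE.
    exact: ao.
  rewrite -(Defs.coset_reprK u) -(Defs.coset_reprK v) [tg_mul _ _]quotient_mulE.
  by rewrite !bE aM (pi1U_proj_coset X_exact U_closed).
pose Q (beta : (pi1U U -> GP) -> Prop) := @H1_pi1U k kb X x U G beta /\
  @pullback k kb G (pi1U U) (pi1_group x) proj (left_coset U) beta =
    cohomologous proj a.
have exQ : exists beta, Q beta.
  exists (cohomologous (@pi1U_proj k kb X x U) b); split; first by exists b.
  rewrite pullback_class; last exact: (pi1U_proj_coset X_exact U_closed).
  by congr cohomologous; apply/funext => g; exact: bE.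
have [[b' [b'c dE]] dP] := choose_orP (fun=> False) exQ.
exists b'; split=> //; rewrite -dP /= dE.
exists b'; exact: cohomologous_refl.
Qed.
End Evaluation.

(** * From a section to diagonal classes *)

Section CtoA.
Variables (k : fieldType) (kb : alg_closure k) (X : kfun k) (x : X (cl_alg kb)).
Hypothesis X_exact : fundamental_sequence_exact x.
Variable U : normal_subgroup (pi1_group x).
Hypothesis U_closed : closed_geometric U.
Variables (I : Type) (e : I -> field_extension kb).
Variable sigma : forall i, gal_group (ext_cl (e i)) -> pi1_group (ext_point (e i) x).
Hypothesis sigma_section : forall i, pi1_section (@sigma i).
Local Open Scope group_scope.
Let s i := section_map U (@sigma i).

Lemma section_map_proj i (g : gal_group (ext_cl (e i))) :
  pi1U_proj (s g) = gal_res g.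
Proof.
rewrite /s /section_map (pi1U_proj_coset X_exact U_closed).
exact: (pi1_proj_section X_exact (sigma_section i)).
Qed.

(** The required class is the pullback of [alpha] along the section. The conjugating element [a] has
    trivial Galois image, so it only changes the cocycle by the coboundary given by [b a]. *)
Lemma c_implies_a : assertion_c s -> assertion_a s.
Proof.
move=> [s0 [[s0c s0M] s0P] sE] G alpha Ha Ta.
have [b [bc dE _]] := deflationP X_exact U_closed Ha Ta.
have [bo bM] := bc.
exists (@cohomologous k kb G (gal_group kb) id (b \o s0)).
  exists (b \o s0); split=> //; split=> [m|g h]; first exact: (s0c _ (bo m)).
  by rewrite /= s0M bM s0P.
move=> i; rewrite /evaluation dE pullback_class; last exact: section_map_proj.
rewrite /field_restriction pullback_class //.
have [a [h ha] aE] := sE i.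
have pa : pi1U_proj a = gal_one kb.
  rewrite ha (pi1U_proj_coset X_exact U_closed).
  by have [_ kerE _] := X_exact; apply/kerE; exists h.
have p1 : @pi1U_proj k kb X x U tg_one = gal_one kb.
  by rewrite (pi1U_proj_coset X_exact U_closed) (pi1_proj1 X_exact).
have pV : pi1U_proj (tg_inv a) = gal_one kb.
  have := pi1U_projM X_exact U_closed (tg_inv a) a.
  rewrite tg_mulV p1 pa => e1; rewrite [RHS]e1; exact/esym/(@tg_mulr1 (gal_group kb)).
have bV : b (tg_inv a) = (b a)^-1.
  apply: (@mulgI _ (b a)); rewrite mulgV -(cocycle1 p1 bc).
  by rewrite -(tg_mulrV a) bM pa gal_act_one.
apply/esym/cohomologous_class; exists (b a)^-1 => g.
rewrite /= aE !bM pa gal_act_one bV invgK; congr (_ * gal_act _ _).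
rewrite pi1U_projM // pa s0P; exact: (@tg_mul1 (gal_group kb)).
Qed.
End CtoA.

Lemma morph_tg1 (P : top_group) (M : finGroupType) (pi : P -> M) :
  {morph pi : g h / tg_mul g h >-> (g * h)%g} -> pi tg_one = 1%g.
Proof.
by move=> piM; apply: (@mulgI _ (pi tg_one)); rewrite -piM tg_mul1 mulg1.
Qed.

Lemma morph_tgV (P : top_group) (M : finGroupType) (pi : P -> M) g :
  {morph pi : g h / tg_mul g h >-> (g * h)%g} -> pi (tg_inv g) = (pi g)^-1%g.
Proof.
move=> piM; apply: (@mulgI _ (pi g)).
by rewrite -piM tg_mulrV morph_tg1 // mulgV.
Qed.

(** * Lifting sections to finite quotients *)

Section Lift.
Variables (k : fieldType) (kb : alg_closure k).
Hypothesis k_char0 : [pchar k] =i pred0.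
Variables (X : kfun k) (x : X (cl_alg kb)).
Hypothesis X_exact : fundamental_sequence_exact x.
Variable U : normal_subgroup (pi1_group x).
Hypothesis U_closed : closed_geometric U.
Variables (I : Type) (e : I -> field_extension kb).
Variable sigma : forall i, gal_group (ext_cl (e i)) -> pi1_group (ext_point (e i) x).
Hypothesis sigma_section : forall i, pi1_section (@sigma i).
Local Open Scope group_scope.
Notation P := (pi1_group x).
Notation proj := (@pi1_proj k kb X x : pi1_group x -> gal kb).
Let s i := section_map U (@sigma i).
Notation s_lift i g := (pi1_map (@sigma i g) : pi1_group x).

Lemma projM (g h : P) : proj (tg_mul g h) = gal_mul (proj g) (proj h).
Proof. exact: (pi1_projM X_exact). Qed.

Lemma projV (g : P) : proj (tg_inv g) = gal_inv (proj g).
Proof. exact: (pi1_projV X_exact). Qed.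

Lemma gal_mulg1 (g : gal kb) : gal_mul g (gal_one kb) = g.
Proof. exact: (@tg_mulr1 (gal_group kb)). Qed.

Section Level.
Variables (l : seq (etale_cover X)) (M : finGroupType) (pi : P -> M).
Hypothesis piM : {morph pi : g h / tg_mul g h >-> (g * h)%g}.
Hypothesis piP : forall g h, pi g = pi h <-> level_set U l (tg_mul (tg_inv g) h).

Lemma level_agree g h : agree l g h -> pi g = pi h.
Proof.
move=> gh; apply/piP; exists tg_one; first exact: ns1.
by move=> Y Yl y /=; rewrite -gh // pi1_actK.
Qed.

Lemma level_U u : U u -> pi u = 1.
Proof.
move=> Uu; rewrite -(morph_tg1 piM); apply/esym/piP.
have -> : tg_mul (tg_inv tg_one) u = u :> P.
  by rewrite -[u in LHS]tg_mul1 tg_mulKV.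
by exists u.
Qed.

Lemma level_coset g h : left_coset U g = left_coset U h -> pi g = pi h.
Proof.
move=> /coset_eq /level_U; rewrite piM morph_tgV // => gh.
by rewrite -[RHS](mulKVg (pi g)) gh mulg1.
Qed.

Lemma level_open m : @tg_open P (fun g => pi g = m).
Proof. exact: (locally_constant_open level_agree). Qed.

Variable s0 : gal_group kb -> pi1U U.
Hypothesis s0_section : pi1U_section s0.

Let t0 g : P := coset_repr (s0 g).
(** The representatives [t0] need not be multiplicative, but [tau] is, because [pi] factors through
    the quotient by [U]. *)
Let tau g : M := pi (t0 g).

Lemma proj_t0 g : proj (t0 g) = g.
Proof. exact: s0_section.2. Qed.

Lemma tauM g h : tau (gal_mul g h) = tau g * tau h.
Proof.
rewrite -piM; apply: level_coset; rewrite /t0 Defs.coset_reprK.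
by have [[_ sM] _] := s0_section; rewrite [LHS]sM.
Qed.

Lemma tau1 : tau (gal_one kb) = 1.
Proof. by apply: (@mulgI _ (tau (gal_one kb))); rewrite -tauM mulg1 gal_mulg1. Qed.

Lemma tau_open m : @tg_open (gal_group kb) (fun g => tau g = m).
Proof.
have [[sc _] _] := s0_section.
apply: (sc (fun u => pi (coset_repr u) = m)); rewrite /= /quotient_open.
have -> : (fun g : P => pi (coset_repr (left_coset U g)) = m) =
    (fun g => pi g = m).
  apply/funext => g; congr (_ = m); apply: level_coset.
  exact: Defs.coset_reprK.
exact: level_open.
Qed.

Lemma tau_locally_constant : exists sq : seq kb, forall g h : gal kb,
  {in sq, forall a, g a = h a} -> tau g = tau h.
Proof.
have [n [a aP]] := tau_open tau1.
exists [seq a i | i <- enum 'I_n] => g h gh.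
have e1 : tau (gal_mul (gal_inv g) h) = 1.
  apply: aP => i; rewrite -[LHS]/(gal_inv g (h (a i))) -gh; last first.
    by apply: map_f; rewrite mem_enum.
  by rewrite -[LHS]/(gal_mul (gal_inv g) g (a i)) gal_mulVg.
rewrite -[h in RHS](gal_mul1g h) -(gal_mulgV g) -gal_mulA tauM e1 mulg1 //.
Qed.

(** The image of the geometric fundamental group, which exactness identifies with the kernel of
    [proj]. *)
Let K : {set M} := [set m | `[< exists w : P, proj w = gal_one kb /\ pi w = m >]].

Lemma K_group_set : group_set K.
Proof.
apply/group_setP; split.
  rewrite inE; apply/asboolP; exists tg_one; split; last exact: morph_tg1.
  exact: (pi1_proj1 X_exact).
move=> m n; rewrite !inE => /asboolP [v [v1 <-]] /asboolP [w [w1 <-]].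
apply/asboolP; exists (tg_mul v w); split; last exact: piM.
by rewrite projM v1 w1 gal_mulg1.
Qed.
Let Kg : {group M} := Group K_group_set.
Let H : finGroupType := subg_of Kg.
Let iota (h : H) : M := sgval h.

Lemma iota_inj : injective iota.
Proof. exact: val_inj. Qed.

Lemma iotaM : {morph iota : a b / a * b}.
Proof. by []. Qed.

Lemma iota_subg (w : P) : proj w = gal_one kb -> iota (subg Kg (pi w)) = pi w.
Proof.
by move=> w1; apply: subgK; rewrite inE; apply/asboolP; exists w.
Qed.

Lemma iota_lift (h : H) : exists2 w : P, proj w = gal_one kb & pi w = iota h.
Proof.
have : iota h \in Kg by exact: subgP.
by rewrite inE => /asboolP [w [w1 wh]]; exists w.
Qed.

Let act (g : gal kb) (h : H) : H := subg Kg (tau g * iota h * (tau g)^-1).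

Lemma iota_act g h : iota (act g h) = tau g * iota h * (tau g)^-1.
Proof.
rewrite /act; have [w w1 <-] := iota_lift h.
rewrite /tau -morph_tgV // -!piM iota_subg //.
by rewrite !projM w1 projV proj_t0 gal_mulg1 gal_mulgV.
Qed.

Let aH (w : P) : H := subg Kg (pi w * (tau (proj w))^-1).

Lemma iota_aH w : iota (aH w) = pi w * (tau (proj w))^-1.
Proof.
rewrite /aH /tau -morph_tgV // -!piM iota_subg //.
by rewrite projM projV proj_t0 gal_mulgV.
Qed.

(* The cocycle [w |-> pi w * (tau (proj w))^-1] takes its values in the image
   [H] of the geometric fundamental group, on which the Galois group acts by
   conjugation through [tau]; a class [d] on the base field with the same
   evaluations turns [tau] into the lift [d * tau]. *)
Lemma level_lift : assertion_a'' s ->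
  exists Xl : gal kb -> P,
  [/\ forall g, proj (Xl g) = g,
      forall g h, pi (Xl (gal_mul g h)) = pi (Xl g) * pi (Xl h),
      forall m, @tg_open (gal_group kb) (fun g => pi (Xl g) = m) &
      forall i, exists2 v : P, proj v = gal_one kb & forall g,
        pi (s_lift i g) = pi v * pi (Xl (gal_res g)) * (pi v)^-1].
Proof.
move=> a''.
have actM g h t : act (gal_mul g h) t = act g (act h t).
  by apply: iota_inj; rewrite !iota_act tauM invMg !mulgA.
have act1 t : act (gal_one kb) t = t.
  by apply: iota_inj; rewrite iota_act tau1 invg1 mul1g mulg1.
have act_morph g : {morph act g : a b / a * b}.
  by move=> a b; apply: iota_inj; rewrite iotaM !iota_act iotaM !mulgA mulgKV.
have [sq sqP] := tau_locally_constant.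
have act_open : exists sq : seq kb, forall g : gal kb,
    {in sq, forall a, g a = a} -> forall t, act g t = t.
  exists sq => g gsq t; apply: iota_inj; rewrite iota_act.
  by rewrite (sqP g (gal_one kb)) // tau1 invg1 mul1g mulg1.
have [G [ev [evI evS evM evA _]]] := twisted_form k_char0 actM act1 act_morph act_open.
have ev1 : ev 1 = 1 by apply: (@mulgI _ (ev 1)); rewrite -evM !mulg1.
have evV h : ev h^-1 = (ev h)^-1.
  by apply: (@mulgI _ (ev h)); rewrite -evM !mulgV.
pose a (w : P) := ev (aH w).
have ac : cocycle proj a.
  split=> [m|g h].
    have [l' l'P] := pi1_proj_continuous X_exact sq.
    apply: (@locally_constant_open _ _ _ x _ a (l ++ l')) => g h gh.
    congr ev; apply: iota_inj; rewrite !iota_aH.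
    rewrite (sqP (proj g) (proj h)) ?(@level_agree g h) //.
      by apply: agree_sub gh => Y Yl; apply/in_list_cat; left.
    by apply: l'P; apply: agree_sub gh => Y Yl; apply/in_list_cat; right.
  rewrite /a evA -evM; congr ev; apply: iota_inj.
  rewrite iotaM iota_act !iota_aH projM tauM piM invMg !mulgA.
  by rewrite mulgKV.
pose alpha := cohomologous proj a.
have Ha : @H1_scheme k kb X x G alpha by exists a.
have Ta : trivial_on_U U (geom_restriction alpha).
  exists (a \o @geom_pi1_map k kb X x).
    by exists a; exact: cohomologous_refl.
  move=> h Uh; rewrite /= /a -ev1; congr ev; apply: iota_inj.
  by rewrite iota_aH (pi1_projU X_exact U_closed Uh) tau1 level_U // invg1 mulg1.
have Sa : surjective_class (geom_restriction alpha).
  exists (a \o @geom_pi1_map k kb X x).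
    by exists a; exact: cohomologous_refl.
  move=> m; have [h <-] := evS m; have [w w1 wh] := iota_lift h.
  have [_ kerE _] := X_exact; have /kerE [u uw] := w1.
  exists u; rewrite /= /a; congr ev; apply: iota_inj.
  by rewrite iota_aH uw w1 tau1 invg1 mulg1.
have [c [c0 [[c0o c0M] cE]] evalE] := a'' G alpha Ha Ta Sa.
have [b [bc dE [m bE]]] := deflationP X_exact U_closed Ha Ta.
have dex g : exists h, ev h = c0 g by exact: evS.
pose d g := projT1 (cid (dex g)).
have dP g : ev (d g) = c0 g by exact: projT2 (cid (dex g)).
have dM g h : d (gal_mul g h) = d g * act g (d h).
  by apply: evI; rewrite evM -evA !dP; exact: c0M.
pose t g := iota (d g) * tau g.
have tM g h : t (gal_mul g h) = t g * t h.
  by rewrite /t dM iotaM iota_act tauM !mulgA mulgKV.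
have lift g : exists w : P, proj w = g /\ pi w = t g.
  have [w w1 wh] := iota_lift (d g); exists (tg_mul w (t0 g)).
  by rewrite projM w1 proj_t0 gal_mul1g piM wh.
pose Xl g := projT1 (cid (lift g)).
have XlP g : proj (Xl g) = g /\ pi (Xl g) = t g by exact: projT2 (cid (lift g)).
exists Xl; split=> [g|g h|n|i]; first exact: (XlP g).1.
- by rewrite !(XlP _).2 tM.
- have -> : (fun g => pi (Xl g) = n) = (fun g => exists2 V : gal kb -> Prop,
      (exists h, V = fun g => d g = h /\ tau g = (iota h)^-1 * n) & V g).
    apply/funext => g; apply/propext; rewrite (XlP g).2; split=> [tn|[V [h ->] [dh th]]].
      exists (fun g' => d g' = d g /\ tau g' = (iota (d g))^-1 * n).
        by exists (d g).
      by split=> //; rewrite -tn mulKg.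
    by rewrite /t dh th mulKVg.
  apply: (@tg_openU (gal_group kb)) => V [h ->].
  apply: (@tg_openI (gal_group kb)); last exact: tau_open.
  have -> : (fun g => d g = h) = (fun g => c0 g = ev h).
    apply/funext => g; apply/propext; rewrite -dP.
    by split=> [->|/evI].
  exact: c0o.
have := evalE i; rewrite /evaluation dE pullback_class; last first.
  exact: (section_map_proj X_exact U_closed sigma_section).
rewrite /field_restriction cE pullback_class // => /cohomologous_classE [n bn].
(* [m] carries [a] to the inflation of [b], and [n] carries the evaluation of [b] to the restriction
   of [c0]. Their product comes from some [r] in [H], and a geometric lift of [r] is the conjugating
   element. *)
have [r rE] := evS (m * n).
have [v v1 vr] := iota_lift r.
exists v => // g; rewrite (XlP _).2 vr.
have pg := pi1_proj_section X_exact (sigma_section i) g.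
have := bn g; rewrite /= -[s g]/(left_coset U (s_lift i g)).
have := bE (s_lift i g); rewrite /= => -> /=.
rewrite pg -dP /a => dE'.
have dr : d (gal_res g) = r^-1 * aH (s_lift i g) * act (gal_res g) r.
  apply: evI; rewrite dE' !evM evV -evA rE gal_actM invMg !mulgA.
  by [].
rewrite /t dr !iotaM iota_act iota_aH pg.
have iV h : iota h^-1 = (iota h)^-1 by [].
by rewrite iV !mulgA mulgV mul1g !mulgKV mulgK.
Qed.
End Level.
End Lift.

(** * The limit section *)

Lemma uf_finite_set (J : Type) (D : (J -> Prop) -> Prop) (T : Type)
    (A : set T) (f : J -> T) :
  ultrafilter D -> finite_set A -> D (fun j => A (f j)) ->
  exists t, D (fun j => f j = t).
Proof.
move=> uD /(@finite_seqP {classic T}) [s AE] Ds.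
apply: (@uf_seq _ _ uD {classic T} s f).
by apply: (ufS uD _ Ds) => j; rewrite AE.
Qed.

Section Limit.
Variables (k : fieldType) (kb : alg_closure k).
Hypothesis k_char0 : [pchar k] =i pred0.
Variables (X : kfun k) (x : X (cl_alg kb)).
Hypothesis X_exact : fundamental_sequence_exact x.
Variable U : normal_subgroup (pi1_group x).
Hypothesis U_closed : closed_geometric U.
Variables (I : Type) (e : I -> field_extension kb).
Variable sigma : forall i, gal_group (ext_cl (e i)) -> pi1_group (ext_point (e i) x).
Hypothesis sigma_section : forall i, pi1_section (@sigma i).
Local Open Scope group_scope.
Notation P := (pi1_group x).
Notation proj := (@pi1_proj k kb X x : pi1_group x -> gal kb).
Let s i := section_map U (@sigma i).
Notation s_lift i g := (pi1_map (@sigma i g) : pi1_group x).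

(* Homomorphisms to [M] are cocycles with values in a constant group scheme: the
   finiteness of the diagonal fibres leaves finitely many classes, each of which
   is a finite set of conjugate homomorphisms. *)
Lemma uf_hom_constant (M : finGroupType) (pi : P -> M) (J : Type)
    (D : (J -> Prop) -> Prop) (Y : J -> gal kb -> P) :
  ultrafilter D -> finite_diagonal_fibres e ->
  D (fun j => [/\ forall g h, pi (Y j (gal_mul g h)) = pi (Y j g) * pi (Y j h),
      forall m, @tg_open (gal_group kb) (fun g => pi (Y j g) = m) &
      forall i, exists v : M, forall g,
        pi (s_lift i g) = v * pi (Y j (gal_res g)) * v^-1]) ->
  exists T : gal kb -> M, D (fun j => forall g, pi (Y j g) = T g).
Proof.
move=> uD fin DY; pose act (g : gal kb) (h : M) := h.
have [||||G [ev [evI evS evM evA cst]]] := @twisted_form k kb k_char0 M act => //.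
  by exists [::].
have {}cst := cst (fun _ _ => erefl).
have trv g m : gal_act g (m : geom_points kb G) = m.
  by have [h <-] := evS m; rewrite evA.
have ev1 : ev 1 = 1 by apply: (@mulgI _ (ev 1)); rewrite -evM !mulg1.
have evV h : ev h^-1 = (ev h)^-1.
  by apply: (@mulgI _ (ev h)); rewrite -evM !mulgV.
pose c j (g : gal_group kb) := ev (pi (Y j g)).
pose C j : (gal kb -> geom_points kb G) -> Prop :=
  @cohomologous k kb G (gal_group kb) id (c j).
pose b i := @cohomologous k kb G (gal_group (ext_cl (e i))) (@gal_res k kb (e i))
  (fun g => ev (pi (s_lift i g))).
have [|C0 DC] := @uf_finite_set J D ((gal kb -> geom_points kb G) -> Prop) _ C
  uD (fin G cst b).
  apply: (ufS uD _ DY) => j [YM Yo Yv]; split=> [|i].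
    exists (c j); split=> //; split=> [m|g h]; last by rewrite trv -evM -YM.
    have [h <-] := evS m.
    have -> : (fun g => c j g = ev h) = (fun g => pi (Y j g) = h).
      by apply/funext => g; apply/propext; rewrite /c; split=> [/evI|->].
    exact: Yo.
  rewrite /field_restriction pullback_class //.
  have [v vE] := Yv i; apply: cohomologous_class; exists (ev v)^-1 => g.
  by rewrite trv vE !evM evV invgK.
have [j0 Cj0] := uf_ex uD DC.
(* All classes now coincide with that of [j0]; the conjugating element ranges over the finite group
   [M], so it too is constant along the ultrafilter. *)
have [|m Dm] := @uf_pick J D M (fun j m => forall g,
    pi (Y j g) = m^-1 * pi (Y j0 g) * m) uD (finitary_fin M).
  apply: (ufS uD _ DC) => j; rewrite -Cj0 => Cj.
  have [m mE] := @cohomologous_classE k kb G (gal_group kb) id (c j0) (c j) (esym Cj).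
  have [h hm] := evS m; exists h => g; apply: evI.
  by rewrite !evM evV hm; have := mE g; rewrite trv.
by exists (fun g => m^-1 * pi (Y j0 g) * m).
Qed.

Lemma a''_implies_c : (exists s0 : gal_group kb -> pi1U U, pi1U_section s0) ->
  finite_diagonal_fibres e -> assertion_a'' s -> assertion_c s.
Proof.
move=> [s0 s0P] fin a''.
have Mex l := level_exists U l.
pose M l : finGroupType := projT1 (cid (Mex l)).
pose pi l : P -> M l := projT1 (cid (projT2 (cid (Mex l)))).
have piMP l : {morph pi l : g h / tg_mul g h >-> g * h} /\
    forall g h, pi l g = pi l h <-> level_set U l (tg_mul (tg_inv g) h).
  exact: projT2 (cid (projT2 (cid (Mex l)))).
have piM l := (piMP l).1; have piP l := (piMP l).2.
have Xex l := level_lift k_char0 X_exact U_closed sigma_section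
  (piM l) (piP l) s0P a''.
pose Y l : gal kb -> P := projT1 (cid (Xex l)).
have YP l : [/\ forall g, proj (Y l g) = g,
      forall g h, pi l (Y l (gal_mul g h)) = pi l (Y l g) * pi l (Y l h),
      forall m, @tg_open (gal_group kb) (fun g => pi l (Y l g) = m) &
      forall i, exists2 v : P, proj v = gal_one kb & forall g,
        pi l (s_lift i g) = pi l v * pi l (Y l (gal_res g)) * (pi l v)^-1].
  exact: projT2 (cid (Xex l)).
have pi_sub l l' g h : sub_list l l' -> pi l' g = pi l' h -> pi l g = pi l h.
  by move=> ll' /piP gh; apply/piP; exact: level_set_sub gh.
have pi_agree l g h : agree l g h -> pi l g = pi l h.
  exact: (level_agree (piP l)).
have piV l g : pi l (tg_inv g) = (pi l g)^-1 by exact: morph_tgV.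
have pi_eq g h : (forall l, pi l g = pi l h) -> left_coset U g = left_coset U h.
  by move=> gh; apply/coset_eq/(level_cap U_closed) => l; apply/piP.
pose V l i : P := projT1 (cid2 (let: And4 _ _ _ Yv := YP l in Yv i)).
have VP l i : proj (V l i) = gal_one kb /\ forall g,
    pi l (s_lift i g) = pi l (V l i) * pi l (Y l (gal_res g)) * (pi l (V l i))^-1.
  by rewrite /V; case: cid2.
have [D uD Dl] := list_ultrafilter (etale_cover X).
(* When [l'] contains [l], the map [Y l'] is multiplicative modulo [l] as well. The gain is
   uniformity: one large set of [l'] serves all [g] at once. *)
have Dconst l : exists T : gal kb -> M l, D (fun l' => forall g, pi l (Y l' g) = T g).
  apply: uf_hom_constant => //; apply: (ufS uD _ (Dl l)) => l' ll'.
  have [_ YM Yo Yv] := YP l'; split=> [g h|m|i].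
  - by rewrite -piM; apply: (pi_sub _ _ _ _ ll'); rewrite piM YM.
  - have -> : (fun g => pi l (Y l' g) = m) = (fun g => exists2 W,
        (exists2 h, pi l (Y l' h) = m & W = fun g => pi l' (Y l' g) = pi l' (Y l' h)) &
        W g).
      apply/funext => g; apply/propext; split=> [gm|[W [h <- ->]]].
        by exists (fun g' => pi l' (Y l' g') = pi l' (Y l' g)) => //; exists g.
      exact: pi_sub.
    by apply: (@tg_openU (gal_group kb)) => W [h _ ->]; exact: Yo.
  - exists (pi l (V l' i)) => g; rewrite -piV -!piM.
    by apply: (pi_sub _ _ _ _ ll'); rewrite !piM piV; exact: (VP l' i).2.
have Zex g := pi1_ulim uD (fun l => Y l g).
pose Z g : P := projT1 (cid (Zex g)).
have ZP l g : D (fun l' => agree l (Y l' g) (Z g)).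
  by apply: (uf_agree uD); exact: projT2 (cid (Zex g)).
(* Modulo [l], the pointwise limit [Z] thus coincides with a single [Y l'], from which it inherits
   multiplicativity and continuity. *)
have ZT l : exists T : gal kb -> M l, (D (fun l' => forall g, pi l (Y l' g) = T g)) /\
    forall g, pi l (Z g) = T g.
  have [T DT] := Dconst l; exists T; split=> // g.
  have [l' [/pi_agree <- ->]] := uf_ex uD (ufI uD (ZP l g) DT); by [].
(* Continuity of [proj] lets the projection pass to ultralimits, both for the lifts and for the
   conjugating elements. *)
have proj_lim (eta : seq (etale_cover X) -> P) (z : P) g :
    (forall l, D (fun l' => agree l (eta l') z)) -> (forall l, proj (eta l) = g) ->
    proj z = g.
  move=> lim etag; apply: gal_eq => a.
  have [l lP] := pi1_proj_continuous X_exact [:: a].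
  have [l' /lP la] := uf_ex uD (lim l).
  by rewrite -(la a (mem_head _ _)) etag.
have Zproj g : proj (Z g) = g.
  by apply: (proj_lim (fun l => Y l g)) => [l|l]; [exact: ZP|have [] := YP l].
have ZM l g h : pi l (Z (gal_mul g h)) = pi l (Z g) * pi l (Z h).
  have [T [DT TE]] := ZT l; rewrite !TE.
  have [l' [ll' lT]] := uf_ex uD (ufI uD (Dl l) DT).
  rewrite -!lT -piM; apply: (pi_sub _ _ _ _ ll'); rewrite piM.
  by have [_ + _ _] := YP l'; apply.
have Zo l m : @tg_open (gal_group kb) (fun g => pi l (Z g) = m).
  have [T [DT TE]] := ZT l; have [l' [ll' lT]] := uf_ex uD (ufI uD (Dl l) DT).
  have -> : (fun g => pi l (Z g) = m) = (fun g => exists2 W,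
      (exists2 h, pi l (Y l' h) = m & W = fun g => pi l' (Y l' g) = pi l' (Y l' h)) &
      W g).
    apply/funext => g; apply/propext; rewrite TE -lT; split=> [gm|[W [h <- ->]]].
      by exists (fun g' => pi l' (Y l' g') = pi l' (Y l' g)) => //; exists g.
    exact: pi_sub.
  apply: (@tg_openU (gal_group kb)) => W [h _ ->].
  by have [_ _ + _] := YP l'; apply.
exists (fun g => left_coset U (Z g)).
  split; first split.
  - move=> O Oo g Og; have [l lP] := open_level Oo Og.
    have [n [a aP]] := Zo l (pi l (Z g)) g erefl.
    exists n, a => h /aP gh; apply: lP; apply/piP; exact/esym.
  - move=> g h; rewrite [RHS]quotient_mulE; apply: pi_eq => l.
    by rewrite piM; exact: ZM.
  by move=> g; rewrite (pi1U_proj_coset X_exact U_closed).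
(* The limit of the conjugating elements [V l i] conjugates correctly modulo every [l], hence modulo
   [U]. *)
move=> i; have [w wP] := pi1_ulim uD (fun l => V l i).
have wlim l : D (fun l' => agree l (V l' i) w) by apply: uf_agree.
have w1 : proj w = gal_one kb.
  by apply: (proj_lim (fun l => V l i)) => // l; exact: (VP l i).1.
exists (left_coset U w).
  by have [_ kerE _] := X_exact; have /kerE [h <-] := w1; exists h.
move=> g; rewrite [RHS](congr1 (fun u => quotient_mul u _) (quotient_mulE _ _ _)).
rewrite [X in quotient_mul _ X]quotient_invE quotient_mulE; apply: pi_eq => l.
have [l' [ll' [lw lZ]]] := uf_ex uD (ufI uD (Dl l) (ufI uD (wlim l) (ZP l (gal_res g)))).
rewrite !piM piV -(pi_agree _ _ _ lw) -(pi_agree _ _ _ lZ) -piV -!piM.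
by apply: (pi_sub _ _ _ _ ll'); rewrite !piM piV; exact: (VP l' i).2.
Qed.
End Limit.

Theorem proposition1p2
  (k : fieldType) (k_char0 : [pchar k] =i pred0) (kb : alg_closure k)
  (X : kfun k) (X_variety : variety X)
  (X_connected : geometrically_connected kb X) (x : X (cl_alg kb))
  (X_exact : fundamental_sequence_exact x)
  (U : normal_subgroup (pi1_group x)) (U_closed : closed_geometric U)
  (I : Type) (e : I -> field_extension kb)
  (sigma : forall i, gal_group (ext_cl (e i)) -> pi1_group (ext_point (e i) x))
  (sigma_section : forall i, pi1_section (sigma i)) :
  let s i := section_map U (sigma i) in
  [/\ assertion_c s -> assertion_a s,
      assertion_a s -> assertion_a'' s &
      (exists s0 : gal_group kb -> pi1U U, pi1U_section s0) ->
      finite_diagonal_fibres e ->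
      (assertion_a s <-> assertion_a'' s) /\
      (assertion_a'' s <-> assertion_c s)].
Proof.
move=> s.
have ca : assertion_c s -> assertion_a s by exact: c_implies_a.
have aa : assertion_a s -> assertion_a'' s by move=> a G alpha Ha Ta _; exact: a.
split=> // s0 fin.
have ac : assertion_a'' s -> assertion_c s by exact: a''_implies_c.
by split; split; [exact: aa|move=> /ac /ca|exact: ac|move=> /ca /aa].
Qed.
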